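(* Let $(a_n)_{n\in\mathbb{N}}$ be a sequence of natural numbers and let $(\tau_n)_{n\in\mathbb{N}}$ be a sequence of integers satisfying $$\tau_{k+1}\ \geq\ 3\,a_k\,|\tau_k|\quad\text{for all } k\in\mathbb{N},\qquad\text{and}\qquad \sum_{j=1}^{\infty}\frac{|a_j|\,|\tau_j|\,|a_{j+1}|}{|\tau_{j+1}|}<\infty .$$ Let $F$, $E$, $L^1_F(\mathbb{T}^{\mathbb{N}})$ and $L^1_E(\mathbb{T})$ be the sets and spaces associated with $(a_n)$ and $(\tau_n)$ as defined in the context. Then the operator $T: L^1_F(\mathbb{T}^{\mathbb{N}})\to L^1_E(\mathbb{T})$ given by the formula $$Tf(x)=\sum_{\lambda\in F}\widehat{f}(\lambda)\,e^{2\pi i\langle \lambda,\tau\rangle x},\qquad \langle\lambda,\tau\rangle=\sum_{k}\lambda_k\tau_k,$$ is an isomorphism. Moreover, $$K^{-1}\|f\|_{L^1_F(\mathbb{T}^{\mathbb{N}})}\ \leq\ \|Tf\|_{L^1_E(\mathbb{T})}\ \leq\ K\,\|f\|_{L^1_F(\mathbb{T}^{\mathbb{N}})}\qquad\text{for all } f\in L^1_F(\mathbb{T}^{\mathbb{N}}),$$ with a constant $K$ depending only on the value of $\sum_{j=1}^{\infty}\frac{|a_j||\tau_j||a_{j+1}|}{|\tau_{j+1}|}$.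
   Context: $\mathbb{T}=\mathbb{R}/\mathbb{Z}$ (identified with $[0,1)$) with normalized Lebesgue measure; $\mathbb{T}^{\mathbb{N}}$ is the countable product, a compact abelian group with normalized Haar (product) measure. The symbol $\mathbb{Z}^{\mathbb{N}}$ denotes the dual group of $\mathbb{T}^{\mathbb{N}}$, i.e. the integer sequences $\lambda=(\lambda_1,\lambda_2,\ldots)$ with only finitely many nonzero entries, $\lambda$ corresponding to the character $x\mapsto e^{2\pi i\sum_k\lambda_k x_k}$; $\widehat f$ denotes the Fourier transform. For a set $A$ of characters of $G$ ($G=\mathbb{T}$ or $G=\mathbb{T}^{\mathbb{N}}$), $L^1_A(G)=\{f\in L^1(G):\ \operatorname{supp}\widehat f\subset A\}$, a subspace of the Banach space $L^1(G)$, with the $L^1(G)$ norm. Given $(a_n)$ and $(\tau_n)$, define $$F=\{\lambda\in\mathbb{Z}^{\mathbb{N}}:\ |\lambda_n|\leq |a_n|\ \text{for all } n\},\qquad E=\Big\{\beta\in\mathbb{Z}:\ \beta=\sum_{k\ge1}\tau_k\lambda_k\ \text{for some } \lambda\in F\Big\}.$$ The formula for $T$ is literal when $f$ is a trigonometric polynomial; for general $f\in L^1_F(\mathbb{T}^{\mathbb{N}})$ the series is understood as the Fourier series of $Tf$, i.e. $T$ is the continuous extension of the operator defined on trigonometric polynomials.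
   Formalization: The formal theorem assumes that the first integer τ_1 is nonzero (for τ_1 = 0, f = e^{2πi x_1} − 1 is a nonzero element of L^1_F with Tf = 0, so the claim fails), and reads ''natural numbers a_n'' as a_n ≥ 1. *)

(* Defs.v *)
From HB Require Import structures.
From mathcomp Require Import all_boot all_order all_algebra.
From mathcomp Require Import finmap complex.
From mathcomp Require Import all_classical all_reals all_analysis.
From mathcomp Require Import measurable_realfun.

Set Implicit Arguments.
Unset Strict Implicit.
Unset Printing Implicit Defensive.

Import Order.TTheory GRing.Theory Num.Theory.
Import numFieldNormedType.Exports.

Local Open Scope classical_set_scope.
Local Open Scope ring_scope.

(* Countable product of a measurable space, with the sigma-algebra generated by
   the coordinate maps. *)
Definition seq_coord_sets d (T : measurableType d) : set (set (nat -> T)) :=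
  [set A | exists n (B : set T), measurable B /\ A = (fun x => x n) @^-1` B].

Notation seqspace T := (g_sigma_algebraType (@seq_coord_sets _ T)).

Lemma measurable_coord d (T : measurableType d) n :
  measurable_fun [set: seqspace T] (fun x => x n).
Proof.
by move=> _ B mB; rewrite setTI; apply: sub_sigma_algebra; exists n, B.
Qed.

Lemma measurable_fun_seqspace d (T : measurableType d) d' (S : measurableType d')
    (h : S -> seqspace T) :
  (forall n, measurable_fun setT (fun s => h s n)) ->
  @measurable_fun _ _ S (seqspace T) setT h.
Proof.
move=> mh; apply: (@measurability _ _ _ (seqspace T) _ _ (@seq_coord_sets _ T)).
  by [].
move=> _ [_ [n [B [mB ->]]] <-].
by rewrite setTI -[X in measurable X]setTI; exact: (mh n).
Qed.

Section cylinders.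
Context d (T : measurableType d).
Implicit Types A B : set (seqspace T).

Definition depends_on_first n A :=
  forall x y : seqspace T, (forall i, (i < n)%N -> x i = y i) -> A x -> A y.

Definition cylinder A := measurable A /\ exists n, depends_on_first n A.

Lemma depends_on_firstW n m A : (n <= m)%N ->
  depends_on_first n A -> depends_on_first m A.
Proof.
by move=> nm dA x y xy; apply: dA => i ni; apply: xy; exact: leq_trans nm.
Qed.

Let cyl0 : cylinder set0.
Proof. by split => //; exists 0%N. Qed.

Let cylU : setU_closed cylinder.
Proof.
move=> A B [mA [n nA]] [mB [m nB]]; split; first exact: measurableU.
exists (maxn n m) => x y xy [Ax|Bx]; [left; move: Ax|right; move: Bx].
  by apply: nA => i ni; apply: xy; rewrite leq_max ni.
by apply: nB => i ni; apply: xy; rewrite leq_max ni orbT.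
Qed.

Let cylC : setC_closed cylinder.
Proof.
move=> A [mA [n nA]]; split; first exact: measurableC.
by exists n => x y xy Ax /(nA y x) Ay; apply/Ax/Ay => i /xy.
Qed.

Definition cylinder_display : measure_display. Proof. by constructor. Qed.

Definition cylspace := (nat -> T).
HB.instance Definition _ := Pointed.on cylspace.
HB.instance Definition _ := @isAlgebraOfSets.Build cylinder_display
  cylspace cylinder cyl0 cylU cylC.

End cylinders.

Section product_measure.
Context d (T : measurableType d) (R : realType) (P : probability T R).
Local Open Scope ereal_scope.
Local Notation X := (seqspace T).
Implicit Types (f g : X -> \bar R) (A B : set X) (x y : X) (n k m : nat).

Let upd n x (t : T) : X := fun i => if i == n then t else x i.
Let I n f x := \int[P]_t f (upd n x t).
Let Fixpoint J n k f {struct k} := if k is k'.+1 then I n (J n.+1 k' f) else f.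
Let dep n f := forall x y, (forall i, (i < n)%N -> x i = y i) -> f x = f y.
Let one A : X -> \bar R := fun x => (\1_A x)%:E.
Let good f := measurable_fun setT f /\ forall x, 0 <= f x.

Let measurable_upd n : measurable_fun setT (fun z : X * T => upd n z.1 z.2).
Proof.
apply: measurable_fun_seqspace => i; rewrite /upd; case: (i == n).
  exact: measurable_snd.
exact: (measurableT_comp (measurable_coord i) measurable_fst).
Qed.

Let measurable_updx n x : measurable_fun setT (upd n x).
Proof. exact: (measurableT_comp (measurable_upd n) (measurable_pair1 x)). Qed.

Let good_upd n x f : good f -> measurable_fun setT (fun t => f (upd n x t)).
Proof. by move=> [mf _]; exact: (measurableT_comp mf (measurable_updx n x)). Qed.

Let good_I n f : good f -> good (I n f).
Proof.
move=> [mf f0]; split; last by move=> x; apply: integral_ge0.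
apply: (@measurable_fun_fubini_tonelli_F _ _ X T R P
  (fun z => f (upd n z.1 z.2))) => //.
exact: (measurableT_comp mf (measurable_upd n)).
Qed.

Let good_J n k f : good f -> good (J n k f).
Proof. by elim: k n => [//|k ih] n gf /=; exact/good_I/ih. Qed.

Let good_one A : measurable A -> good (one A).
Proof.
move=> mA; split; last by move=> x; rewrite lee_fin.
by apply/measurable_EFinP; exact: measurable_indic.
Qed.

Let upd_eq n x t i : (i < n)%N -> upd n x t i = x i.
Proof. by rewrite /upd; case: eqP => // ->; rewrite ltnn. Qed.

Let depW n m f : (n <= m)%N -> dep n f -> dep m f.
Proof. by move=> nm df x y xy; apply: df => i ni; apply: xy; apply: leq_trans nm. Qed.

Let I_dep n f : dep n f -> I n f = f.
Proof.
move=> df; apply/funext => x; rewrite /I.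
rewrite (eq_integral (cst (f x))); last first.
  by move=> t _; apply: df => i; exact: upd_eq.
by rewrite integral_cst// [X in _ * X]probability_setT mule1.
Qed.

Let dep_I n f : dep n.+1 f -> dep n (I n f).
Proof.
move=> df x y xy; apply: eq_integral => t _; apply: df => i.
by rewrite ltnS leq_eqVlt /upd; case: eqP => //= _ /xy.
Qed.

Let dep_J n k f : dep (n + k) f -> dep n (J n k f).
Proof.
elim: k n => [|k ih] n /=; first by rewrite addn0.
by rewrite -addSnnS => /ih /dep_I.
Qed.

Let J_stable n k m f : dep (n + k) f -> J n (k + m) f = J n k f.
Proof.
elim: k n => [|k ih] n.
  rewrite addn0 add0n /=; elim: m n => [//|m ih] n df /=.
  by rewrite ih ?I_dep//; apply: depW df.
by rewrite -addSnnS => /ih /= ->.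
Qed.

Let JD n k f g : good f -> good g ->
  J n k (fun x => f x + g x) = fun x => J n k f x + J n k g x.
Proof.
move=> gf gg; elim: k n => [//|k ih] n /=; rewrite ih.
have [mf f0] := good_J n.+1 k gf; have [mg g0] := good_J n.+1 k gg.
apply/funext => x; rewrite /I ge0_integralD//.
- exact: (good_upd _ _ (good_J n.+1 k gf)).
- exact: (good_upd _ _ (good_J n.+1 k gg)).
Qed.


Let dep_one n A : depends_on_first n A -> dep n (one A).
Proof.
move=> dA x y xy; rewrite /one !indicE; congr ((nat_of_bool _)%:R%:E).
apply/idP/idP => /set_mem ?; apply/mem_set; [exact: (dA x y)|].
by apply: (dA y x) => // i /xy.
Qed.

Let level A : nat :=
  if pselect (exists n, depends_on_first n A) is left h then projT1 (cid h)
  else 0%N.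

Let levelP A : cylinder A -> depends_on_first (level A) A.
Proof.
by move=> [_ h]; rewrite /level; case: pselect => // ?; case: cid.
Qed.

(* integral of the indicator function of a cylinder over all the coordinates
   of index >= n *)
Let E n A : X -> \bar R := J n (level A - n) (one A).

Let EE n k A : cylinder A -> depends_on_first (n + k) A -> E n A = J n k (one A).
Proof.
move=> cA dA.
have h j m : depends_on_first (n + j) A -> (j <= m)%N ->
    J n m (one A) = J n j (one A).
  by move=> dj jm; rewrite -(subnKC jm) J_stable//; exact: dep_one.
rewrite -(h k (maxn (level A - n) k)) ?leq_maxr//.
rewrite (h (level A - n)%N (maxn (level A - n) k)) ?leq_maxl//.
by apply: depends_on_firstW (levelP cA); rewrite -leq_subLR.
Qed.

Let ES n A : cylinder A -> E n A = I n (E n.+1 A).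
Proof.
move=> cA; have dA := levelP cA.
rewrite (@EE n (level A).+1)//; last first.
  by apply: depends_on_firstW dA; rewrite addnS leqW ?leq_addl.
rewrite (@EE n.+1 (level A))//.
by apply: depends_on_firstW dA; rewrite leq_addl.
Qed.

Let E_level n A : cylinder A -> depends_on_first n A -> E n A = one A.
Proof. by move=> cA dA; rewrite (@EE n 0)// addn0. Qed.

Let good_E n A : cylinder A -> good (E n A).
Proof. by move=> [mA _]; apply/good_J/good_one. Qed.

Let dep_E n A : cylinder A -> dep n (E n A).
Proof.
move=> cA; have dA := levelP cA.
apply/dep_J/dep_one; apply: depends_on_firstW dA.
by rewrite -leq_subLR.
Qed.

Let x0 : X := point.
Let c (A : set (cylspace T)) : \bar R := E 0 A x0.

Let c_ge0 A : 0 <= c A.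
Proof.
suff h k n x : 0 <= J n k (one A) x by exact: h.
elim: k n x => [|k ih] n x /=; first by rewrite lee_fin.
by apply: integral_ge0 => t _; exact: ih.
Qed.

Let c_additive2 : additive2 c.
Proof.
move=> A B cA cB AB0.
pose N := maxn (level A) (level B).
have dA : depends_on_first N A.
  by apply: depends_on_firstW (levelP cA); exact: leq_maxl.
have dB : depends_on_first N B.
  by apply: depends_on_firstW (levelP cB); exact: leq_maxr.
have cAB : cylinder (A `|` B) by exact: measurableU cA cB.
have dAB : depends_on_first N (A `|` B).
  by move=> x y xy [/(dA x y xy)|/(dB x y xy)]; [left|right].
rewrite /c (@EE 0 N (A `|` B))// (@EE 0 N A)// (@EE 0 N B)//.
rewrite (_ : one (A `|` B) = fun x => one A x + one B x); last first.
  apply/funext => x; rewrite /one -EFinD; congr (_%:E).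
  rewrite !indicE in_setU; have [/set_mem Ax|_] := boolP (x \in A) => /=.
    have [/set_mem Bx|_] := boolP (x \in B); last by rewrite addr0.
    by have : (A `&` B) x by []; rewrite AB0.
  by rewrite add0r.
by rewrite JD//; apply/good_one; [case: cA|case: cB].
Qed.

Let c0 : c set0 = 0.
Proof.
rewrite /c (@EE 0 0)//=; last exact: (@measurable0 _ (cylspace T)).
by rewrite /one indicE in_set0.
Qed.

Let c_semi_additive : measure_function.semi_additive c.
Proof. by apply/additive2P => //; exact: c_additive2. Qed.

HB.instance Definition _ := isContent.Build _ _ _ c c_ge0 c_semi_additive.

Let step n (A : set X) (F : (set X)^nat) x : cylinder A -> (forall i, cylinder (F i)) ->
  \sum_(i <oo) E n (F i) x < E n A x ->
  exists t, \sum_(i <oo) E n.+1 (F i) (upd n x t) < E n.+1 A (upd n x t).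
Proof.
move=> cA cF h; apply: contrapT => /forallNP H.
move: h; apply/negP; rewrite -leNgt ES//.
under eq_eseriesr do rewrite ES//.
rewrite /I -integral_nneseries//; last 2 first.
- by move=> i; exact: good_upd (good_E n.+1 (cF i)).
- by move=> i t _; have [_] := good_E n.+1 (cF i); exact.
apply: ge0_le_integral => //.
- by move=> t _; have [_] := good_E n.+1 cA; exact.
- exact: good_upd (good_E n.+1 cA).
- rewrite [X in measurable_fun _ X](_ : _ = fun t =>
      \sum_(i <oo | i \in xpredT) E n.+1 (F i) (upd n x t)); last first.
    by apply/funext => t; exact: eq_eseriesl.
  apply: ge0_emeasurable_sum.
  + by move=> i t _ _; have [_] := good_E n.+1 (cF i); exact.
  + by move=> i _; exact: good_upd (good_E n.+1 (cF i)).
- by move=> t _; rewrite leNgt; apply/negP/H.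
Qed.

Let c_sigma_subadditive : measurable_subset_sigma_subadditive c.
Proof.
move=> A F cF cA AF; rewrite leNgt; apply/negP => lt0.
have /choice[t tP] : forall nx : nat * X, exists t,
    \sum_(i <oo) E nx.1 (F i) nx.2 < E nx.1 A nx.2 ->
    \sum_(i <oo) E nx.1.+1 (F i) (upd nx.1 nx.2 t)
      < E nx.1.+1 A (upd nx.1 nx.2 t).
  move=> [n x] /=.
  have [h|h] := pselect (\sum_(i <oo) E n (F i) x < E n A x).
    by have [t ht] := step cA cF h; exists t.
  by exists point => /h.
pose fix y n : X := if n is m.+1 then upd m (y m) (t (m, y m)) else x0.
have yP n : \sum_(i <oo) E n (F i) (y n) < E n A (y n).
  by elim: n => [//|n ih]; exact: tP (n, y n) ih.
pose z : X := fun k => y k.+1 k.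
have yz n i : (i < n)%N -> y n i = z i.
  elim: n => [//|n ih]; rewrite ltnS leq_eqVlt => /predU1P[->//|ni].
  by rewrite /= upd_eq// ih.
have {yP}zP n : \sum_(i <oo) E n (F i) z < E n A z.
  have := yP n; rewrite (dep_E cA (yz n)).
  by under eq_eseriesr do rewrite (dep_E (cF _) (yz n)).
have Ege0 n i : 0 <= E n (F i) z by have [_] := good_E n (cF i); exact.
have Az : A z.
  have := zP (level A); rewrite (E_level cA (levelP cA)) /one indicE.
  case: (boolP (z \in A)) => [/set_mem//|_ /=].
  by rewrite ltNge nneseries_ge0.
have [i _ Fz] := AF _ Az.
pose N := maxn (level A) (level (F i)).
have := zP N; rewrite (@E_level N A)//; last first.
  by apply: depends_on_firstW (levelP cA); exact: leq_maxl.
rewrite /one indicE mem_set//= ltNge => /negP; apply.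
apply: (@le_trans _ _ (E N (F i) z)).
  rewrite E_level; [|exact: cF|]; last first.
    by apply: depends_on_firstW (levelP (cF i)); exact: leq_maxr.
  by rewrite /one indicE mem_set.
rewrite (@nneseriesD1 _ _ i) => [|k _|//]; last exact: Ege0.
by apply: leeDl; apply: nneseries_ge0 => k _ _; exact: Ege0.
Qed.

HB.instance Definition _ := Content_SigmaSubAdditive_isMeasure.Build _ _ _ c
  c_sigma_subadditive.

Let cylinder_coord n (B : set T) : measurable B ->
  cylinder ((fun x : X => x n) @^-1` B).
Proof.
move=> mB; split; last by exists n.+1 => x y /(_ n (ltnSn n)) /= ->.
by rewrite -[X in measurable X]setTI; exact: measurable_coord.
Qed.

Let gE : <<s @cylinder _ T >> = @measurable _ X.
Proof.
apply/seteqP; split.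
  by apply: smallest_sub; [exact: sigma_algebra_measurable|move=> A []].
apply: smallest_sub; first exact: smallest_sigma_algebra.
by move=> _ [n [B [mB ->]]]; apply: sub_sigma_algebra; exact: cylinder_coord.
Qed.

Let m (A : set X) : \bar R := measure_extension c A.

Let m0 : m set0 = 0. Proof. exact: measure0. Qed.

Let m_ge0 A : 0 <= m A. Proof. exact: measure_ge0. Qed.

Let m_sigma_additive : measure_function.semi_sigma_additive m.
Proof.
move=> F mF tF mUF; apply: (@measure_semi_sigma_additive _ _ _ (measure_extension c)) => //.
- by move=> i; have := mF i; rewrite -gE.
- by move: mUF; rewrite -gE.
Qed.

HB.instance Definition _ := isMeasure.Build _ _ _ m m0 m_ge0 m_sigma_additive.

Let mE A : cylinder A -> m A = c A.
Proof. by move=> cA; rewrite /m /measure_extension measurable_mu_extE. Qed.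

Let box (B : nat -> set T) n : set X := [set x | forall i, (i < n)%N -> B i (x i)].

Let cylinder_box (B : nat -> set T) n : (forall i, measurable (B i)) -> cylinder (box B n).
Proof.
move=> mB; split; last first.
  by exists n => x y xy Bx i ni; rewrite -xy//; exact: Bx.
rewrite (_ : box B n = \bigcap_(i < n) ((fun x : X => x i) @^-1` B i)); last first.
  by apply/seteqP; split => x Bx i; exact: Bx.
by apply: bigcap_measurableType => // i _; have [] := cylinder_coord i (mB i).
Qed.

Let J_box (B : nat -> set T) n k x : (forall i, measurable (B i)) ->
  J n k (one (box B (n + k))) x = one (box B n) x * \prod_(i < k) P (B (n + i)%N).
Proof.
move=> mB; elim: k n x => [|k ih] n x; first by rewrite addn0 big_ord0 mule1.
rewrite /= /I; under eq_integral do rewrite -addSnnS ih.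
rewrite big_ord_recl addn0 muleA.
rewrite [in RHS](eq_bigr (fun i : 'I_k => P (B (n.+1 + i)%N))); last first.
  by move=> i _; rewrite /= /bump /= addnA addn1.
set p := \prod_(i < k) _.
have p0 : 0 <= p by exact: prode_ge0.
rewrite ge0_integralZr//; last 2 first.
- exact: good_upd (good_one (cylinder_box n.+1 mB).1).
- by move=> t _; rewrite lee_fin.
congr (_ * _).
rewrite (eq_integral (fun t => one (box B n) x * (\1_(B n) t)%:E)); last first.
  move=> t _; rewrite /one -EFinM; congr (_%:E).
  rewrite !indicE -natrM mulnb; congr ((nat_of_bool _)%:R).
  apply/idP/andP => [/set_mem h|[/set_mem h1 /set_mem h2]].
    split; apply/mem_set; last first.
      by have := h n (ltnSn n); rewrite /upd eqxx.
    by move=> i ni; have := h i (leqW ni); rewrite upd_eq.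
  apply/mem_set => i; rewrite ltnS leq_eqVlt => /predU1P[->|ni].
    by rewrite /upd eqxx.
  by rewrite upd_eq//; exact: h1.
rewrite ge0_integralZl//; last 2 first.
- by apply/measurable_EFinP; exact: measurable_indic.
- by rewrite lee_fin.
by rewrite integral_indic// setIT.
Qed.

Let m_box (B : nat -> set T) n : (forall i, measurable (B i)) ->
  m (box B n) = \prod_(i < n) P (B i).
Proof.
move=> mB; have cB := cylinder_box n mB.
rewrite mE// /c (@EE 0%N n)//; last first.
  by move=> x y xy Bx i ni; rewrite -xy//; exact: Bx.
rewrite (J_box 0 n _ mB) [X in X * _](_ : _ = 1) ?mul1e//.
by rewrite /one indicE mem_set.
Qed.

Let m1 : m setT = 1.
Proof.
rewrite (_ : setT = box (fun=> setT) 0); first by rewrite m_box// big_ord0.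
by apply/seteqP; split.
Qed.

HB.instance Definition _ := Measure_isProbability.Build _ _ _ m m1.

(* Existence of the countable power of a probability measure P.  The product
   rule on finite-dimensional boxes determines it uniquely, by the pi-lambda
   theorem. *)
Lemma product_probability_exists : exists Q : probability X R,
  forall (B : nat -> set T) n, (forall i, measurable (B i)) ->
    Q [set x | forall i, (i < n)%N -> B i (x i)] = \prod_(i < n) P (B i).
Proof. by exists m => B n; exact: m_box. Qed.

(*END*)
End product_measure.

Definition product_probability d (T : measurableType d) (R : realType)
    (P : probability T R) : probability (seqspace T) R :=
  projT1 (cid (product_probability_exists P)).

Lemma product_probabilityE d (T : measurableType d) (R : realType)
    (P : probability T R) (B : nat -> set T) n :
  (forall i, measurable (B i)) ->
  product_probability P [set x | forall i, (i < n)%N -> B i (x i)] =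
  (\prod_(i < n) P (B i))%E.
Proof. by rewrite /product_probability; case: cid => Q /= h; exact: h. Qed.

Section haar_measures.
Variable R : realType.

(* The circle R/Z is identified with [0, 1): a function on it is represented by
   a function on R, considered up to null sets of the Lebesgue measure
   restricted to [0, 1). *)
Definition haarT : set (measurableTypeR R) -> \bar R :=
  mrestr lebesgue_measure (measurable_itv `[0%R, 1%R[).

HB.instance Definition _ := Measure.on haarT.

Let haarT_setT : haarT setT = 1%E.
Proof.
by rewrite /haarT /mrestr setTI lebesgue_measure_itv/= lte01 sube0.
Qed.

HB.instance Definition _ :=
  Measure_isProbability.Build _ _ _ haarT haarT_setT.

(* Likewise T^N is represented by real sequences; haarTN is carried by
   [0, 1)^N. *)
Definition torusN := seqspace (measurableTypeR R).

Definition haarTN : probability torusN R := product_probability haarT.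

End haar_measures.
Arguments haarT {R}.
Arguments haarTN {R}.

Local Open Scope complex_scope.

Section complex_L1.
Context d (X : measurableType d) (R : realType) (mu : {measure set X -> \bar R}).
Implicit Types f g : X -> R[i].

Definition cintegrable f :=
  mu.-integrable setT (fun x => (complex.Re (f x))%:E) /\
  mu.-integrable setT (fun x => (complex.Im (f x))%:E).

Definition cintegral f : R[i] :=
  (\int[mu]_x complex.Re (f x)) +i* (\int[mu]_x complex.Im (f x)).

Definition L1norm f : R := \int[mu]_x ComplexField.Normc.normc (f x).

Definition eq_ae f g := {ae mu, forall x, f x = g x}.

(* A family chi of characters indexed by the dual group I. *)
Context (I : choiceType) (chi : I -> X -> R[i]).

Definition fourier f (i : I) : R[i] := cintegral (fun x => f x * (chi i x)^*).

Definition L1_spectrum (A : set I) : set (X -> R[i]) :=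
  [set f | cintegrable f /\ [set i | fourier f i != 0] `<=` A].

End complex_L1.

Definition trig_polynomial (X : Type) (R : realType) (I : choiceType)
    (chi : I -> X -> R[i]) (f : X -> R[i]) :=
  exists (s : {fset I}) (c : I -> R[i]), f = fun x => \sum_(i <- s) c i * chi i x.

(* Operators between spaces V and W of integrable functions modulo a.e.
   equality, written on representatives. *)
Section L1_operators.
Context d (X : measurableType d) d' (Y : measurableType d') (R : realType).
Context (mu : {measure set X -> \bar R}) (nu : {measure set Y -> \bar R}).
Context (V : set (X -> R[i])) (W : set (Y -> R[i])).

Definition L1_bounded_operator (T : (X -> R[i]) -> (Y -> R[i])) :=
  [/\ forall f, V f -> W (T f),
      forall f g, V f -> V g -> eq_ae mu f g -> eq_ae nu (T f) (T g),
      forall (c : R[i]) f g, V f -> V g ->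
        eq_ae nu (T (fun x => c * f x + g x)) (fun y => c * T f y + T g y) &
      exists M : R, forall f, V f -> L1norm nu (T f) <= M * L1norm mu f].

End L1_operators.

Definition L1_isomorphism d (X : measurableType d) d' (Y : measurableType d')
    (R : realType) (mu : {measure set X -> \bar R})
    (nu : {measure set Y -> \bar R}) (V : set (X -> R[i])) (W : set (Y -> R[i]))
    (T : (X -> R[i]) -> (Y -> R[i])) :=
  L1_bounded_operator mu nu V W T /\
  exists S : (Y -> R[i]) -> (X -> R[i]),
    [/\ L1_bounded_operator nu mu W V S,
        forall f, V f -> eq_ae mu (S (T f)) f &
        forall g, W g -> eq_ae nu (T (S g)) g].

Section torus_duality.
Variable R : realType.

Definition e2pi (t : R) : R[i] := cos (2 * pi * t) +i* sin (2 * pi * t).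

Definition charT (b : int) (x : R) : R[i] := e2pi (b%:~R * x).

(* Integer sequences with finitely many nonzero entries. *)
Definition dualTN := {fsfun nat -> int with 0}.

Definition charTN (l : dualTN) (x : nat -> R) : R[i] :=
  e2pi (\sum_(k <- finsupp l) (l k)%:~R * x k).

End torus_duality.

Definition pairing (l : dualTN) (tau : nat -> int) : int :=
  \sum_(k <- finsupp l) l k * tau k.

(* Sequences are indexed from 0: a 0 and tau 0 are the first terms. *)
Section lacunary.
Variables (R : realType) (a : nat -> nat) (tau : nat -> int).

Definition specF : set dualTN := [set l | forall n, (`|l n| <= a n)%N].

Definition specE : set int := [set pairing l tau | l in specF].

Definition L1F : set (torusN R -> R[i]) := L1_spectrum haarTN (@charTN R) specF.

Definition L1E : set (measurableTypeR R -> R[i]) :=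
  L1_spectrum haarT (@charT R) specE.

Definition ratio_term (j : nat) : R :=
  (a j)%:R * `|(tau j)%:~R| * (a j.+1)%:R / `|(tau j.+1)%:~R|.

(* T f = sum over l in F of (fourier f l) e(<l, tau> x): pointwise a.e. when f is
   a trigonometric polynomial, as the Fourier series of T f in general.  The
   sums over infinite index sets have finitely many nonzero terms here. *)
Definition given_by_formula
    (T : (torusN R -> R[i]) -> (measurableTypeR R -> R[i])) :=
  (forall f, L1F f -> trig_polynomial (@charTN R) f ->
     eq_ae haarT (T f) (fun x =>
       \sum_(l \in specF) fourier haarTN (@charTN R) f l *
                          e2pi ((pairing l tau)%:~R * x))) /\
  (forall f, L1F f -> forall b : int,
     fourier haarT (@charT R) (T f) b =
     \sum_(l \in specF `&` [set l | pairing l tau = b])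
       fourier haarTN (@charTN R) f l).

End lacunary.

(* Main.v *)
(* With N_n = |tau_n| and D_n = sum_(i < n) a_i N_i, the gap condition gives
   2 D_n < N_n.  Write <l>_n = sum_(i < n) l_i tau_i and let v_n be the de la
   Vallee-Poussin multiplier (t_(N_n - D_n) - t_(D_n)) / (N_n - 2 D_n), where
   t_A(p) = max(A - |p|, 0): it equals 1 on [-D_n, D_n] and vanishes outside
   ]-(N_n - D_n), N_n - D_n[.  Put w(l) = prod_n v_n(<l>_n), and let w+ be the
   same product with sums t_(N_n - D_n) + t_(D_n) instead of differences.
   - w = 1 on F, and if l is in F, w+(m) <> 0 and <m, tau> = <l, tau>, then
     m = l (descending induction on n).
   - Each t_A(<l>_n) is a positive definite function of l, hence so are
     w+ - w and w+ + w.  Smoothed by a Fejer kernel over a box, w therefore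
     gives a kernel on T x T^N dominated by a nonnegative one whose integrals
     over either variable are w+(0), because of the previous point.
   Integrating against this kernel recovers f(tau x) from f and f from
   f(tau x), for every trigonometric polynomial f with spectrum in F, so that
   both norms agree up to the factor
   w+(0) = prod_n (1 - 2 D_n / N_n)^-1 <= exp(6 s + 36 s^2).
   The case w = 1 of the same construction is Fejer summation on T^N, which
   approximates a function of L^1_F by polynomials with spectrum in F; the
   circle is treated as the first coordinate of T^N. *)
Require Import Defs.
From mathcomp Require Import all_boot all_order all_algebra.
From mathcomp Require Import finmap complex.
From mathcomp Require Import all_classical all_reals all_analysis.
From mathcomp Require Import measurable_realfun.
From mathcomp Require Import ring lra zify.

Import Order.TTheory GRing.Theory Num.Theory.
Import numFieldNormedType.Exports.

Local Open Scope classical_set_scope.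
(* ring_scope comes last, so that _^* denotes Num.conj as in Defs. *)
Local Open Scope complex_scope.
Local Open Scope ring_scope.

(** Obstacle: f(tau x) only sees f on a null set of T^N, so no change of variables compares the two
    norms, and outside polynomials the composition has no meaning. The kernel must reproduce F and
    yet have bounded mass on every slice. A positive definite w with w(0) = 1 cannot do this: being
    1 at the unit vectors, which lie in F as a_n >= 1, it would be 1 everywhere and would not
    separate frequencies with the same pairing. Differences of positive definite functions are the
    substitute, and the price is w+(0) in place of 1. Origin of the constant: put r_n = a_n N_n /
    N_(n+1), which is at most 1/3 and at most the n-th summand of s. Since 2 D_n < N_n <= a_n N_n,
    one has 1 - 2 D_(n+1) / N_(n+1) >= 1 - 3 r_n. For small r_n the logarithm of this costs 6 r_n,
    whence 6 s. Near r_n = 1/3 the bound degenerates; there are at most 6 s indices with r_n > 1/6,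
    each costing at most 6 s, whence 36 s^2. *)

Local Notation Re := complex.Re.
Local Notation Im := complex.Im.
Local Notation normc := ComplexField.Normc.normc.

Set Implicit Arguments.
Unset Strict Implicit.
Unset Printing Implicit Defensive.

(** * Complex-valued integrable functions *)

Section complex_numbers.
Context {R : realType}.
Implicit Types z w : R[i].

Lemma complex_eqP z w : Re z = Re w -> Im z = Im w -> z = w.
Proof. by case: z => a b; case: w => c d /= -> ->. Qed.

Lemma normc_ge0 z : 0 <= normc z.
Proof. by case: z => a b; exact: sqrtr_ge0. Qed.

Lemma normc_conj z : normc z^* = normc z.
Proof. by case: z => a b /=; rewrite sqrrN. Qed.

Lemma normc_real (r : R) : normc r%:C = `|r|.
Proof. by rewrite /= expr0n/= addr0 sqrtr_sqr. Qed.

Lemma mul_conjc z : z * z^* = ((normc z) ^+ 2)%:C.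
Proof.
case: z => a b; rewrite /= sqr_sqrtr ?addr_ge0 ?sqr_ge0//.
by apply: complex_eqP => /=; ring.
Qed.

Lemma normc_sum I (s : seq I) (P : pred I) (F : I -> R[i]) :
  normc (\sum_(i <- s | P i) F i) <= \sum_(i <- s | P i) normc (F i).
Proof.
elim/big_ind2 : _ => [|x1 x2 y1 y2 h1 h2|//]; first by rewrite ComplexField.Normc.normc0.
by rewrite (le_trans (le_normcD _ _))// lerD.
Qed.

Lemma normcB z w : normc (z - w) = normc (w - z).
Proof. by rewrite -normcN opprB. Qed.

Lemma Re_le_normc z : `|Re z| <= normc z.
Proof. by case: z => a b; rewrite -sqrtr_sqr ler_sqrt ?addr_ge0 ?sqr_ge0// lerDl sqr_ge0. Qed.

Lemma Im_le_normc z : `|Im z| <= normc z.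
Proof. by case: z => a b; rewrite -sqrtr_sqr ler_sqrt ?addr_ge0 ?sqr_ge0// lerDr sqr_ge0. Qed.

Lemma normc_le_ReIm z : normc z <= `|Re z| + `|Im z|.
Proof.
rewrite {1}(complexE z) (le_trans (le_normcD _ _))// normc_real lerD2l.
by rewrite ComplexField.Normc.normcM normc_real /= expr0n/= add0r expr1n sqrtr1 mul1r.
Qed.

Lemma ReD z w : Re (z + w) = Re z + Re w. Proof. by case: z; case: w. Qed.
Lemma ImD z w : Im (z + w) = Im z + Im w. Proof. by case: z; case: w. Qed.
Lemma ReN z : Re (- z) = - Re z. Proof. by case: z. Qed.
Lemma ImN z : Im (- z) = - Im z. Proof. by case: z. Qed.
Lemma ReM z w : Re (z * w) = Re z * Re w - Im z * Im w.
Proof. by case: z; case: w. Qed.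
Lemma ImM z w : Im (z * w) = Re z * Im w + Im z * Re w.
Proof. by case: z; case: w. Qed.
Lemma ReJ z : Re z^* = Re z. Proof. by case: z. Qed.
Lemma ImJ z : Im z^* = - Im z. Proof. by case: z. Qed.

End complex_numbers.

Section complex_measurability.
Context d (X : measurableType d) (R : realType).
Implicit Types f g : X -> R[i].

Definition cmeasurable f :=
  measurable_fun setT (fun x => Re (f x)) /\ measurable_fun setT (fun x => Im (f x)).

Lemma cmeasurable_cst (c : R[i]) : cmeasurable (fun=> c).
Proof. by split. Qed.

Lemma cmeasurableD f g : cmeasurable f -> cmeasurable g ->
  cmeasurable (fun x => f x + g x).
Proof.
move=> [f1 f2] [g1 g2]; split.
  under eq_fun do rewrite ReD.
  exact: measurable_funD.
under eq_fun do rewrite ImD.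
exact: measurable_funD.
Qed.

Lemma cmeasurableM f g : cmeasurable f -> cmeasurable g ->
  cmeasurable (fun x => f x * g x).
Proof.
move=> [f1 f2] [g1 g2]; split.
  under eq_fun do rewrite ReM.
  by apply: measurable_funB; exact: measurable_funM.
under eq_fun do rewrite ImM.
by apply: measurable_funD; exact: measurable_funM.
Qed.

Lemma cmeasurableJ f : cmeasurable f -> cmeasurable (fun x => (f x)^*).
Proof.
move=> [f1 f2]; split; first by under eq_fun do rewrite ReJ.
under eq_fun do rewrite ImJ.
exact: measurableT_comp.
Qed.

Lemma cmeasurable_sum I (s : seq I) (P : pred I) (F : I -> X -> R[i]) :
  (forall i, cmeasurable (F i)) -> cmeasurable (fun x => \sum_(i <- s | P i) F i x).
Proof.
move=> mF; elim: s => [|i s ih].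
  under eq_fun do rewrite big_nil.
  exact: cmeasurable_cst.
under eq_fun do rewrite big_cons.
by case: (P i) => //; exact: cmeasurableD.
Qed.

Lemma measurable_normc f : cmeasurable f -> measurable_fun setT (fun x => normc (f x)).
Proof.
move=> [f1 f2].
rewrite (_ : (fun _ => _) = fun x => Num.sqrt (Re (f x) ^+ 2 + Im (f x) ^+ 2)); last first.
  by apply/funext => x; case: (f x).
apply: (measurableT_comp (continuous_measurable_fun (@sqrt_continuous R))).
by apply: measurable_funD; apply: measurable_funX.
Qed.

End complex_measurability.

Section complex_integration.
Context d (X : measurableType d) (R : realType) (mu : probability X R).
Implicit Types f g : X -> R[i].

Lemma bounded_integrable (h : X -> R) (M : R) : measurable_fun setT h ->
  (forall x, `|h x| <= M) -> mu.-integrable setT (EFin \o h).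
Proof.
move=> mh hM; apply: measurable_bounded_integrable => //.
  by rewrite [ltLHS]probability_setT ltry.
exists M; split; first exact: num_real.
by move=> N MN x _ /=; rewrite (le_trans (hM x))// ltW.
Qed.

Lemma cintegrableP f : cintegrable mu f <->
  cmeasurable f /\ mu.-integrable setT (fun x => (normc (f x))%:E).
Proof.
split=> [[f1 f2]|[[f1 f2] fi]].
  have mf : cmeasurable f.
    by split; apply/measurable_EFinP; [exact: measurable_int f1|exact: measurable_int f2].
  split=> //; apply: le_integrable (integrableD _ (integrable_norm f1) (integrable_norm f2)) => //.
    exact/measurable_EFinP/measurable_normc.
  move=> x _ /=; rewrite lee_fin ger0_norm ?normc_ge0//.
  by rewrite (le_trans (normc_le_ReIm _))// ler_norm.
split; apply: le_integrable fi => //.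
- exact/measurable_EFinP.
- by move=> x _; rewrite lee_fin [leRHS]ger0_norm ?normc_ge0// Re_le_normc.
- exact/measurable_EFinP.
- by move=> x _; rewrite lee_fin [leRHS]ger0_norm ?normc_ge0// Im_le_normc.
Qed.

Lemma cintegrable_meas f : cintegrable mu f -> cmeasurable f.
Proof. by case/cintegrableP. Qed.

Lemma cintegrable_normc f : cintegrable mu f ->
  mu.-integrable setT (fun x => (normc (f x))%:E).
Proof. by case/cintegrableP. Qed.

Lemma bounded_cintegrable f (M : R) : cmeasurable f ->
  (forall x, normc (f x) <= M) -> cintegrable mu f.
Proof.
move=> mf fM; apply/cintegrableP; split => //.
apply: (@bounded_integrable _ M); first exact: measurable_normc.
by move=> x; rewrite ger0_norm ?normc_ge0.
Qed.

Lemma cintegrable_cst (c : R[i]) : cintegrable mu (fun=> c).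
Proof. by apply: (@bounded_cintegrable _ (normc c)) => //; exact: cmeasurable_cst. Qed.

Lemma cintegrableD f g : cintegrable mu f -> cintegrable mu g ->
  cintegrable mu (fun x => f x + g x).
Proof.
move=> [f1 f2] [g1 g2]; split.
  under eq_fun do rewrite ReD EFinD.
  exact: integrableD.
under eq_fun do rewrite ImD EFinD.
exact: integrableD.
Qed.

Lemma cintegrableM f g (M : R) : cintegrable mu f -> cmeasurable g ->
  (forall x, normc (g x) <= M) -> cintegrable mu (fun x => f x * g x).
Proof.
move=> /cintegrableP[mf fi] mg gM; apply/cintegrableP.
have mfg := cmeasurableM mf mg; split=> //.
apply: le_integrable (integrableZl _ M fi) => //.
  exact/measurable_EFinP/measurable_normc.
move=> x _ /=; rewrite lee_fin ComplexField.Normc.normcM !normrM mulrC.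
by rewrite ler_wpM2r// !ger0_norm ?normc_ge0// (le_trans (normc_ge0 _) (gM x)).
Qed.

Lemma cintegrableZ (c : R[i]) f : cintegrable mu f -> cintegrable mu (fun x => c * f x).
Proof.
move=> fi; under eq_fun do rewrite mulrC.
by apply: (@cintegrableM _ _ (normc c)) => //; exact: cmeasurable_cst.
Qed.

Lemma cintegrableB f g : cintegrable mu f -> cintegrable mu g ->
  cintegrable mu (fun x => f x - g x).
Proof.
move=> fi /(cintegrableZ (-1)) gi; under eq_fun do rewrite -mulN1r.
exact: cintegrableD.
Qed.

Lemma cintegrable_sum I (s : seq I) (P : pred I) (F : I -> X -> R[i]) :
  (forall i, cintegrable mu (F i)) ->
  cintegrable mu (fun x => \sum_(i <- s | P i) F i x).
Proof.
move=> iF; elim: s => [|i s ih].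
  under eq_fun do rewrite big_nil.
  exact: cintegrable_cst.
under eq_fun do rewrite big_cons.
by case: (P i) => //; exact: cintegrableD.
Qed.

Lemma cintegralD f g : cintegrable mu f -> cintegrable mu g ->
  cintegral mu (fun x => f x + g x) = cintegral mu f + cintegral mu g.
Proof.
move=> [f1 f2] [g1 g2]; apply: complex_eqP => /=.
  by under eq_Rintegral do rewrite ReD; exact: RintegralD.
by under eq_Rintegral do rewrite ImD; exact: RintegralD.
Qed.

Lemma integrable_RZ (k : R) (h : X -> R) : mu.-integrable setT (EFin \o h) ->
  mu.-integrable setT (EFin \o (fun x => k * h x)).
Proof. by move=> hi; exact: (integrableZl measurableT k hi). Qed.

Lemma cintegralZ (c : R[i]) f : cintegrable mu f ->
  cintegral mu (fun x => c * f x) = c * cintegral mu f.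
Proof.
move=> [f1 f2]; apply: complex_eqP; rewrite ?(ReM, ImM) /cintegral /=.
  under eq_Rintegral do rewrite ReM.
  rewrite RintegralB//; [|exact: integrable_RZ..].
  by rewrite !RintegralZl.
under eq_Rintegral do rewrite ImM.
rewrite RintegralD//; [|exact: integrable_RZ..].
by rewrite !RintegralZl.
Qed.

Lemma cintegralB f g : cintegrable mu f -> cintegrable mu g ->
  cintegral mu (fun x => f x - g x) = cintegral mu f - cintegral mu g.
Proof.
move=> fi gi; under [fun x => _]eq_fun do rewrite -mulN1r.
by rewrite cintegralD ?cintegralZ ?mulN1r//; exact: cintegrableZ.
Qed.

Lemma cintegral_cst (c : R[i]) : cintegral mu (fun=> c) = c.
Proof.
by apply: complex_eqP => /=; rewrite Rintegral_cst// [X in fine X]probability_setT mulr1.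
Qed.

Lemma cintegral_sum I (s : seq I) (P : pred I) (F : I -> X -> R[i]) :
  (forall i, cintegrable mu (F i)) ->
  cintegral mu (fun x => \sum_(i <- s | P i) F i x)
    = \sum_(i <- s | P i) cintegral mu (F i).
Proof.
move=> iF; elim: s => [|i s ih].
  under [fun x => _]eq_fun do rewrite big_nil.
  by rewrite big_nil cintegral_cst.
under [fun x => _]eq_fun do rewrite big_cons.
rewrite big_cons; case: (P i) => //; rewrite cintegralD ?ih//.
exact: cintegrable_sum.
Qed.

Lemma L1norm_ge0 f : 0 <= L1norm mu f.
Proof. by apply: Rintegral_ge0 => x _; exact: normc_ge0. Qed.

Lemma le_L1norm f (h : X -> R) : cintegrable mu f -> mu.-integrable setT (EFin \o h) ->
  (forall x, normc (f x) <= h x) -> L1norm mu f <= \int[mu]_x h x.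
Proof. by move=> fi hi fh; apply: le_Rintegral => //; exact: cintegrable_normc. Qed.

Lemma L1normD f g : cintegrable mu f -> cintegrable mu g ->
  L1norm mu (fun x => f x + g x) <= L1norm mu f + L1norm mu g.
Proof.
move=> fi gi; rewrite /L1norm -RintegralD//; [|exact: cintegrable_normc..].
apply: le_L1norm; first exact: cintegrableD.
  exact: (integrableD _ (cintegrable_normc fi) (cintegrable_normc gi)).
by move=> x; exact: le_normcD.
Qed.

Lemma L1normZ (c : R[i]) f : cintegrable mu f ->
  L1norm mu (fun x => c * f x) = normc c * L1norm mu f.
Proof.
move=> fi; rewrite /L1norm -RintegralZl//; last exact: cintegrable_normc.
by apply: eq_Rintegral => x _; rewrite ComplexField.Normc.normcM.
Qed.

Lemma L1normBC f g : L1norm mu (fun x => f x - g x) = L1norm mu (fun x => g x - f x).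
Proof. by apply: eq_Rintegral => x _; rewrite normcB. Qed.

Lemma L1normB f g h : cintegrable mu f -> cintegrable mu g -> cintegrable mu h ->
  L1norm mu (fun x => f x - h x) <=
  L1norm mu (fun x => f x - g x) + L1norm mu (fun x => g x - h x).
Proof.
move=> fi gi hi; rewrite (le_trans _ (L1normD _ _))//; [|exact: cintegrableB..].
by under [in leRHS]eq_fun do rewrite addrA subrK.
Qed.

Lemma normc_cintegral f : cintegrable mu f -> normc (cintegral mu f) <= L1norm mu f.
Proof.
move=> fi; set z := cintegral mu f.
have [z0|z0] := eqVneq (normc z) 0; first by rewrite z0 L1norm_ge0.
(* Rotating by the phase [u] makes the integral real and equal to |z|, so it suffices to integrate
   [Re (u * f x) <= normc (u * f x)]. *)
pose u := z^* / (normc z)%:C.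
have nu : normc u = 1.
  by rewrite /u ComplexField.Normc.normcM ComplexField.Normc.normcV normc_conj
             normc_real ger0_norm ?normc_ge0// divff.
have uz : u * z = (normc z)%:C.
  rewrite /u mulrAC [z^* * z]mulrC mul_conjc expr2 rmorphM/= mulfK//.
  by apply/eqP => -[]; apply/eqP.
have ufi := cintegrableZ u fi.
have -> : normc z = \int[mu]_x Re (u * f x).
  by have /(congr1 (@complex.Re R)) := cintegralZ u fi; rewrite -/z uz /=.
rewrite -[leRHS]mul1r -nu -L1normZ//.
apply: le_Rintegral => //; [exact: ufi.1|exact: cintegrable_normc|].
by move=> x _; rewrite (le_trans (ler_norm _))// Re_le_normc.
Qed.

Lemma L1norm_le_sup f (M : R) : cintegrable mu f -> (forall x, normc (f x) <= M) ->
  L1norm mu f <= M.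
Proof.
move=> fi fM; apply: (le_trans (le_L1norm (h := fun=> M) fi _ fM)).
  exact: finite_measure_integrable_cst.
by rewrite Rintegral_cst// [X in fine X]probability_setT mulr1.
Qed.

Lemma L1norm_eq0 f : cintegrable mu f -> L1norm mu f = 0 -> eq_ae mu f (fun=> 0).
Proof.
move=> fi f0.
have mf := measurable_normc (cintegrable_meas fi).
have : (\int[mu]_x `|(normc (f x))%:E| = 0)%E.
  under eq_integral do rewrite gee0_abs ?lee_fin ?normc_ge0//.
  rewrite -[LHS]fineK ?integrable_fin_num//; last exact: cintegrable_normc.
  by move: f0; rewrite /L1norm /Rintegral => ->.
have /measurable_EFinP mf' := mf.
move/(ae_eq_integral_abs mu measurableT mf').1.
apply: filterS => [x /= /(_ I) []].
exact: ComplexField.Normc.eq0_normc.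
Qed.

End complex_integration.

(** * Kernels dominated by positive definite ones *)

(** In the order of [R[i]], 0 <= z includes Im z = 0, so the symmetry of [A] is part of the
    condition. *)
Definition psd (R : realType) (J : finType) (A : J -> J -> R) :=
  forall c : J -> R[i], 0 <= \sum_j \sum_k (A j k)%:C * (c j * (c k)^*).

(** This is -mp <= m <= mp for quadratic forms. The value of a kernel at a point is the value of a
    form at a vector, so this order yields a pointwise bound between kernels. *)
Definition dominated (R : realType) (J : finType) (m mp : J -> J -> R) :=
  psd (fun j k => mp j k - m j k) /\ psd (fun j k => mp j k + m j k).

Lemma dominated_normc (R : realType) (J : finType) (m mp : J -> J -> R) (c : J -> R[i]) :
  dominated m mp ->
  normc (\sum_j \sum_k (m j k)%:C * (c j * (c k)^*)) <=
  Re (\sum_j \sum_k (mp j k)%:C * (c j * (c k)^*)).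
Proof.
move=> [/(_ c) + /(_ c)].
have -> : \sum_j \sum_k (mp j k - m j k)%:C * (c j * (c k)^*) =
    \sum_j \sum_k (mp j k)%:C * (c j * (c k)^*) -
    \sum_j \sum_k (m j k)%:C * (c j * (c k)^*).
  rewrite -sumrB; apply: eq_bigr => j _; rewrite -sumrB; apply: eq_bigr => k _.
  by rewrite rmorphB mulrBl.
have -> : \sum_j \sum_k (mp j k + m j k)%:C * (c j * (c k)^*) =
    \sum_j \sum_k (mp j k)%:C * (c j * (c k)^*) +
    \sum_j \sum_k (m j k)%:C * (c j * (c k)^*).
  rewrite -big_split; apply: eq_bigr => j _; rewrite -big_split; apply: eq_bigr => k _.
  by rewrite /= rmorphD mulrDl.
set u := \sum_j \sum_k (mp j k)%:C * _; set v := \sum_j \sum_k _.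
case: u => a b; case: v => a' b'; rewrite !lecE /=.
move=> /andP[/eqP h1 h2] /andP[/eqP h3 h4].
(* [u - v] and [u + v] are both real, hence so is [v]. *)
have b'0 : b' = 0 by lra.
by rewrite b'0 expr0n addr0 sqrtr_sqr ler_norml; apply/andP; split; lra.
Qed.

Section kernel_bound.
Context d (X : measurableType d) d' (Y : measurableType d') (R : realType).
Context (mu : probability X R) (nu : probability Y R) (J : finType).
Context (al : J -> X -> R[i]) (be : J -> Y -> R[i]) (m mp : J -> J -> R).
Hypothesis mal : forall j, cmeasurable (al j).
Hypothesis mbe : forall j, cmeasurable (be j).
Hypothesis nal : forall j x, normc (al j x) = 1.
Hypothesis nbe : forall j y, normc (be j y) = 1.
Hypothesis dom : dominated m mp.
Hypothesis orth : forall j k, j != k -> mp j k != 0 ->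
  cintegral mu (fun x => al j x * (al k x)^*) = 0.

Let bal j k x : normc (al j x * (al k x)^*) <= 1.
Proof. by rewrite ComplexField.Normc.normcM normc_conj !nal mulr1. Qed.

Let bbe j k y : normc (be j y * (be k y)^*)^* <= 1.
Proof. by rewrite normc_conj ComplexField.Normc.normcM normc_conj !nbe mulr1. Qed.

Let mals j k : cmeasurable (fun x => al j x * (al k x)^*).
Proof. by apply: cmeasurableM => //; exact: cmeasurableJ. Qed.

Let mbes j k : cmeasurable (fun y => (be j y * (be k y)^*)^*).
Proof. by apply: cmeasurableJ; apply: cmeasurableM => //; exact: cmeasurableJ. Qed.

(** The quadratic form of [A] at the vector c_j = [al j x * (be j y)^*]. This shape suits
    [dominated_normc]; [WE] separates the variables for integration. *)
Let W (A : J -> J -> R) x y : R[i] := \sum_j \sum_k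
  (A j k)%:C * ((al j x * (be j y)^*) * (al k x * (be k y)^*)^*).

Let WE A x y : W A x y =
  \sum_j \sum_k (A j k)%:C * ((al j x * (al k x)^*) * (be j y * (be k y)^*)^*).
Proof.
apply: eq_bigr => j _; apply: eq_bigr => k _; congr (_ * _).
by rewrite !rmorphM /= ?conjcK mulrACA.
Qed.

Let w x y : R := Re (W mp x y).

Let Ww x y : normc (W m x y) <= w x y.
Proof. exact: dominated_normc. Qed.

Let w0 x y : 0 <= w x y.
Proof. exact: le_trans (normc_ge0 _) (Ww x y). Qed.

Let mW A : cmeasurable (fun z : X * Y => W A z.1 z.2).
Proof.
under eq_fun do rewrite WE.
apply: cmeasurable_sum => j; apply: cmeasurable_sum => k.
apply: cmeasurableM; first exact: cmeasurable_cst.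
apply: cmeasurableM.
  have [h1 h2] := mals j k.
  by split; [exact: (measurableT_comp h1 measurable_fst)|exact: (measurableT_comp h2 measurable_fst)].
have [h1 h2] := mbes j k.
by split; [exact: (measurableT_comp h1 measurable_snd)|exact: (measurableT_comp h2 measurable_snd)].
Qed.

Let mWy A x : cmeasurable (W A x).
Proof.
have [h1 h2] := mW A.
by split; [apply: (measurableT_comp h1 (measurable_pair1 x))|
           apply: (measurableT_comp h2 (measurable_pair1 x))].
Qed.

Let B (A : J -> J -> R) := \sum_j \sum_k `|A j k|.

Let WB A x y : normc (W A x y) <= B A.
Proof.
rewrite WE (le_trans (normc_sum _ _ _))//; apply: ler_sum => j _.
rewrite (le_trans (normc_sum _ _ _))//; apply: ler_sum => k _.
rewrite ComplexField.Normc.normcM normc_real -[leRHS]mulr1 ler_wpM2l//.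
by rewrite ComplexField.Normc.normcM; apply: mulr_ile1; rewrite ?normc_ge0 ?bal ?bbe.
Qed.

Let int_al j k : cintegrable mu (fun x => al j x * (al k x)^*).
Proof. exact: bounded_cintegrable (mals j k) (bal j k). Qed.

(** Off the diagonal either [mp j k] is 0 or the integral over [x] vanishes by [orth]; on the
    diagonal the functions have modulus 1. The mass of a slice is thus the same for every [y]. *)
Let intw y : \int[mu]_x w x y = \sum_j mp j j.
Proof.
transitivity (Re (cintegral mu (fun x => W mp x y))); first by [].
under [fun x => _]eq_fun do rewrite WE.
rewrite cintegral_sum; last first.
  move=> j; apply: cintegrable_sum => k.
  apply: cintegrableZ; under eq_fun do rewrite mulrC.
  exact: cintegrableZ.
have -> : (\sum_j mp j j) = Re (\sum_j (mp j j)%:C : R[i]) by rewrite -rmorph_sum.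
congr Re; apply: eq_bigr => j _.
rewrite cintegral_sum; last first.
  move=> k; apply: cintegrableZ.
  by under eq_fun do rewrite mulrC; apply: cintegrableZ.
have E k : cintegral mu (fun x => (mp j k)%:C *
      (al j x * (al k x)^* * (be j y * (be k y)^*)^*)) =
    (mp j k)%:C * ((be j y * (be k y)^*)^* * cintegral mu (fun x => al j x * (al k x)^*)).
  under [fun x => _]eq_fun do rewrite [X in _ * X]mulrC.
  by rewrite !cintegralZ//; exact: cintegrableZ.
under eq_bigr do rewrite E.
rewrite (bigD1 j)//= big1 ?addr0; last first.
  move=> k kj; have [->|mp0] := eqVneq (mp j k) 0; first by rewrite mul0r.
  by rewrite orth// 1?eq_sym// mulr0 mulr0.
under [fun x => _]eq_fun do rewrite mul_conjc nal expr1n.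
rewrite cintegral_cst mulr1 mul_conjc nbe expr1n.
by apply: complex_eqP => /=; ring.
Qed.

(** The function on the left is the integral of f(y) W(x, y) over y. As |W| <= w, Tonelli bounds its
    norm by the integral of |f(y)| times the mass of the slice at y, which [intw] gives. *)
Lemma kernel_bound f : cintegrable nu f ->
  L1norm mu (fun x => \sum_j \sum_k (m j k)%:C *
    cintegral nu (fun y => f y * (be j y * (be k y)^*)^*) * (al j x * (al k x)^*))
  <= (\sum_j mp j j) * L1norm nu f.
Proof.
move=> fi; set g := (X in L1norm mu X).
have fb j k : cintegrable nu (fun y => f y * (be j y * (be k y)^*)^*).
  exact: cintegrableM fi (mbes j k) (bbe j k).
have gE x : g x = cintegral nu (fun y => f y * W m x y).
  under [in RHS]eq_fun do rewrite WE mulr_sumr.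
  have fs j k : cintegrable nu (fun y => f y *
      ((m j k)%:C * (al j x * (al k x)^* * (be j y * (be k y)^*)^*))).
    under eq_fun do rewrite mulrCA [X in _ * X]mulrCA.
    by do 2 apply: cintegrableZ.
  have fs2 j : cintegrable nu (fun y => f y *
      (\sum_k (m j k)%:C * (al j x * (al k x)^* * (be j y * (be k y)^*)^*))).
    by under eq_fun do rewrite mulr_sumr; exact: cintegrable_sum.
  rewrite cintegral_sum//; apply: eq_bigr => j _.
  under [in RHS]eq_fun do rewrite mulr_sumr.
  rewrite cintegral_sum//; apply: eq_bigr => k _.
  under [in RHS]eq_fun do rewrite mulrCA [X in _ * X]mulrCA.
  by rewrite !cintegralZ//; [rewrite -mulrA [X in _ = _ * X]mulrC|exact: cintegrableZ].
have gi : cintegrable mu g.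
  apply: cintegrable_sum => j; apply: cintegrable_sum => k.
  exact: cintegrableZ.
pose h := fun z : X * Y => (normc (f z.2) * w z.1 z.2)%:E.
have mf := measurable_normc (cintegrable_meas fi).
have mh : measurable_fun setT h.
  apply/measurable_EFinP; apply: measurable_funM.
    exact: (measurableT_comp mf measurable_snd).
  exact: (mW mp).1.
have h0 z : (0 <= h z)%E by rewrite lee_fin mulr_ge0 ?normc_ge0.
have fwi x : nu.-integrable setT (EFin \o (fun y => normc (f y) * w x y)).
  apply: le_integrable (integrable_RZ (B mp) (cintegrable_normc fi)) => //.
    exact: (measurableT_comp mh (measurable_pair1 x)).
  move=> y _ /=; rewrite lee_fin !normrM mulrC ler_wpM2r//.
  by rewrite (le_trans (Re_le_normc _))// (le_trans (WB _ _ _))// ler_norm.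
rewrite -lee_fin EFinM {1}/L1norm /Rintegral fineK; last first.
  exact/integrable_fin_num/cintegrable_normc.
apply: (@le_trans _ _ (\int[mu]_x \int[nu]_y h (x, y))%E).
  apply: ge0_le_integral => //.
  - by move=> x _; rewrite lee_fin normc_ge0.
  - exact/measurable_EFinP/(measurable_normc (cintegrable_meas gi)).
  - by apply: measurable_fun_fubini_tonelli_F.
  move=> x _; rewrite gE.
  have fWi : cintegrable nu (fun y => f y * W m x y).
    exact: cintegrableM fi (mWy m x) (WB m x).
  apply: (@le_trans _ _ (\int[nu]_y (normc (f y) * w x y))%:E); last first.
    by rewrite /Rintegral fineK//; exact: integrable_fin_num (fwi x).
  rewrite lee_fin (le_trans (normc_cintegral fWi))//; apply: le_L1norm => //.
  by move=> y; rewrite ComplexField.Normc.normcM ler_wpM2l ?normc_ge0.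
rewrite (fubini_tonelli h)//.
have -> : (\int[nu]_y \int[mu]_x h (x, y) =
    \int[nu]_y ((\sum_j mp j j)%:E * (normc (f y))%:E))%E.
  apply: eq_integral => y _.
  have wi : mu.-integrable setT (EFin \o (fun x => w x y)).
    apply: (@bounded_integrable _ _ _ _ _ (B mp)).
      exact: (measurableT_comp (mW mp).1 (measurable_pair2 y)).
    by move=> x; rewrite (le_trans (Re_le_normc _)).
  have E := RintegralZl (normc (f y)) measurableT wi.
  have wi' := integrable_RZ (normc (f y)) wi.
  rewrite intw in E; rewrite muleC -EFinM -E /Rintegral fineK//.
  exact: integrable_fin_num wi'.
rewrite integralZl//; last exact: cintegrable_normc.
rewrite /L1norm /Rintegral fineK//.
exact/integrable_fin_num/cintegrable_normc.
Qed.

End kernel_bound.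

(** By [triE] this is max(A - |p|, 0). The count of pairs is the form that shows positive
    definiteness in [psd_tri] and that arises in [count_box_diff]. *)
Definition tri (A : nat) (p : int) : nat :=
  (\sum_(u < A) \sum_(v < A) nat_of_bool (u%:Z - v%:Z == p)%R)%N.

(** Given [u], only v = u - p contributes, so the sum is the length of [0, A[ intersected with its
    translate by [p]. *)
Lemma triE A p : tri A p = (A - `|p|)%N.
Proof.
rewrite /tri; have inner (u : 'I_A) :
    (\sum_(v < A) nat_of_bool (u%:Z - v%:Z == p)%R)%N =
    nat_of_bool ((0 <= u%:Z - p) && (u%:Z - p < A)).
  have [/andP[h1 h2]|h] := boolP ((0 <= u%:Z - p) && (u%:Z - p < A)).
    have lt : (`|(u%:Z - p)%R| < A)%N by lia.
    rewrite (bigD1 (Ordinal lt))//= big1 ?addn0; first by lia.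
    by move=> v /eqP vn; case: eqP => // e; exfalso; apply: vn; apply: val_inj => /=; lia.
  by rewrite big1 // => v _; have := ltn_ord v; case: eqP => // e; move: h; lia.
rewrite (eq_bigr _ (fun u _ => inner u)).
rewrite -(big_mkord xpredT (fun u : nat => nat_of_bool ((0 <= u%:Z - p) && (u%:Z - p < A)))).
have cnt (b c : nat) : (b <= A)%N -> (c <= A)%N ->
   (\sum_(0 <= u < A) nat_of_bool ((b <= u) && (u < c)))%N = (c - b)%N.
  move=> bA cA.
  have [cb|bc] := leqP c b.
    by rewrite big1_seq; [lia|move=> u _; lia].
  rewrite (big_cat_nat (n := b)) //=.
  rewrite (big_cat_nat (m := b) (n := c)) ?(ltnW bc) //=.
  rewrite [X in (X + _)%N]big1_seq; last by move=> u; rewrite mem_index_iota; lia.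
  rewrite [X in (_ + (_ + X))%N]big1_seq; last by move=> u; rewrite mem_index_iota; lia.
  rewrite (eq_big_nat _ _ (F2 := fun=> 1%N)); last by move=> u; lia.
  by rewrite sum_nat_const_nat; lia.
have [p0|p0] := leP 0 p.
  have [pA|pA] := leqP A `|p|.
    by rewrite big1_seq; [lia|move=> u; rewrite mem_index_iota; lia].
  rewrite -(cnt `|p|%N A) //; last by lia.
  by apply: eq_big_nat => u; lia.
have [pA|pA] := leqP A `|p|.
  by rewrite big1_seq; [lia|move=> u; rewrite mem_index_iota; lia].
rewrite -[RHS]subn0 -(cnt 0%N (A - `|p|)%N) //; last by lia.
by apply: eq_big_nat => u; lia.
Qed.

(** * Closure properties of positive definite kernels *)

Section psd_closure.
Context {R : realType} {J : finType}.
Implicit Types (A m mp : J -> J -> R) (h : J -> int).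

Lemma eq_psd A A' : (forall j k, A j k = A' j k) -> psd A -> psd A'.
Proof. by move=> e PA c; have := PA c; under eq_bigr do under eq_bigr do rewrite e. Qed.

Lemma psdD A A' : psd A -> psd A' -> psd (fun j k => A j k + A' j k).
Proof.
move=> PA PA' c; rewrite (_ : \sum_j _ = \sum_j \sum_k (A j k)%:C * (c j * (c k)^*) +
    \sum_j \sum_k (A' j k)%:C * (c j * (c k)^*)); first exact: addr_ge0.
rewrite -big_split; apply: eq_bigr => j _; rewrite -big_split; apply: eq_bigr => k _.
by rewrite /= rmorphD mulrDl.
Qed.

Lemma psdZ (x : R) A : 0 <= x -> psd A -> psd (fun j k => x * A j k).
Proof.
move=> x0 PA c; rewrite (_ : \sum_j _ = x%:C * \sum_j \sum_k (A j k)%:C * (c j * (c k)^*)).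
  by rewrite mulr_ge0// ler0c.
rewrite mulr_sumr; apply: eq_bigr => j _; rewrite mulr_sumr; apply: eq_bigr => k _.
by rewrite [RHS]mulrA -rmorphM.
Qed.

Lemma psd1 : psd (fun _ _ : J => 1 : R).
Proof.
move=> c; rewrite (_ : \sum_j _ = (\sum_j c j) * (\sum_j c j)^*).
  by rewrite mul_conjc ler0c sqr_ge0.
rewrite rmorph_sum mulr_suml; apply: eq_bigr => j _; rewrite mulr_sumr.
by apply: eq_bigr => k _; rewrite mul1r.
Qed.

Lemma psd0 : psd (fun _ _ : J => 0 : R).
Proof. by move=> c; rewrite big1// => j _; rewrite big1// => k _; rewrite mul0r. Qed.

(* Schur's product theorem for the Fejer matrix, which is a sum of rank one
   0-1 matrices. *)
Lemma psd_tri (N : nat) h A : psd A ->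
  psd (fun j k => A j k * (tri N (h j - h k))%:R).
Proof.
move=> PA c.
pose S := undup [seq u%:Z - h j | u <- iota 0 N, j <- enum J].
(* [phi z] marks the j with z + h j in [0, N[. A pair (u, v) with u - v = h j - h k is counted at
   the common value z = u - h j = v - h k, and [S] contains the finitely many z that occur. *)
pose phi z j : nat := (\sum_(u < N) nat_of_bool (u%:Z - h j == z)%R)%N.
have E j k : (tri N (h j - h k) = \sum_(z <- S) phi z j * phi z k)%N.
  rewrite /phi; under eq_bigr do rewrite big_distrl/=.
  rewrite exchange_big/= /tri; apply: eq_bigr => u _.
  have uS : u%:Z - h j \in S.
    rewrite mem_undup; apply/allpairsP; exists (val u, j) => /=.
    by rewrite mem_iota/= add0n ltn_ord mem_enum.
  rewrite (bigD1_seq _ uS (undup_uniq _))/= eqxx mul1n [X in (_ + X)%N]big1 ?addn0.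
    by apply: eq_bigr => v _; congr nat_of_bool; lia.
  by move=> z /negPf; rewrite eq_sym => ->.
rewrite (_ : \sum_j _ = \sum_(z <- S) \sum_j \sum_k (A j k)%:C *
    (((phi z j)%:R * c j) * ((phi z k)%:R * c k)^*)).
  by rewrite sumr_ge0.
rewrite [RHS]exchange_big/=; apply: eq_bigr => j _.
rewrite [RHS]exchange_big/=; apply: eq_bigr => k _.
rewrite E natr_sum rmorphM rmorph_sum/= mulr_sumr mulr_suml; apply: eq_bigr => z _.
by rewrite natrM !rmorphM !rmorph_nat /=; ring.
Qed.

(** With t_N, t_D the two triangles, mp (t_N + t_D) - m (t_N - t_D) = (mp - m) t_N + (mp + m) t_D,
    and with + for the first - the roles of mp - m and mp + m are exchanged; each summand is handled
    by [psd_tri]. *)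
Lemma dominated_tri (x : R) (N D : nat) h m mp : 0 <= x -> dominated m mp ->
  dominated (fun j k => m j k * (x * ((tri N (h j - h k))%:R - (tri D (h j - h k))%:R)))
    (fun j k => mp j k * (x * ((tri N (h j - h k))%:R + (tri D (h j - h k))%:R))).
Proof.
move=> x0 [Pm Pp]; split.
  apply: eq_psd (psdZ x0 (psdD (psd_tri N h Pm) (psd_tri D h Pp))) => j k /=; ring.
apply: eq_psd (psdZ x0 (psdD (psd_tri N h Pp) (psd_tri D h Pm))) => j k /=; ring.
Qed.

Lemma dominated_refl m : psd m -> dominated m m.
Proof.
move=> Pm; split; first by apply: eq_psd psd0 => j k; rewrite subrr.
exact: psdD.
Qed.

End psd_closure.

(** * The bound of w+(0) in terms of the series *)

Section constant.
Context {R : realType} (d r : nat -> R) (s : R).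
Hypothesis d0 : d 0%N = 1.
Hypothesis dP : forall n, 0 < d n <= 1.
Hypothesis rP : forall n, 0 <= r n <= 3^-1.
Hypothesis dr : forall n, 1 - 3 * r n + r n * d n <= d n.+1.
Hypothesis rs : forall n, \sum_(k < n) r k <= s.

(** (1 - d_n)(1 - 3 r_n) >= 0 turns [dr] into d_(n+1) >= d_n (1 - 2 r_n), and exp(-6 r) <= 1 - 2 r
    on [0, 1/3] because (1 + 6 r)(1 - 2 r) >= 1 there. *)
Let d_ge n : expR (- 6 * \sum_(k < n) r k) <= d n.
Proof.
elim: n => [|n ih]; first by rewrite big_ord0 mulr0 expR0 d0.
have /andP[dn0 dn1] := dP n; have /andP[r0 r3] := rP n.
rewrite big_ord_recr/= mulrDr expRD.
have h : expR (- 6 * r n) <= 1 - 2 * r n.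
  rewrite mulNr expRN -(invrK (1 - 2 * r n)) lef_pV2 ?posrE ?expR_gt0 ?invr_gt0//; last by lra.
  rewrite (le_trans _ (expR_ge1Dx _))// -[leLHS]mul1r ler_pdivrMr; last by lra.
  nra.
have : expR (- 6 * \sum_(k < n) r k) * expR (- 6 * r n) <= d n * (1 - 2 * r n).
  by rewrite ler_pM// expR_ge0.
move=> /le_trans; apply; rewrite (le_trans _ (dr n))//; nra.
Qed.

(** Using [d_ge] in every factor would give an exponent growing with [M]. Each factor is instead
    charged to its own r_n at the rate 6 + 36 s, and the r_n sum to at most s. *)
Lemma prod_constant M : \prod_(n < M.+1) (d n)^-1 <= expR (6 * s + 36 * s ^+ 2).
Proof.
have s0 : 0 <= s by have := rs 0; rewrite big_ord0.
have rsum0 n : 0 <= \sum_(k < n) r k by apply: sumr_ge0 => k _; case/andP: (rP k).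
have step n : (d n.+1)^-1 <= expR ((6 + 36 * s) * r n).
  have /andP[dn0 dn1] := dP n.+1; have /andP[r0 r3] := rP n; have /andP[dm0 dm1] := dP n.
  rewrite -[leRHS]invrK lef_pV2 ?posrE ?invr_gt0 ?expR_gt0// -expRN.
  (* (1 + 6 r)(1 - 3 r) >= 1 holds up to r = 1/6, so below it d_(n+1) >= 1 - 3 r_n >= exp(-6 r_n).
     Above it 1 < 6 r_n, and [d_ge] gives d_(n+1) >= exp(-6 s) >= exp(-36 s r_n). *)
  have [r6|r6] := leP (r n) 6^-1.
    apply: (@le_trans _ _ (expR (- (6 * r n)))).
      by rewrite ler_expR; nra.
    rewrite (@le_trans _ _ (1 - 3 * r n))//; last by have := dr n; nra.
    rewrite expRN -(invrK (1 - 3 * r n)) lef_pV2 ?posrE ?expR_gt0 ?invr_gt0//; last by lra.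
    rewrite (le_trans _ (expR_ge1Dx _))// -[leLHS]mul1r ler_pdivrMr; last by lra.
    by nra.
  apply: le_trans (d_ge n.+1); rewrite ler_expR.
  have := rs n.+1; have := rsum0 n.+1; nra.
suff : \prod_(n < M.+1) (d n)^-1 <= expR ((6 + 36 * s) * \sum_(k < M) r k).
  move=> /le_trans; apply; rewrite ler_expR expr2.
  have := rs M; have := rsum0 M; nra.
elim: M => [|M ih].
  by rewrite big_ord_recr !big_ord0 /= d0 mulr0 expR0 mul1r invr1.
rewrite big_ord_recr [in leRHS]big_ord_recr/= mulrDr expRD ler_pM//.
  by apply: prodr_ge0 => i _; rewrite invr_ge0; case/andP: (dP i) => /ltW.
by rewrite invr_ge0; case/andP: (dP M.+1) => /ltW.
Qed.

End constant.

(** * The multiplier of a lacunary sequence *)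

Section multiplier.
Context (a : nat -> nat) (tau : nat -> int).
Hypothesis a_gt0 : forall n, (0 < a n)%N.
Hypothesis tau0 : tau 0%N != 0.
Hypothesis tauS : forall k, 3 * (a k)%:Z * `|tau k| <= tau k.+1.
Implicit Types l mu : nat -> int.

Definition partial_pairing l n : int := \sum_(i < n) l i * tau i.

Definition max_pairing n : nat := (\sum_(i < n) a i * `|tau i|)%N.

Local Notation N n := `|tau n|%N.
Local Notation D := max_pairing.

Lemma partial_pairingS l n :
  partial_pairing l n.+1 = partial_pairing l n + l n * tau n.
Proof. exact: big_ord_recr. Qed.

Lemma partial_pairingB l mu n :
  partial_pairing (fun i => l i - mu i) n = partial_pairing l n - partial_pairing mu n.
Proof. by rewrite -sumrB; apply: eq_bigr => i _; rewrite mulrBl. Qed.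

Lemma max_pairingS n : D n.+1 = (D n + a n * N n)%N.
Proof. exact: big_ord_recr. Qed.

Lemma lacunarity n : (3 * (a n * N n) <= N n.+1)%N.
Proof. by have := tauS n; have := a_gt0 n; nia. Qed.

(** The factor 3 and a_n >= 1 enter here: 2 D_(n+1) < N_n + 2 a_n N_n <= 3 a_n N_n <= N_(n+1). *)
Lemma max_pairing_lt n : (2 * D n < N n)%N.
Proof.
elim: n => [|n ih]; first by rewrite /max_pairing big_ord0; lia.
by have := lacunarity n; have := a_gt0 n; rewrite max_pairingS; nia.
Qed.

Lemma partial_pairing_le l n : (forall i, (`|l i| <= a i)%N) ->
  (`|partial_pairing l n| <= D n)%N.
Proof.
clear a_gt0 tau0 tauS; move=> lF.
elim: n => [|n ih]; first by rewrite /partial_pairing big_ord0.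
by rewrite partial_pairingS max_pairingS; have := lF n; nia.
Qed.

(** Equality of the sums at n + 1 gives (mu_n - l_n) tau_n = <l>_n - <mu>_n, whose absolute value is
    less than D_n + (N_n - D_n) = N_n. So mu_n = l_n, and equality holds at n. *)
Lemma partial_pairing_inj l mu M : (forall i, (`|l i| <= a i)%N) ->
  (forall n, (n < M)%N -> (`|partial_pairing mu n| < N n - D n)%N) ->
  partial_pairing mu M = partial_pairing l M -> forall i, (i < M)%N -> mu i = l i.
Proof.
move=> lF muD; suff h n : (n <= M)%N -> partial_pairing mu n = partial_pairing l n ->
    forall i, (i < n)%N -> mu i = l i by exact: h.
elim: n => [//|n ih] nM; rewrite !partial_pairingS => e.
have mul : mu n = l n.
  have h1 := muD _ nM; have h2 := partial_pairing_le n lF; have h3 := max_pairing_lt n.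
  have {}e : partial_pairing l n - partial_pairing mu n = (mu n - l n) * tau n by lia.
  have lt : (`|((mu n - l n) * tau n)%R| < `|tau n|)%N by rewrite -e; lia.
  have [//|ne] := eqVneq (mu n) (l n).
  by move: lt; rewrite abszM; nia.
have en : partial_pairing mu n = partial_pairing l n by move: e; rewrite mul; lia.
by move=> i; rewrite ltnS leq_eqVlt => /predU1P[->//|]; exact: ih (ltnW nM) en i.
Qed.

Section real_multiplier.
Context {R : realType}.

Definition vallee_poussin (n : nat) (p : int) : R :=
  ((N n)%:R - 2 * (D n)%:R)^-1 * ((tri (N n - D n) p)%:R - (tri (D n) p)%:R).

Definition vallee_poussin_maj (n : nat) (p : int) : R :=
  ((N n)%:R - 2 * (D n)%:R)^-1 * ((tri (N n - D n) p)%:R + (tri (D n) p)%:R).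

Definition multiplier M l : R :=
  \prod_(n < M) vallee_poussin n (partial_pairing l n).

Definition multiplier_maj M l : R :=
  \prod_(n < M) vallee_poussin_maj n (partial_pairing l n).

Lemma gap_gt0 n : 0 < (N n)%:R - 2 * (D n)%:R :> R.
Proof. by have := max_pairing_lt n; rewrite subr_gt0 -natrM ltr_nat. Qed.

Lemma multiplier1 M l : (forall i, (`|l i| <= a i)%N) -> multiplier M l = 1.
Proof.
move=> lF; apply: big1 => n _; rewrite /vallee_poussin !triE.
have h1 := partial_pairing_le n lF; have h3 := max_pairing_lt n.
rewrite -natrB; last by lia.
rewrite -natrM -natrB; last by lia.
(* For |p| <= D_n both truncated subtractions are exact and |p| cancels in (N_n - D_n - |p|) - (D_n
   - |p|). *)
set u := (X in _ * X); rewrite (_ : u = (N n - 2 * D n)%:R); last by congr _%:R; lia.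
by rewrite mulVf// pnatr_eq0; lia.
Qed.

Lemma multiplier_maj_supp M l n : multiplier_maj M l != 0 -> (n < M)%N ->
  (`|partial_pairing l n| < N n - D n)%N.
Proof.
move=> /prodf_neq0 h nM; have /= := h (Ordinal nM) isT.
rewrite /vallee_poussin_maj !triE; apply: contraNT; rewrite -leqNgt => le.
have h3 := max_pairing_lt n.
have -> : (N n - D n - `|partial_pairing l n| = 0)%N by lia.
have -> : (D n - `|partial_pairing l n| = 0)%N by lia.
by rewrite addr0 mulr0.
Qed.

Lemma multiplier_supp M l : multiplier M l != 0 -> multiplier_maj M l != 0.
Proof.
move=> /prodf_neq0 h; apply/prodf_neq0 => n _; have := h n isT.
rewrite /vallee_poussin /vallee_poussin_maj !mulf_eq0 !negb_or => /andP[-> /=].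
apply: contra; rewrite paddr_eq0// => /andP[/eqP -> /eqP ->].
by rewrite subrr.
Qed.

Lemma multiplier_maj0 M : multiplier_maj M (fun=> 0) =
  \prod_(n < M) (1 - 2 * ((D n)%:R / (N n)%:R))^-1.
Proof.
apply: eq_bigr => n _; rewrite /partial_pairing big1; last by move=> i _; rewrite mul0r.
rewrite /vallee_poussin_maj !triE absz0 !subn0 -natrD.
have h3 := max_pairing_lt n; rewrite subnK; last by lia.
have N0 : (N n)%:R != 0 :> R by rewrite pnatr_eq0; lia.
have := gap_gt0 n => /lt0r_neq0 g0.
have g1 : 1 - 2 * ((D n)%:R / (N n)%:R) != 0 :> R.
  apply: contra g0 => /eqP e; apply/eqP.
  transitivity ((N n)%:R * (1 - 2 * ((D n)%:R / (N n)%:R)) : R); last by rewrite e mulr0.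
  by field.
by field; rewrite N0 g0.
Qed.

(** Partial pairings are additive, so factor n is a combination of triangles at h_j - h_k with h_j =
    <e_j>_n, and [dominated_tri] adds one factor at a time. *)
Lemma dominated_multiplier (J : finType) (e : J -> nat -> int) M :
  dominated (fun j k : J => multiplier M (fun i => e j i - e k i))
    (fun j k => multiplier_maj M (fun i => e j i - e k i)).
Proof.
elim: M => [|M ih].
  rewrite (_ : (fun j k => multiplier _ _) = fun _ _ => 1); last first.
    by apply/funext => j; apply/funext => k; rewrite /multiplier big_ord0.
  rewrite (_ : (fun j k => multiplier_maj _ _) = fun _ _ => 1); last first.
    by apply/funext => j; apply/funext => k; rewrite /multiplier_maj big_ord0.
  exact/dominated_refl/psd1.
rewrite (_ : (fun j k => multiplier _ _) = fun j k =>
    multiplier M (fun i => e j i - e k i) *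
    vallee_poussin M (partial_pairing (e j) M - partial_pairing (e k) M)); last first.
  apply/funext => j; apply/funext => k.
  by rewrite /multiplier big_ord_recr/= partial_pairingB.
rewrite (_ : (fun j k => multiplier_maj _ _) = fun j k =>
    multiplier_maj M (fun i => e j i - e k i) *
    vallee_poussin_maj M (partial_pairing (e j) M - partial_pairing (e k) M)); last first.
  apply/funext => j; apply/funext => k.
  by rewrite /multiplier_maj big_ord_recr/= partial_pairingB.
by apply: dominated_tri => //; rewrite invr_ge0 ltW ?gap_gt0.
Qed.

Lemma multiplier_maj0_le M : cvgn (series (@ratio_term R a tau)) ->
  multiplier_maj M (fun=> 0) <= expR (6 * limn (series (@ratio_term R a tau)) +
                                      36 * limn (series (@ratio_term R a tau)) ^+ 2).
Proof.
move=> cv; set s := limn _.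
have N_gt0 n : 0 < (N n)%:R :> R by rewrite ltr0n; have := max_pairing_lt n; lia.
have ratio0 n : 0 <= @ratio_term R a tau n.
  by rewrite /ratio_term divr_ge0// mulr_ge0// mulr_ge0.
(* 1 / d_n is the n-th factor of w+(0). Below, r_n is the n-th summand of the series without its
   factor a_(n+1) >= 1, hence no larger. *)
pose d n : R := 1 - 2 * ((D n)%:R / (N n)%:R).
pose r n : R := (a n)%:R * (N n)%:R / (N n.+1)%:R.
have tauR n : `|(tau n)%:~R| = (N n)%:R :> R by rewrite -intr_norm -abszE.
have s0 n : \sum_(k < n) r k <= s.
  apply: (@le_trans _ _ (series (@ratio_term R a tau) n)); last first.
    apply: nondecreasing_cvgn_le => //; apply: nondecreasing_series => k _ _.
    exact: ratio0.
  rewrite /series/= big_mkord; apply: ler_sum => k _.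
  rewrite /ratio_term !tauR /r ler_wpM2r ?invr_ge0// ler_peMr ?mulr_ge0//.
  by rewrite ler1n a_gt0.
rewrite multiplier_maj0.
case: M => [|M].
  rewrite big_ord0 (le_trans _ (expR_ge1Dx _))// lerDl.
  by have := s0 0%N; rewrite big_ord0 => s1; rewrite addr_ge0// mulr_ge0// exprn_ge0.
apply: (@prod_constant R d r s) => //.
- by rewrite /d /max_pairing big_ord0 mul0r mulr0 subr0.
- move=> n; have q0 : 0 <= 2 * ((D n)%:R / (N n)%:R) :> R by rewrite mulr_ge0// divr_ge0.
  rewrite /d gerBl q0 andbT subr_gt0 mulrA ltr_pdivrMr// mul1r -natrM ltr_nat.
  exact: max_pairing_lt.
- move=> n; rewrite /r divr_ge0// ?mulr_ge0//= ler_pdivrMr//.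
  by rewrite ler_pdivlMl// -!natrM ler_nat lacunarity.
- move=> n; rewrite /d /r max_pairingS natrD natrM.
  have Nn := N_gt0 n; have NSn := N_gt0 n.+1; have an : 1 <= (a n)%:R :> R by rewrite ler1n.
  set x := (D n)%:R; set y := (N n)%:R in Nn *; set z := (N n.+1)%:R in NSn *.
  set b := (a n)%:R in an *.
  (* After this rewriting the recursive inequality is [x <= b * x], that is D_n <= a_n D_n. *)
  have -> : 1 - 3 * (b * y / z) + b * y / z * (1 - 2 * (x / y)) =
      1 - 2 * ((b * x + b * y) / z) by field; rewrite !lt0r_neq0.
  have z0 : 0 <= z^-1 by rewrite invr_ge0 ltW.
  by rewrite lerD2l lerN2 ler_wpM2l// ler_wpM2r// lerD2r ler_peMl.
Qed.

End real_multiplier.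
End multiplier.

(** * Completeness of L1 and transfer of approximations *)

Section L1_completeness.
Context d (X : measurableType d) (R : realType) (mu : probability X R).

(** G = sum_k |u_k| has integral at most C by monotone convergence, so it is finite almost
    everywhere and dominates all partial sums. *)
Lemma L1_complete_real (u : nat -> X -> R) (C : R) :
  (forall k, mu.-integrable setT (EFin \o u k)) ->
  (forall n, \sum_(k < n) \int[mu]_x `|u k x| <= C) ->
  exists h : X -> R, mu.-integrable setT (EFin \o h) /\
    forall e, 0 < e -> exists N, forall n, (N <= n)%N ->
      \int[mu]_x `|\sum_(k < n) u k x - h x| <= e.
Proof.
move=> ui uC.
have mu_ k : measurable_fun setT (u k) by apply/measurable_EFinP; exact: measurable_int (ui k).
have mau k : measurable_fun setT (fun x => `|u k x|) by exact: measurableT_comp.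
pose G x := (\sum_(k <oo) `|u k x|%:E)%E.
have mG : measurable_fun setT G.
  rewrite (_ : G = fun x => (\sum_(k <oo | k \in xpredT) `|u k x|%:E)%E); last first.
    by apply/funext => x; apply: eq_eseriesl.
  apply: ge0_emeasurable_sum; first by move=> k x _ _; rewrite lee_fin.
  by move=> k _; exact/measurable_EFinP.
have G0 x : (0 <= G x)%E by apply: nneseries_ge0 => k _ _; rewrite lee_fin.
have iG : mu.-integrable setT G.
  apply/integrableP; split=> //; under eq_integral do rewrite gee0_abs//.
  rewrite /G integral_nneseries//; last by move=> k; exact/measurable_EFinP.
  apply: (@le_lt_trans _ _ C%:E); last exact: ltry.
  apply: lime_le; first by apply: is_cvg_nneseries => k _ _; exact: integral_ge0.
  apply: nearW => n; rewrite big_mkord.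
  rewrite (eq_bigr (fun k : 'I_n => (\int[mu]_x `|u k x|)%:E)); last first.
    move=> k _; rewrite /Rintegral fineK//.
    exact: integrable_fin_num (integrable_norm (ui k)).
  by rewrite sumEFin lee_fin; exact: uC.
pose A := [set x | (G x < +oo)%E].
have mA : measurable A by rewrite -[A]setTI; exact: emeasurable_fun_infty_o.
(* Cutting off the null set where [G] is infinite makes the sequence converge at every point, which
   gives a measurable limit. *)
pose v n x : R := (\sum_(k < n) u k x) * \1_A x.
have mv n : measurable_fun setT (v n).
  apply: measurable_funM; first exact: measurable_sum.
  exact: measurable_indic.
have cv x : cvgn (v ^~ x).
  rewrite /v indicE; case: (boolP (x \in A)) => [/set_mem Ax|_] /=.
    under eq_fun do rewrite mulr1.
    suff : cvgn (series (fun k => u k x)).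
      by rewrite /series/=; under eq_fun do rewrite big_mkord.
    apply: normed_cvg; apply: nondecreasing_is_cvgn.
      by apply: nondecreasing_series => k _ _; exact: normr_ge0.
    exists (fine (G x)) => _ [n _ <-]; rewrite /series/= -lee_fin fineK; last first.
      by rewrite ge0_fin_numE.
    rewrite -sumEFin big_mkord -(big_mkord xpredT (fun k => (`|u k x|)%:E)).
    by apply: nneseries_lim_ge => k _ _; rewrite lee_fin.
  under eq_fun do rewrite mulr0.
  exact: is_cvg_cst.
pose h x : R := limn (v ^~ x).
have mh : measurable_fun setT h.
  by apply: (measurable_fun_cvg mv) => x _; exact: cv.
have aeA : {ae mu, forall x, A x}.
  apply: filterS (integrable_ae measurableT iG) => x /(_ I).
  by rewrite ge0_fin_numE.
pose S n x := (\sum_(k < n) u k x)%:E.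
have mS n : measurable_fun setT (S n).
  by apply/measurable_EFinP; exact: measurable_sum.
have Sh : {ae mu, forall x, setT x -> S ^~ x @ \oo --> (EFin \o h) x}.
  apply: filterS aeA => x Ax _; apply: cvg_EFin; first exact: nearW.
  rewrite (_ : fine \o S ^~ x = v ^~ x); first exact: cv.
  by apply/funext => n; rewrite /v /= indicE mem_set// mulr1.
have Sg : {ae mu, forall x n, setT x -> (`|S n x| <= G x)%E}.
  apply: aeW => x n _; rewrite /S /= /abse.
  apply: (@le_trans _ _ (\sum_(k < n) `|u k x|)%:E).
    by rewrite lee_fin ler_norm_sum.
  rewrite -sumEFin -(big_mkord xpredT (fun k => (`|u k x|)%:E)).
  by apply: nneseries_lim_ge => k _ _; rewrite lee_fin.
have mhE : measurable_fun setT (EFin \o h) by exact/measurable_EFinP.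
have [ih cvh _] := dominated_convergence measurableT mS mhE Sh iG Sg.
exists h; split=> // e e0.
have /fine_cvgP[_ /cvgrPdist_le /(_ _ e0)[N _ hN]] := cvh.
exists N => n Nn; have := hN n Nn; rewrite /= sub0r normrN; apply: le_trans.
rewrite -[leLHS]ger0_norm//; apply: Rintegral_ge0 => x _; exact: normr_ge0.
Qed.

Implicit Types f g : nat -> X -> R[i].

Lemma L1_complete f (C : R) : (forall n, cintegrable mu (f n)) ->
  (forall n, L1norm mu (fun x => f n.+1 x - f n x) <= C * 2^-1 ^+ n) ->
  exists g : X -> R[i], cintegrable mu g /\
    forall e, 0 < e -> exists N, forall n, (N <= n)%N ->
      L1norm mu (fun x => f n x - g x) <= e.
Proof.
move=> fi fC.
pose df n x := f n.+1 x - f n x.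
have dfi n : cintegrable mu (df n) by exact: cintegrableB.
have sumC n : \sum_(k < n) L1norm mu (df k) <= C * 2.
  have C0 : 0 <= C by have := fC 0%N; rewrite expr0 mulr1; exact/le_trans/L1norm_ge0.
  (* The exact geometric partial sum, which the induction can carry. *)
  suff : \sum_(k < n) L1norm mu (df k) <= C * (2 - 2 * 2^-1 ^+ n).
    by move=> /le_trans; apply; rewrite ler_wpM2l// gerBl mulr_ge0// exprn_ge0// invr_ge0.
  elim: n => [|n ih]; first by rewrite big_ord0 expr0 mulr1 subrr mulr0.
  rewrite big_ord_recr/=; have h := fC n; rewrite exprSr.
  by move: (2^-1 ^+ n) ih h => t; rewrite -/(df n); lra.
have iRe n : mu.-integrable setT (EFin \o (fun x => Re (df n x))) by exact: (dfi n).1.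
have iIm n : mu.-integrable setT (EFin \o (fun x => Im (df n x))) by exact: (dfi n).2.
have sumRe n : \sum_(k < n) \int[mu]_x `|Re (df k x)| <= C * 2.
  apply: le_trans (sumC n); apply: ler_sum => k _; apply: le_Rintegral => //.
  - exact: integrable_norm.
  - exact: cintegrable_normc.
  - by move=> x _; exact: Re_le_normc.
have sumIm n : \sum_(k < n) \int[mu]_x `|Im (df k x)| <= C * 2.
  apply: le_trans (sumC n); apply: ler_sum => k _; apply: le_Rintegral => //.
  - exact: integrable_norm.
  - exact: cintegrable_normc.
  - by move=> x _; exact: Im_le_normc.
have [h1 [h1i h1P]] := L1_complete_real iRe sumRe.
have [h2 [h2i h2P]] := L1_complete_real iIm sumIm.
have tel n x : f n x = f 0%N x + \sum_(k < n) df k x.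
  elim: n => [|n ih]; first by rewrite big_ord0 addr0.
  by rewrite big_ord_recr/= addrA -ih addrC subrK.
pose h x : R[i] := h1 x +i* h2 x.
have hi : cintegrable mu h by split.
exists (fun x => f 0%N x + h x); split; first exact: cintegrableD.
move=> e e0; have e20 : 0 < e / 2 by rewrite divr_gt0.
have [N1 N1P] := h1P _ e20; have [N2 N2P] := h2P _ e20.
exists (maxn N1 N2) => n; rewrite geq_max => /andP[/N1P + /N2P].
have si n' : cintegrable mu (fun x => \sum_(k < n') df k x) by exact: cintegrable_sum.
have [sh1 sh2] := cintegrableB (si n) hi.
have ReS n' x : Re (\sum_(k < n') df k x - h x) = \sum_(k < n') Re (df k x) - h1 x.
  rewrite ReD ReN /=; congr (_ - _).
  by elim/big_ind2 : _ => // x1 x2 y1 y2 <- <-; rewrite ReD.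
have ImS n' x : Im (\sum_(k < n') df k x - h x) = \sum_(k < n') Im (df k x) - h2 x.
  rewrite ImD ImN /=; congr (_ - _).
  by elim/big_ind2 : _ => // x1 x2 y1 y2 <- <-; rewrite ImD.
move=> le1 le2.
have -> : e = e / 2 + e / 2 by lra.
apply: le_trans (lerD le1 le2).
under eq_fun do rewrite tel opprD addrACA subrr add0r.
under [X in _ <= X + _]eq_Rintegral do rewrite -ReS.
under [X in _ <= _ + X]eq_Rintegral do rewrite -ImS.
have i1 := integrable_norm sh1; have i2 := integrable_norm sh2.
rewrite -RintegralD//; apply: le_L1norm; first exact: cintegrableB.
  exact: (integrableD measurableT i1 i2).
by move=> x; exact: normc_le_ReIm.
Qed.

End L1_completeness.

(** A list may repeat a frequency, so that addition is concatenation and the Fejer sums can be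
    indexed by pairs of box points. *)
Definition combination (R : realType) (X : Type) (I : Type) (chi : I -> X -> R[i])
  (s : seq (I * R[i])) (x : X) : R[i] := \sum_(z <- s) z.2 * chi z.1 x.

Section combinations.
Context {d} {X : measurableType d} {R : realType} (mu : probability X R).
Context {I : choiceType} (chi : I -> X -> R[i]) (F : set I).
Hypothesis mchi : forall i, cmeasurable (chi i).
Hypothesis nchi : forall i x, normc (chi i x) = 1.
Hypothesis orth : forall i j, F i -> F j ->
  cintegral mu (fun x => chi i x * (chi j x)^*) = (i == j)%:R.
Implicit Types s : seq (I * R[i]).

Lemma char_cintegrable i : cintegrable mu (chi i).
Proof. by apply: (bounded_cintegrable (M := 1) mu (mchi i)) => x; rewrite nchi. Qed.

Lemma combination_cintegrable s : cintegrable mu (combination chi s).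
Proof. by apply: cintegrable_sum => z; apply: cintegrableZ; exact: char_cintegrable. Qed.

Lemma combination_cat s t x :
  combination chi (s ++ t) x = combination chi s x + combination chi t x.
Proof. exact: big_cat. Qed.

Lemma combinationZ (c : R[i]) s x :
  combination chi [seq (z.1, c * z.2) | z <- s] x = c * combination chi s x.
Proof. by rewrite /combination big_map mulr_sumr; apply: eq_bigr => z _; rewrite mulrA. Qed.

Lemma cintegrable_char_conj f i : cintegrable mu f ->
  cintegrable mu (fun x => f x * (chi i x)^*).
Proof.
move=> fi; apply: (cintegrableM (M := 1) fi (cmeasurableJ (mchi i))) => x.
by rewrite normc_conj nchi.
Qed.

Lemma fourier_le f i : cintegrable mu f -> normc (fourier mu chi f i) <= L1norm mu f.
Proof.
move=> fi; apply: le_trans (normc_cintegral (cintegrable_char_conj i fi)) _.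
apply: le_L1norm; first exact: cintegrable_char_conj.
  exact: cintegrable_normc.
by move=> x; rewrite ComplexField.Normc.normcM normc_conj nchi mulr1.
Qed.

Lemma fourierB f g i : cintegrable mu f -> cintegrable mu g ->
  fourier mu chi (fun x => f x - g x) i = fourier mu chi f i - fourier mu chi g i.
Proof.
move=> fi gi; rewrite /fourier; under [fun x => _]eq_fun do rewrite mulrBl.
by rewrite cintegralB//; exact: cintegrable_char_conj.
Qed.

Lemma fourierZD (c : R[i]) f g i : cintegrable mu f -> cintegrable mu g ->
  fourier mu chi (fun x => c * f x + g x) i = c * fourier mu chi f i + fourier mu chi g i.
Proof.
move=> fi gi; rewrite /fourier; under [fun x => _]eq_fun do rewrite mulrDl -mulrA.
have fc := cintegrable_char_conj i fi.
rewrite cintegralD ?cintegralZ//; first exact: cintegrableZ.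
exact: cintegrable_char_conj.
Qed.

Lemma fourier_combination s j : (forall z, z \in s -> F z.1) -> F j ->
  fourier mu chi (combination chi s) j = \sum_(z <- s | z.1 == j) z.2.
Proof.
move=> sF Fj; rewrite /fourier /combination.
under [fun x => _]eq_fun do rewrite mulr_suml.
rewrite cintegral_sum; last first.
  by move=> z; apply: cintegrable_char_conj; apply: cintegrableZ; exact: char_cintegrable.
rewrite [RHS]big_mkcond [LHS]big_seq [RHS]big_seq; apply: eq_bigr => z zs.
under [fun x => _]eq_fun do rewrite -mulrA.
rewrite cintegralZ; last by apply: cintegrable_char_conj; exact: char_cintegrable.
by rewrite orth//; [case: eqP => _; rewrite ?mulr1 ?mulr0|exact: sF].
Qed.

Definition approximable (f : X -> R[i]) := forall e : R, 0 < e -> exists s,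
  (forall z, z \in s -> F z.1) /\ L1norm mu (fun x => f x - combination chi s x) <= e.

End combinations.

Section extension.
Context d (X : measurableType d) d' (Y : measurableType d') (R : realType).
Context (mu : probability X R) (nu : probability Y R) (I : choiceType) (F : set I).
Context (a : I -> X -> R[i]) (b : I -> Y -> R[i]) (K : R).
Hypothesis ma : forall i, cmeasurable (a i).
Hypothesis mb : forall i, cmeasurable (b i).
Hypothesis na : forall i x, normc (a i x) = 1.
Hypothesis nb : forall i x, normc (b i x) = 1.
Hypothesis oa : forall i j, F i -> F j ->
  cintegral mu (fun x => a i x * (a j x)^*) = (i == j)%:R.
Hypothesis ob : forall i j, F i -> F j ->
  cintegral nu (fun x => b i x * (b j x)^*) = (i == j)%:R.
Hypothesis K0 : 0 <= K.
Hypothesis abK : forall s, (forall z, z \in s -> F z.1) ->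
  L1norm nu (combination b s) <= K * L1norm mu (combination a s).

(** Continuous extension carried out on one function: the images of its approximants are Cauchy by
    [abK], and coefficients, being L1 continuous, pass to the limit. Both systems share one index
    set, so the lemma applies in either direction. *)
Lemma transfer f : cintegrable mu f -> approximable mu a F f ->
  exists g, [/\ cintegrable nu g, approximable nu b F g,
    forall i, F i -> fourier nu b g i = fourier mu a f i &
    L1norm nu g <= K * L1norm mu f].
Proof.
move=> fi fF.
have /choice[s sP] : forall n : nat, exists s, (forall z, z \in s -> F z.1) /\
    L1norm mu (fun x => f x - combination a s x) <= 2^-1 ^+ n.
  by move=> n; apply: fF; rewrite exprn_gt0// invr_gt0.
pose p n := combination a (s n); pose q n := combination b (s n).
have pi n : cintegrable mu (p n) by exact: combination_cintegrable.
have qi n : cintegrable nu (q n) by exact: combination_cintegrable.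
have fp n : L1norm mu (fun x => f x - p n x) <= 2^-1 ^+ n by case: (sP n).
have qK n : L1norm nu (q n) <= K * L1norm mu (p n) by apply: abK; case: (sP n).
(* The distance of p_(n+1) and p_n is at most 2^-(n+1) + 2^-n, which is below twice 2^-n. *)
have qcauchy n : L1norm nu (fun y => q n.+1 y - q n y) <= (K * 2) * 2^-1 ^+ n.
  pose t := s n.+1 ++ [seq (z.1, -1 * z.2) | z <- s n].
  have tF z : z \in t -> F z.1.
    rewrite mem_cat => /orP[|/mapP[z' z's ->]]; first by case: (sP n.+1) => + _; exact.
    by case: (sP n) => /(_ _ z's).
  have -> : (fun y => q n.+1 y - q n y) = combination b t.
    by apply/funext => y; rewrite combination_cat combinationZ mulN1r.
  apply: (le_trans (abK tF)); rewrite -mulrA ler_wpM2l//.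
  have -> : combination a t = (fun x => p n.+1 x - p n x).
    by apply/funext => y; rewrite combination_cat combinationZ mulN1r.
  apply: (le_trans (L1normB (pi n.+1) fi (pi n))).
  rewrite L1normBC; have h1 := fp n; have h2 := fp n.+1.
  have h3 : 0 <= 2^-1 ^+ n :> R by rewrite exprn_ge0// invr_ge0.
  move: h1 h2; rewrite exprS; move: (2^-1 ^+ n) h3 => t0; lra.
have [g [gi gP]] := L1_complete qi qcauchy.
have smalln (e : R) : 0 < e -> exists N, forall n, (N <= n)%N -> 2^-1 ^+ n <= e.
  move=> e0; have /cvgrPdist_le /(_ _ e0)[N _ NP] : (2^-1 ^+ n : R) @[n --> \oo] --> (0 : R).
    by apply: cvg_expr; rewrite ger0_norm ?invr_ge0// invf_lt1// ltr1n.
  exists N => n Nn; have := NP n Nn; rewrite /= sub0r normrN ger0_norm ?exprn_ge0 ?invr_ge0//.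
have both (e : R) : 0 < e -> exists n, 2^-1 ^+ n <= e /\ L1norm nu (fun y => q n y - g y) <= e.
  move=> e0; have [N1 P1] := smalln _ e0; have [N2 P2] := gP _ e0.
  by exists (maxn N1 N2); split; [apply: P1|apply: P2]; rewrite leq_max leqnn ?orbT.
exists g; split=> //.
- move=> e e0; have [N NP] := gP _ e0; exists (s N); split; first by case: (sP N).
  by rewrite L1normBC; exact: NP.
- move=> i Fi; apply/eqP; rewrite -subr_eq0; apply/eqP/ComplexField.Normc.eq0_normc.
  apply/eqP; rewrite eq_le normc_ge0 andbT; apply/ler_addgt0Pl => e e0; rewrite addr0.
  have [n [n1 n2]] := both (e / 2) (divr_gt0 e0 (ltr0Sn _ _)).
  have pq : fourier mu a (p n) i = fourier nu b (q n) i.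
    by case: (sP n) => sF _; rewrite (fourier_combination _ _ oa)// (fourier_combination _ _ ob).
  rewrite -(subrK (fourier nu b (q n) i) (fourier nu b g i)) -addrA -{2}pq.
  apply: (le_trans (le_normcD _ _)); rewrite -!fourierB//.
  have h1 := fourier_le mb nb i (cintegrableB gi (qi n)).
  have h2 := fourier_le ma na i (cintegrableB (pi n) fi).
  rewrite L1normBC in h1; rewrite L1normBC in h2; have := fp n; lra.
- apply/ler_addgt0Pl => e e0.
  (* With e' = e / (1 + K), e' + K e' = e: one share for g - q_n and K shares for f - p_n. *)
  have e1 : 0 < e / (1 + K) by rewrite divr_gt0// ltr_wpDr.
  have [n [n1 n2]] := both _ e1.
  have hg : L1norm nu g <= L1norm nu (fun y => g y - q n y) + L1norm nu (q n).
    rewrite (le_trans _ (L1normD _ _))//; last exact: cintegrableB.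
    by under [in leRHS]eq_fun do rewrite subrK.
  have hp : L1norm mu (p n) <= L1norm mu (fun x => p n x - f x) + L1norm mu f.
    rewrite (le_trans _ (L1normD _ _))//; last exact: cintegrableB.
    by under [in leRHS]eq_fun do rewrite subrK.
  have e2 : e = e / (1 + K) + K * (e / (1 + K)).
    by field; rewrite lt0r_neq0// ltr_wpDr.
  rewrite L1normBC in hg; rewrite L1normBC in hp.
  have hpe : L1norm mu (p n) <= e / (1 + K) + L1norm mu f by have := fp n; lra.
  have := ler_wpM2l K0 hpe; have := qK n; rewrite mulrDr; lra.
Qed.

End extension.

(** * Characters *)

Section circle.
Context {R : realType}.
Implicit Types (t x : R) (b : int).

Lemma e2pi_norm t : normc (e2pi t) = 1.
Proof. by rewrite /= cos2Dsin2 sqrtr1. Qed.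

Lemma e2piD s t : e2pi (s + t) = e2pi s * e2pi t :> R[i].
Proof.
apply: complex_eqP; rewrite ?ReM ?ImM /= mulrDr; first exact: cosD.
by rewrite sinD addrC [cos _ * _]mulrC [sin _ * cos _]mulrC; ring.
Qed.

Lemma e2piN t : e2pi (- t) = (e2pi t)^* :> R[i].
Proof. by apply: complex_eqP; rewrite ?ReJ ?ImJ /= mulrN ?cosN ?sinN. Qed.

Lemma e2pi0 : e2pi 0 = 1 :> R[i].
Proof. by apply: complex_eqP; rewrite /= mulr0 ?cos0 ?sin0. Qed.

Lemma e2pi_int b : e2pi b%:~R = 1 :> R[i].
Proof.
have nat n : e2pi n%:R = 1 :> R[i].
  elim: n => [|n ih]; first exact: e2pi0.
  rewrite -natr1 e2piD ih mul1r.
  by apply: complex_eqP; rewrite /= mulr1 mulr_natl ?cos2pi ?sin2pi.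
case: b => n; first exact: nat.
rewrite NegzE mulrNz e2piN [X in e2pi X](_ : _ = n.+1%:R)// nat.
by apply: complex_eqP; rewrite /= ?oppr0.
Qed.

(** The uniform probability on [0, 1] agrees with [haarT], the point 1 being null, and for it the
    fundamental theorem of calculus applies on the closed interval. *)
Lemma integral_haarT (g G : R -> R) : (forall x, 0 <= g x) -> continuous g ->
  (forall x, is_derive x 1 G (g x)) -> (\int[haarT]_x (g x)%:E = (G 1 - G 0)%:E)%E.
Proof.
move=> g0 cg dG.
transitivity (\int[uniform_prob (@ltr01 R)]_x (g x)%:E)%E.
  apply: eq_measure_integral => A mA _.
  transitivity (\int[lebesgue_measure]_(x in A) (uniform_pdf 0 1 x)%:E)%E; last by [].
  rewrite integral_uniform_pdf.
  rewrite (eq_integral (fun=> 1%E)); last first.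
    move=> x; rewrite inE/= => -[_]; rewrite in_itv/= => x01.
    by rewrite /uniform_pdf x01 subr0 invr1.
  rewrite integral_cst ?mul1e; last by apply: measurableI => //; exact: measurable_itv.
  have -> : A `&` `[0, 1]%classic = (A `&` `[0, 1[%classic) `|` (A `&` [set 1]).
    by rewrite -[RHS](@setIUr R) (setUitv1 true) ?bnd_simp.
  rewrite measureU0//; [by apply: measurableI; [|exact: measurable_itv]|exact: measurableI|].
  have [A1|A1] := pselect (A 1).
    have -> : A `&` [set 1] = [set 1] by apply/seteqP; split=> x /=; [case|move=> ->].
    exact: lebesgue_measure_set1.
  have -> : A `&` [set 1] = set0; last exact: measure0.
  by rewrite -subset0 => x [Ax /= x1]; apply: A1; rewrite -x1.
have mg : measurable_fun setT (EFin \o g).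
  by apply/measurable_EFinP; exact: continuous_measurable_fun.
rewrite integral_uniform//.
rewrite subr0 invr1 mul1e (@continuous_FTC2 _ g G)//.
- exact: continuous_subspaceT.
- have cG x : {for x, continuous G}.
    by apply: differentiable_continuous; apply/derivable1_diffP; exact: ex_derive.
  split.
  + by move=> x _; exact: ex_derive.
  + by apply: cvg_at_right_filter; exact: cG.
  + by apply: cvg_at_left_filter; exact: cG.
- by move=> x _; rewrite derive1E; exact: derive_val.
Qed.

Lemma integral_haarT_signed (g G : R -> R) : (forall x, `|g x| <= 1) -> continuous g ->
  (forall x, is_derive x 1 G (g x)) -> \int[haarT]_x g x = G 1 - G 0.
Proof.
move=> g1 cg dG.
have mg : measurable_fun setT g by exact: continuous_measurable_fun.
have gi : (haarT : probability _ R).-integrable setT (EFin \o g).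
  exact: (bounded_integrable haarT mg g1).
(* Adding 1 makes the integrand nonnegative, with primitive x + G x. *)
have : \int[haarT]_x (1 + g x) = 1 + G 1 - G 0.
  rewrite /Rintegral (@integral_haarT _ (fun x => x + G x)) /=; first by ring.
  - by move=> x; have := g1 x; rewrite ler_norml => /andP[]; lra.
  by move=> x; apply: continuousD; [exact: cst_continuous|exact: cg].
rewrite RintegralD//; last exact: finite_measure_integrable_cst.
rewrite Rintegral_cst// [X in fine X](probability_setT haarT) /=; lra.
Qed.

Lemma measurable_e2pi d (X : measurableType d) (h : X -> R) : measurable_fun setT h ->
  cmeasurable (fun y => e2pi (h y)).
Proof.
move=> mh; have m2 : measurable_fun setT (fun y => 2 * pi * h y) by exact: measurable_funM.
split; apply: (measurableT_comp _ m2); apply: continuous_measurable_fun.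
  exact: continuous_cos.
exact: continuous_sin.
Qed.

Lemma integral_charT b : cintegral haarT (@charT R b) = (b == 0)%:R.
Proof.
have [->|b0] := eqVneq b 0.
  rewrite (_ : charT 0 = fun=> 1) ?(cintegral_cst haarT)//.
  by apply/funext => x; rewrite /charT mul0r e2pi0.
pose w : R := 2 * pi * b%:~R.
have w0 : w != 0 by rewrite /w mulf_neq0 ?intr_eq0// mulf_neq0// gt_eqF// pi_gt0.
have dw x : is_derive x 1 (fun y : R => w * y) w.
  by apply: is_derive_eq; rewrite /GRing.scale/= mulr1.
have cw : continuous (fun x : R => w * x) by exact: mulrl_continuous.
have wE x : 2 * pi * (b%:~R * x) = w * x by rewrite mulrA.
have [cosw sinw] : cos w = 1 /\ sin w = 0 by have [] := e2pi_int b.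
have dsin x : is_derive x 1 (fun y => w^-1 * sin (w * y)) (cos (w * x)).
  have ds : is_derive x 1 (sin \o (fun y => w * y)) (cos (w * x) * w).
    exact: is_derive1_comp.
  have := is_deriveZ w^-1 ds; rewrite /GRing.scale/= mulrCA mulVf// mulr1; exact.
have dcos x : is_derive x 1 (fun y => - w^-1 * cos (w * y)) (sin (w * x)).
  have dc : is_derive x 1 (cos \o (fun y => w * y)) (- sin (w * x) * w).
    exact: is_derive1_comp.
  have := is_deriveZ (- w^-1) dc.
  by rewrite [_ *: (_ * w)](_ : _ = sin (w * x))// /GRing.scale/=; field.
apply: complex_eqP; rewrite /= /charT /e2pi/=.
  rewrite (_ : (fun x => _) = fun x => cos (w * x)); last by apply/funext => x; rewrite wE.
  rewrite (@integral_haarT_signed _ (fun x => w^-1 * sin (w * x)) _ _ dsin).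
  - by rewrite mulr1 mulr0 sin0 sinw mulr0 subrr.
  - by move=> x; rewrite ler_norml cos_geN1 cos_le1.
  - by move=> x; apply: continuous_comp; [exact: cw|exact: continuous_cos].
rewrite (_ : (fun x => _) = fun x => sin (w * x)); last by apply/funext => x; rewrite wE.
rewrite (@integral_haarT_signed _ (fun x => - w^-1 * cos (w * x)) _ _ dcos).
- by rewrite mulr1 mulr0 cos0 cosw subrr.
- by move=> x; rewrite ler_norml sin_geN1 sin_le1.
- by move=> x; apply: continuous_comp; [exact: cw|exact: continuous_sin].
Qed.

End circle.

(** * Averaging over one coordinate of the product *)

Section coordinates.
Context d (T : measurableType d) (R : realType) (P : probability T R).
Local Notation X := (seqspace T).
Local Notation Q := (product_probability P).

Definition update_coord (k : nat) (z : X * T) : X := fun i => if i == k then z.2 else z.1 i.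

Lemma measurable_update_coord k : measurable_fun setT (update_coord k).
Proof.
apply: measurable_fun_seqspace => i; rewrite /update_coord; case: (i == k).
  exact: measurable_snd.
exact: (measurableT_comp (measurable_coord i) measurable_fst).
Qed.

Let box (B : nat -> set T) n : set X := [set x | forall i, (i < n)%N -> B i (x i)].

Let boxes : set (set X) := [set A | exists (B : nat -> set T) n,
  (forall i, measurable (B i)) /\ A = box B n].

Let measurable_box B n : (forall i, measurable (B i)) -> measurable (box B n).
Proof.
move=> mB; rewrite (_ : box B n = \bigcap_(i < n) ((fun x : X => x i) @^-1` B i)).
  apply: bigcap_measurableType => // i _.
  by rewrite -[X in measurable X]setTI; exact: measurable_coord.
by apply/seteqP; split => x Bx i; exact: Bx.
Qed.

Let boxW (B : nat -> set T) n m : (n <= m)%N ->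
  box B n = box (fun i => if (i < n)%N then B i else setT) m.
Proof.
move=> nm; apply/seteqP; split => x Bx i.
  by move=> _; case: ifPn => // ni; exact: Bx.
by move=> ni; have := Bx i (leq_trans ni nm); rewrite ni.
Qed.

Let measurable_if (B : nat -> set T) n : (forall i, measurable (B i)) ->
  forall i, measurable (if (i < n)%N then B i else setT).
Proof. by move=> mB i; case: ifP. Qed.

Let measurableE : @measurable _ X = <<s boxes >>.
Proof.
apply/seteqP; split.
  apply: smallest_sub; first exact: smallest_sigma_algebra.
  move=> _ [n [B [mB ->]]]; apply: sub_sigma_algebra.
  exists (fun i => if i == n then B else setT), n.+1; split.
    by move=> i; case: ifP.
  apply/seteqP; split => x /=; first by move=> Bx i _; case: eqP => [->|].
  by move=> /(_ n (ltnSn n)); rewrite eqxx.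
apply: smallest_sub; first exact: sigma_algebra_measurable.
by move=> _ [B [n [mB ->]]]; exact: measurable_box.
Qed.

Let boxesI : setI_closed boxes.
Proof.
move=> _ _ [B [n [mB ->]]] [C [m [mC ->]]].
rewrite (boxW B (leq_maxl n m)) (boxW C (leq_maxr n m)).
exists (fun i => (if (i < n)%N then B i else setT) `&` (if (i < m)%N then C i else setT)),
  (maxn n m); split.
  by move=> i; apply: measurableI; exact: measurable_if.
by apply/seteqP; split => x; [move=> [h1 h2] i im; split; [exact: h1|exact: h2]|
  move=> h; split => i im; have [] := h i im].
Qed.

(** Both sides are the same product on boxes, which form a generating pi-system. With Fubini this
    allows coordinate [k] to be integrated first. *)
Lemma update_coord_invariant k (A : set X) : measurable A ->
  pushforward (Q \x P)%E (update_coord k) A = Q A.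
Proof.
move=> mA.
pose m1 : {measure set X -> \bar R} := pushforward (Q \x P)%E (update_coord k).
apply: (measure_unique boxes (fun=> setT) _ _ _ _ (m1 (measurable_update_coord k)) Q) => //.
- by move=> _; exists (fun=> setT), 0%N; split=> //; apply/seteqP; split.
- by rewrite bigcup_const.
- move=> _ [B [n [mB ->]]].
  (* Lengthening the box past [k] with full factors makes coordinate [k] one of its factors. *)
  pose N := maxn n k.+1; pose C i := if (i < n)%N then B i else setT.
  have -> : box B n = box C N by exact: boxW (leq_maxl n k.+1).
  have mC i : measurable (C i) by exact: measurable_if.
  have kN : (k < N)%N by rewrite leq_max ltnSn orbT.
  pose C' i := if i == k then setT else C i.
  have mC' i : measurable (C' i) by rewrite /C'; case: ifP.
  transitivity ((Q \x P)%E (box C' N `*` C k)).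
    congr ((Q \x P)%E _); apply/seteqP; split => -[x t] /=; rewrite /update_coord /=.
      move=> h; split; last by have := h k kN; rewrite eqxx.
      by move=> i iN; rewrite /C'; have := h i iN; case: eqP.
    move=> [h tC] i iN; case: eqP => [->//|/eqP/negPf ik].
    by have := h i iN; rewrite /C' ik.
  transitivity (Q (box C' N) * P (C k))%E.
    by apply: product_measure1E => //; exact: measurable_box.
  have -> : Q (box C' N) = (\prod_(i < N) P (C' i))%E := product_probabilityE P N mC'.
  transitivity (\prod_(i < N) P (C i))%E; last exact/esym/product_probabilityE.
  rewrite (bigD1 (Ordinal kN))//= [RHS](bigD1 (Ordinal kN))//= /C' eqxx.
  rewrite probability_setT mul1e muleC; congr (_ * _)%E.
  apply: eq_bigr => i ik; rewrite ifN//.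
- by move=> _; rewrite [ltLHS](_ : _ = 1%E) ?ltry//; exact: (probability_setT (Q \x P)%E).
Qed.

Lemma integral_update_coord k (f : X -> R) : Q.-integrable setT (EFin \o f) ->
  (\int[Q]_x (f x)%:E = \int[Q]_x \int[P]_t (f (update_coord k (x, t)))%:E)%E.
Proof.
move=> fi; have mu := measurable_update_coord k.
pose g := (EFin \o f) \o update_coord k.
have mEf := measurable_int _ fi.
have mg : measurable_fun setT g by exact: measurableT_comp.
have pushE (h : X -> \bar R) : (\int[Q]_x h x =
    \int[pushforward (Q \x P)%E (update_coord k)]_x h x)%E.
  by apply: eq_measure_integral => A mA _; exact: esym (update_coord_invariant k mA).
have gi : (Q \x P)%E.-integrable setT g.
  apply/integrableP; split=> //; case/integrableP: fi => _; rewrite pushE.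
  rewrite (@ge0_integral_pushforward _ _ _ _ _ (update_coord k))//.
  exact: measurableT_comp.
rewrite pushE (@integral_pushforward _ _ _ _ _ (update_coord k))//.
by rewrite -[LHS](integral12_prod_meas1 gi).
Qed.

Lemma cintegral_update_coord0 k (f : X -> R[i]) : cintegrable Q f ->
  (forall x, cintegrable P (fun t => f (update_coord k (x, t)))) ->
  (forall x, cintegral P (fun t => f (update_coord k (x, t))) = 0) -> cintegral Q f = 0.
Proof.
move=> [fR fI] fxi fx0.
(* [h] stands for the real or the imaginary part. *)
have z (h : R[i] -> R) : Q.-integrable setT (fun x => (h (f x))%:E) ->
    (forall x, P.-integrable setT (fun t => (h (f (update_coord k (x, t))))%:E)) ->
    (forall x, \int[P]_t h (f (update_coord k (x, t))) = 0) -> \int[Q]_x h (f x) = 0.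
  move=> hi hxi hx0; rewrite /Rintegral (integral_update_coord k hi) integral0_eq//.
  by move=> x _; rewrite -[LHS]fineK ?integrable_fin_num// [fine _]hx0.
by apply: complex_eqP; apply: z => //; move=> x;
  [case: (fxi x)|have /(congr1 (@complex.Re R)) := fx0 x|
   case: (fxi x)|have /(congr1 (@complex.Im R)) := fx0 x].
Qed.

Lemma pushforward_coord n (B : set T) : measurable B ->
  Q ((fun x : X => x n) @^-1` B) = P B.
Proof.
move=> mB; pose C i := if i == n then B else setT.
have mC i : measurable (C i) by rewrite /C; case: ifP.
rewrite (_ : _ @^-1` B = box C n.+1); last first.
  apply/seteqP; split => x /=; first by move=> Bx i _; rewrite /C; case: eqP => [->|].
  by move=> /(_ n (ltnSn n)); rewrite /C eqxx.
have -> : Q (box C n.+1) = (\prod_(i < n.+1) P (C i))%E := product_probabilityE P n.+1 mC.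
rewrite (bigD1 ord_max)//= big1 ?mule1 /C ?eqxx//.
by move=> i /negPf ; rewrite -val_eqE/= => ->; rewrite [LHS]probability_setT.
Qed.

End coordinates.

(** Multipliers and box points are plain sequences, where differences are taken entrywise;
    truncation turns them into indices of characters. *)
Definition trunc_seq (M : nat) (e : nat -> int) : dualTN :=
  [fsfun k in seq_fset tt (iota 0 M) => e k].

Lemma trunc_seqE M e k : trunc_seq M e k = if (k < M)%N then e k else 0.
Proof. by rewrite fsfunE seq_fsetE mem_iota add0n. Qed.

Definition supported (M : nat) (l : dualTN) := forall k, (M <= k)%N -> l k = 0.

Lemma trunc_seq_supported M e : supported M (trunc_seq M e).
Proof. by move=> k Mk; rewrite trunc_seqE ltnNge Mk. Qed.

Lemma supportedW M N l : (M <= N)%N -> supported M l -> supported N l.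
Proof. by move=> MN lM k Nk; apply: lM; exact: leq_trans Nk. Qed.

Lemma exists_supported (l : dualTN) : exists M, supported M l.
Proof.
exists (\max_(k <- finsupp l) k).+1 => k Mk; apply: contraTeq Mk => lk.
by rewrite -leqNgt (leq_bigmax_seq (F := id))// mem_finsupp.
Qed.

Lemma exists_supported_seq (C : eqType) (s : seq (dualTN * C)) :
  exists M, forall z, z \in s -> supported M z.1.
Proof.
elim: s => [|[l c] s [M MP]]; first by exists 0%N.
have [N NP] := exists_supported l; exists (maxn M N) => z.
rewrite inE => /predU1P[->|/MP]; last exact/supportedW/leq_maxl.
exact/(supportedW _ NP)/leq_maxr.
Qed.

Lemma sum_finsupp (V : zmodType) (l : dualTN) M (g : nat -> V) : supported M l ->
  (forall k, l k = 0 -> g k = 0) -> \sum_(k <- finsupp l) g k = \sum_(k < M) g k.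
Proof.
move=> lM g0; rewrite -(big_mkord xpredT) /index_iota subn0.
rewrite [RHS](bigID (fun k => k \in finsupp l))/= [X in _ + X]big1 ?addr0; last first.
  by move=> k; rewrite memNfinsupp => /eqP /g0.
rewrite -[RHS]big_filter; apply: perm_big; apply: uniq_perm.
- exact: fset_uniq.
- by rewrite filter_uniq ?iota_uniq.
- move=> k; rewrite mem_filter mem_iota add0n /=.
  have [|//] := boolP (k \in finsupp l); rewrite mem_finsupp => lk.
  by apply/esym; rewrite ltnNge; apply: contra lk => /lM ->.
Qed.

(** * Characters of T^N and of the circle, and their orthonormality *)

Section characters.
Context {R : realType}.
Implicit Types (l : dualTN) (e : nat -> int).

Lemma charTN_supported M l (x : nat -> R) : supported M l ->
  charTN l x = e2pi (\sum_(k < M) (l k)%:~R * x k).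
Proof.
by move=> lM; rewrite /charTN (sum_finsupp lM (g := fun k => (l k)%:~R * x k))// => k ->; rewrite mul0r.
Qed.

Lemma charTN_trunc M e (x : nat -> R) :
  charTN (trunc_seq M e) x = e2pi (\sum_(k < M) (e k)%:~R * x k).
Proof.
rewrite (charTN_supported _ (@trunc_seq_supported M e)); congr e2pi.
by apply: eq_bigr => k _; rewrite trunc_seqE ltn_ord.
Qed.

Lemma charTN_sub M e e' (x : nat -> R) : charTN (trunc_seq M (fun i => e i - e' i)) x =
  charTN (trunc_seq M e) x * (charTN (trunc_seq M e') x)^*.
Proof.
rewrite !charTN_trunc. rewrite -e2piN -e2piD -sumrN -big_split; congr e2pi.
by apply: eq_bigr => k _; rewrite /= rmorphB/= mulrBl.
Qed.

Lemma trunc_seqK M l : supported M l -> trunc_seq M l = l.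
Proof.
move=> lM; apply/fsfunP => k; rewrite trunc_seqE; case: ltnP => // Mk.
by rewrite lM.
Qed.

Lemma normc_charTN l (x : nat -> R) : normc (charTN l x) = 1.
Proof. exact: e2pi_norm. Qed.

Lemma normc_charT (b : int) (x : R) : normc (charT b x) = 1.
Proof. exact: e2pi_norm. Qed.

Lemma measurable_charTN l : cmeasurable (charTN l : torusN R -> R[i]).
Proof.
have [M lM] := exists_supported l.
rewrite (_ : charTN l = fun x => e2pi (\sum_(k < M) (l k)%:~R * x k)); last first.
  by apply/funext => x; exact: charTN_supported.
apply: measurable_e2pi; apply: measurable_sum => k.
by apply: measurable_funM => //; exact: measurable_coord.
Qed.

Lemma measurable_charT (b : int) : cmeasurable (@charT R b).
Proof. by apply: measurable_e2pi; exact: measurable_funM. Qed.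

Lemma charT_sub (b b' : int) (x : R) : charT (b - b') x = charT b x * (charT b' x)^*.
Proof. by rewrite /charT rmorphB mulrBl e2piD e2piN. Qed.

Lemma charTN_update_coord l k (x : torusN R) (t : measurableTypeR R) :
  charTN l (update_coord k (x, t)) = charTN l (update_coord k (x, 0)) * charT (l k) t.
Proof.
have [m lm] := exists_supported l.
pose M := maxn k.+1 m; have lM : supported M l by apply: supportedW lm; exact: leq_maxr.
have kM : (k < M)%N by exact: leq_maxl.
rewrite !(charTN_supported _ lM) /charT -e2piD; congr e2pi.
rewrite (bigD1 (Ordinal kM))//= [in RHS](bigD1 (Ordinal kM))//= /update_coord eqxx mulr0 add0r addrC.
congr (_ + _); apply: eq_bigr => j; rewrite -val_eqE/= => jk.
by rewrite (negPf jk).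
Qed.

Lemma integral_charTN l : (exists k, l k != 0) -> cintegral haarTN (@charTN R l) = 0.
Proof.
move=> [k lk]; apply: (cintegral_update_coord0 (k := k)) => [|x|x].
- by apply: (bounded_cintegrable (M := 1) haarTN (measurable_charTN l)) => x; rewrite normc_charTN.
- rewrite (_ : (fun t => _) = fun t => charTN l (update_coord k (x, 0)) * charT (l k) t); last first.
    by apply/funext => t; exact: charTN_update_coord.
  apply: cintegrableZ; apply: (bounded_cintegrable (M := 1) haarT (measurable_charT _)) => t.
  by rewrite normc_charT.
rewrite (_ : (fun t => _) = fun t => charTN l (update_coord k (x, 0)) * charT (l k) t); last first.
  by apply/funext => t; exact: charTN_update_coord.
rewrite (cintegralZ (mu := haarT)); last first.
  apply: (bounded_cintegrable (M := 1) haarT (measurable_charT _)) => t.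
  by rewrite normc_charT.
by rewrite integral_charT (negPf lk) mulr0.
Qed.

Lemma orthonormal_charTN l l' :
  cintegral haarTN (fun x => charTN l x * (charTN l' x)^*) = (l == l')%:R :> R[i].
Proof.
have [m lm] := exists_supported l; have [m' lm'] := exists_supported l'.
pose M := maxn m m'; have lM : supported M l by apply: supportedW lm; exact: leq_maxl.
have lM' : supported M l' by apply: supportedW lm'; exact: leq_maxr.
have [<-|ll'] := eqVneq l l'.
  transitivity (cintegral (@haarTN R) (fun=> 1)); last exact: cintegral_cst.
  by congr (cintegral _ _); apply/funext => x; rewrite mul_conjc normc_charTN expr1n.
transitivity (cintegral (@haarTN R) (charTN (trunc_seq M (fun i => l i - l' i)))).
  congr (cintegral _ _); apply/funext => x.
  by rewrite charTN_sub !trunc_seqK.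
apply: integral_charTN; apply: contrapT => /forallNP h; case/eqP: ll'.
apply/fsfunP => k; have /negP := h k; rewrite negbK trunc_seqE.
by case: ltnP => [_|Mk]; [rewrite subr_eq0 => /eqP|rewrite lM// lM'].
Qed.

Lemma orthonormal_charT (b b' : int) :
  cintegral haarT (fun x : R => charT b x * (charT b' x)^*) = (b == b')%:R.
Proof.
rewrite -subr_eq0 -integral_charT; congr (cintegral _ _).
by apply/funext => x; rewrite charT_sub.
Qed.

End characters.

(** * Fejer summation *)

(** Extended by 0 past [M], since [trunc_seq] takes a sequence on all of nat. *)
Definition box_point (M L : nat) (j : {ffun 'I_M -> 'I_L}) (i : nat) : int :=
  if insub i is Some i' then (j i' : nat)%:Z else 0.

(* The differences of points of the box [0, L[^M carry the Fejer kernel: each frequency l is hit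
   by prod_i max(L - |l_i|, 0) pairs of points. *)
Definition box_diff (M L : nat) (j k : {ffun 'I_M -> 'I_L}) : dualTN :=
  trunc_seq M (fun i => box_point j i - box_point k i).

Lemma box_diffE M L (j k : {ffun 'I_M -> 'I_L}) (i : 'I_M) :
  box_diff j k i = (j i : nat)%:Z - (k i : nat)%:Z.
Proof. by rewrite trunc_seqE ltn_ord /box_point valK. Qed.

Lemma box_diff_supported M L (j k : {ffun 'I_M -> 'I_L}) : supported M (box_diff j k).
Proof. exact: trunc_seq_supported. Qed.

Lemma supported_eqP M (l l' : dualTN) : supported M l -> supported M l' ->
  (forall i : 'I_M, l i = l' i) -> l = l'.
Proof.
move=> lM lM' e; apply/fsfunP => i; have [iM|Mi] := ltnP i M; first exact: (e (Ordinal iM)).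
by rewrite lM// lM'.
Qed.

Lemma box_diffP M L (j k : {ffun 'I_M -> 'I_L}) (l : dualTN) : supported M l ->
  (box_diff j k == l) = [forall i : 'I_M, (j i : nat)%:Z - (k i : nat)%:Z == l i].
Proof.
move=> lM; apply/eqP/forallP => [<- i|h]; first by rewrite box_diffE.
apply: (@supported_eqP M _ _ _ lM) => [|i]; first exact: box_diff_supported.
by rewrite box_diffE; apply/eqP.
Qed.

(** Distributing the product of the sums gives a sum over pairs of box points, in which a pair
    survives exactly when all its coordinates match. *)
Lemma count_box_diff M L (l : dualTN) : supported M l ->
  (\sum_(j : {ffun 'I_M -> 'I_L}) \sum_(k : {ffun 'I_M -> 'I_L}) (box_diff j k == l))%N =
  (\prod_(i < M) tri L (l i))%N.
Proof.
move=> lM; rewrite /tri bigA_distr_bigA/=; apply: eq_bigr => j _.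
rewrite bigA_distr_bigA/=; apply: eq_bigr => k _; rewrite box_diffP//.
case: (boolP [forall i : 'I_M, (j i : nat)%:Z - (k i : nat)%:Z == l i]) =>
  [/forallP h|/forallPn[i /negPf hi]].
  by rewrite big1// => i _; rewrite h.
by rewrite (bigD1 i)//= hi mul0n.
Qed.

Lemma prod_ge_1Bsum (R : realType) M (x : 'I_M -> R) : (forall i, 0 <= x i <= 1) ->
  1 - \sum_i x i <= \prod_i (1 - x i) <= 1.
Proof.
move=> x01; elim: M x x01 => [|M ih] x x01; first by rewrite !big_ord0 subr0 lexx.
rewrite !big_ord_recl; have /andP[h1 h2] := ih (fun i => x (lift ord0 i)) (fun i => x01 _).
have /andP[y0 y1] := x01 ord0.
have s0 : 0 <= \sum_(i < M) x (lift ord0 i).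
  by apply: sumr_ge0 => i _; case/andP: (x01 (lift ord0 i)).
have p0 : 0 <= \prod_(i < M) (1 - x (lift ord0 i)).
  by apply: prodr_ge0 => i _; rewrite subr_ge0; case/andP: (x01 (lift ord0 i)).
move: h1 h2 s0 p0; set S := \sum_(i < M) _; set P := \prod_(i < M) _; nra.
Qed.

(** The coefficient prod_i max(1 - |l_i| / L, 0) of a product Fejer kernel. *)
Definition fejer (R : realType) (M L : nat) (l : dualTN) : R :=
  (L ^ M)%:R^-1 * (\prod_(i < M) tri L (l i))%:R.

Lemma fejer_near1 (R : realType) M L (l : dualTN) : (0 < L)%N ->
  `|fejer R M L l - 1| <= (\sum_(i < M) `|l i|)%N%:R / L%:R.
Proof.
move=> L0; have LR : 0 < L%:R :> R by rewrite ltr0n.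
pose x (i : 'I_M) : R := 1 - (tri L (l i))%:R / L%:R.
have x01 i : 0 <= x i <= 1.
  rewrite /x triE gerBl divr_ge0// andbT subr_ge0 ler_pdivrMr// mul1r ler_nat.
  exact: leq_subr.
have fE : fejer R M L l = \prod_i (1 - x i).
  rewrite /fejer natr_prod.
  have -> : (L ^ M)%:R^-1 = \prod_(i < M) L%:R^-1 :> R by rewrite prodr_const card_ord natrX exprVn.
  by rewrite -big_split/=; apply: eq_bigr => i _; rewrite /x subKr mulrC.
have /andP[h1 h2] := prod_ge_1Bsum x01.
rewrite fE ler0_norm ?subr_le0// opprB lerBlDl -lerBlDr (le_trans _ h1)// lerD2l lerN2.
rewrite natr_sum mulr_suml; apply: ler_sum => i _; rewrite /x triE.
have [le|lt] := leqP `|l i| L.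
  by rewrite natrB// mulrBl divff ?gt_eqF// opprB addrCA subrr addr0.
have -> : (L - `|l i| = 0)%N by lia.
by rewrite mul0r subr0 ler_pdivlMr// mul1r ler_nat ltnW.
Qed.

(** * Smoothed multiplier operators between two systems of characters *)

Section fejer_operator.
Context d (X : measurableType d) d' (Y : measurableType d') (R : realType).
Context (mu : probability X R) (nu : probability Y R).
Context (a : dualTN -> X -> R[i]) (b : dualTN -> Y -> R[i]).
Context (F : set dualTN) (M : nat) (w wp : dualTN -> R).
Hypothesis ma : forall l, cmeasurable (a l).
Hypothesis mb : forall l, cmeasurable (b l).
Hypothesis na : forall l x, normc (a l x) = 1.
Hypothesis nb : forall l x, normc (b l x) = 1.
Hypothesis subl_a : forall e e' x, a (trunc_seq M (fun i => e i - e' i)) x =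
  a (trunc_seq M e) x * (a (trunc_seq M e') x)^*.
Hypothesis subl_b : forall e e' x, b (trunc_seq M (fun i => e i - e' i)) x =
  b (trunc_seq M e) x * (b (trunc_seq M e') x)^*.
Hypothesis dom : forall (J : finType) (e : J -> nat -> int),
  dominated (fun j k => w (trunc_seq M (fun i => e j i - e k i)))
            (fun j k => wp (trunc_seq M (fun i => e j i - e k i))).
Hypothesis orth_a : forall l, supported M l -> (exists k, l k != 0) -> wp l != 0 ->
  cintegral mu (a l) = 0.
Hypothesis orth_b : forall l l', F l -> supported M l -> supported M l' -> w l' != 0 ->
  cintegral nu (fun y => b l y * (b l' y)^*) = (l' == l)%:R.
Hypothesis w1 : forall l, F l -> supported M l -> w l = 1.

(** A frequency l is listed once per pair of box points with difference l, so its entries add up to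
    [fejer R M L l * w l] times its coefficient. Coefficients are read off in the system [b] and
    resummed in [a]; ([a], [b]) will be (circle, T^N), (T^N, circle) and, with w = 1, (T^N, T^N). *)
Definition fejer_coef L (f : Y -> R[i]) : seq (dualTN * R[i]) :=
  [seq (box_diff jk.1 jk.2,
        ((L ^ M)%:R^-1 * w (box_diff jk.1 jk.2))%:C * fourier nu b f (box_diff jk.1 jk.2))
  | jk <- enum {: {ffun 'I_M -> 'I_L} * {ffun 'I_M -> 'I_L}}].

Lemma fejer_combinationE L f x : combination a (fejer_coef L f) x =
  \sum_(j : {ffun 'I_M -> 'I_L}) \sum_(k : {ffun 'I_M -> 'I_L})
    ((L ^ M)%:R^-1 * w (box_diff j k))%:C * fourier nu b f (box_diff j k) * a (box_diff j k) x.
Proof. by rewrite /combination big_map big_enum/= pair_big. Qed.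

(** [kernel_bound] with one index per box point and entries [w (box_diff j k)] divided by L^M. The
    trace has L^M equal terms, so [L] disappears from the constant. *)
Lemma fejer_bound L f : (0 < L)%N -> cintegrable nu f ->
  L1norm mu (combination a (fejer_coef L f)) <=
  wp (trunc_seq M (fun=> 0)) * L1norm nu f.
Proof.
move=> L0 fi; have LM : (0 < (L ^ M))%N by rewrite expn_gt0 L0.
pose J := {ffun 'I_M -> 'I_L}.
pose al (j : J) := a (trunc_seq M (box_point j)).
pose be (j : J) := b (trunc_seq M (box_point j)).
pose m (j k : J) : R := (L ^ M)%:R^-1 * w (box_diff j k).
pose mp (j k : J) : R := (L ^ M)%:R^-1 * wp (box_diff j k).
have alE j k x : al j x * (al k x)^* = a (box_diff j k) x by rewrite -subl_a.
have beE j k y : be j y * (be k y)^* = b (box_diff j k) y by rewrite -subl_b.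
have domm : dominated m mp.
  have [d1 d2] := dom (fun j : J => box_point j).
  have c0 : 0 <= (L ^ M)%:R^-1 :> R by rewrite invr_ge0.
  split; [apply: eq_psd (psdZ c0 d1) | apply: eq_psd (psdZ c0 d2)] => j k; rewrite /m /mp.
    by rewrite mulrBr.
  by rewrite mulrDr.
have orthm j k : j != k -> mp j k != 0 -> cintegral mu (fun x => al j x * (al k x)^*) = 0.
  move=> jk; rewrite /mp mulf_eq0 => /norP[_ wp0].
  have -> : (fun x => al j x * (al k x)^*) = a (box_diff j k).
    by apply/funext => x; rewrite alE.
  apply: orth_a => //; first exact: box_diff_supported.
  apply: contrapT => /forallNP h; case/eqP: jk; apply/ffunP => i; apply/val_inj.
  by have /negP := h i; rewrite negbK box_diffE /= => /eqP; lia.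
have := kernel_bound (fun j => ma (trunc_seq M (box_point j)))
  (fun j => mb (trunc_seq M (box_point j))) (fun j => na _) (fun j => nb _) domm orthm fi.
have -> : \sum_j mp j j = wp (trunc_seq M (fun=> 0)).
  rewrite (eq_bigr (fun=> (L ^ M)%:R^-1 * wp (trunc_seq M (fun=> 0)))); last first.
    move=> j _; rewrite /mp /box_diff; congr (_ * wp (trunc_seq M _)).
    by apply/funext => i; rewrite subrr.
  rewrite sumr_const card_ffun !card_ord -[LHS]mulr_natl mulrA divff ?mul1r//.
  by rewrite pnatr_eq0 -lt0n.
apply: le_trans; rewrite le_eqVlt; apply/orP; left; apply/eqP.
congr (L1norm mu _); apply/funext => x; rewrite fejer_combinationE.
apply: eq_bigr => j _; apply: eq_bigr => k _; rewrite alE; congr (_ * _ * _).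
by congr (cintegral nu _); apply/funext => y; rewrite beE.
Qed.

(** A frequency of the box outside [s] could acquire a coefficient only because two labels give the
    same function in [b]. By [orth_b] this happens only where [w] vanishes, so each entry of [s] is
    merely damped by its Fejer coefficient. *)
Lemma fejer_combination L s : (forall z, z \in s -> F z.1 /\ supported M z.1) ->
  combination a (fejer_coef L (combination b s)) =
  fun x => \sum_(z <- s) (fejer R M L z.1)%:C * z.2 * a z.1 x.
Proof.
move=> sF; apply/funext => x; rewrite fejer_combinationE.
have fE (l : dualTN) : supported M l -> (w l)%:C * fourier nu b (combination b s) l =
    \sum_(z <- s) (l == z.1)%:R * z.2.
  (* If [w l] is 0 then [l] is not listed in [s], where [w1] gives the value 1; both sides
     vanish. *)
  move=> lM; have [wl|wl] := eqVneq (w l) 0.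
    rewrite wl mul0r big_seq big1// => z /sF[Fz zM]; case: eqP => [lz|]; last by rewrite mul0r.
    by move: (w1 Fz zM); rewrite -lz wl => /eqP; rewrite eq_sym oner_eq0.
  rewrite /fourier /combination.
  rewrite (_ : (fun y => _) = fun y => \sum_(z <- s) z.2 * (b z.1 y * (b l y)^*)); last first.
    by apply/funext => y; rewrite mulr_suml; apply: eq_bigr => z _; rewrite mulrA.
  have bi z : cintegrable nu (fun y => b z y * (b l y)^*).
    apply: (@bounded_cintegrable _ _ _ nu _ 1).
      by apply: cmeasurableM => //; exact: cmeasurableJ.
    by move=> y; rewrite ComplexField.Normc.normcM normc_conj !nb mulr1.
  rewrite cintegral_sum; last by move=> z; apply: cintegrableZ.
  rewrite mulr_sumr [LHS]big_seq [RHS]big_seq; apply: eq_bigr => z /sF[Fz zM].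
  rewrite cintegralZ// orth_b//; case: eqP => [lz|]; last by rewrite !(mulr0, mul0r).
  by rewrite lz w1// mulr1 !mul1r.
transitivity (\sum_(j : {ffun 'I_M -> 'I_L}) \sum_(k : {ffun 'I_M -> 'I_L}) \sum_(z <- s)
    (L ^ M)%:R^-1 * ((box_diff j k == z.1)%:R * (z.2 * a z.1 x))).
  apply: eq_bigr => j _; apply: eq_bigr => k _.
  rewrite rmorphM -[X in X * _]mulrA fE; last exact: box_diff_supported.
  rewrite -[LHS]mulrA mulr_suml -mulr_sumr; congr (_ * _); first by rewrite fmorphV rmorph_nat.
  by apply: eq_bigr => z _; case: eqP => [->|_]; rewrite ?mul1r ?mul0r.
rewrite (eq_bigr _ (fun j _ => exchange_big _ _ _ _ _ _)) exchange_big/=.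
rewrite [LHS]big_seq [RHS]big_seq; apply: eq_bigr => z /sF[Fz zM].
rewrite /fejer -count_box_diff// -mulrA rmorphM fmorphV !rmorph_nat -!mulrA.
under eq_bigr do rewrite -mulr_sumr -mulr_suml.
rewrite -mulr_sumr -mulr_suml; congr (_ * (_ * _)).
by rewrite natr_sum; apply: eq_bigr => j _; rewrite natr_sum.
Qed.

Lemma fejer_approx s (e : R) : (forall z, z \in s -> F z.1 /\ supported M z.1) -> 0 < e ->
  exists L, (0 < L)%N /\
    L1norm mu (fun x => combination a (fejer_coef L (combination b s)) x - combination a s x) <= e.
Proof.
move=> sF e0.
(* By [fejer_near1] the damping changes the combination by at most C / L at every point. *)
pose C : R := \sum_(z <- s) (\sum_(i < M) `|z.1 i|)%N%:R * normc z.2.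
have C0 : 0 <= C by apply: sumr_ge0 => z _; rewrite mulr_ge0// normc_ge0.
have [L LP] : exists L : nat, C / e < L%:R.
  by exists (Num.bound (C / e)); rewrite archi_boundP// divr_ge0// ltW.
have LR : 0 < L%:R :> R by apply: le_lt_trans LP; rewrite divr_ge0// ltW.
have L0 : (0 < L)%N by rewrite -(ltr0n R).
exists L; split=> //; rewrite fejer_combination//.
apply: L1norm_le_sup.
  apply: cintegrableB; last exact: combination_cintegrable.
  apply: cintegrable_sum => z; apply: cintegrableZ.
  exact: char_cintegrable.
move=> x; rewrite /combination -sumrB (le_trans (normc_sum _ _ _))//.
apply: (@le_trans _ _ (C / L%:R)); last first.
  by rewrite ler_pdivrMr// mulrC -ler_pdivrMr// ltW.
rewrite /C mulr_suml; apply: ler_sum => z _.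
rewrite -mulrA -{2}[z.2 * _]mul1r -mulrBl !ComplexField.Normc.normcM na mulr1 mulrAC.
rewrite ler_wpM2r ?normc_ge0// -(rmorph1 (real_complex R)) -rmorphB normc_real.
exact: fejer_near1.
Qed.

(** The error in [fejer_approx] can be made arbitrarily small by choice of L, and the constant of
    [fejer_bound] does not involve L. *)
Lemma combination_transfer s : (forall z, z \in s -> F z.1 /\ supported M z.1) ->
  L1norm mu (combination a s) <= wp (trunc_seq M (fun=> 0)) * L1norm nu (combination b s).
Proof.
move=> sF; apply/ler_addgt0Pl => e e0.
have [L [L0 LP]] := fejer_approx sF e0.
have bi := combination_cintegrable nu mb nb s.
have h := fejer_bound L0 bi.
have ai := combination_cintegrable mu ma na.
rewrite L1normBC in LP.
apply: le_trans (lerD LP h); rewrite (le_trans _ (L1normD _ _))//; last exact: cintegrableB.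
by under [in leRHS]eq_fun do rewrite subrK.
Qed.

End fejer_operator.

(** * Density of trigonometric polynomials *)

Section sqrt_iteration.
Context {R : realType}.
Implicit Types t : R.

(* Polynomials in t increasing to sqrt t on [0, 1]; they show that the class of
   functions studied below is stable under absolute value. *)
Fixpoint sqrt_iter t n : R :=
  if n is n'.+1 then sqrt_iter t n' + 2^-1 * (t - sqrt_iter t n' ^+ 2) else 0.

(** With r = sqrt t and p the current iterate, the next error is (r - p)(1 - (r + p) / 2), which is
    nonnegative and at most (r - p)(1 - r / 2). *)
Lemma sqrt_iter_bounds t n : 0 <= t <= 1 ->
  0 <= sqrt_iter t n <= Num.sqrt t /\
  Num.sqrt t - sqrt_iter t n <= Num.sqrt t * (1 - Num.sqrt t / 2) ^+ n.
Proof.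
move=> /andP[t0 t1]; set r := Num.sqrt t.
have r0 : 0 <= r by exact: sqrtr_ge0.
have tr : t = r ^+ 2 by rewrite sqr_sqrtr.
have r1 : r <= 1 by rewrite /r -[leRHS]sqrtr1; exact: ler_wsqrtr.
elim: n => [|n [/andP[p0 pr] e]]; first by split; rewrite /= ?lexx ?r0// expr0 mulr1 subr0.
set p := sqrt_iter t n in p0 pr e *.
have pE : r - sqrt_iter t n.+1 = (r - p) * (1 - (r + p) / 2) by rewrite /= -/p tr; field.
have d0 : 0 <= (r - p) * (1 - (r + p) / 2) by apply: mulr_ge0; lra.
split; first by apply/andP; split; [rewrite /= -/p tr; nra|lra].
rewrite pE exprSr mulrA; apply: ler_pM => //; lra.
Qed.

Lemma geometric_cvg0 (q : R) : 0 <= q < 1 -> (q ^+ n) @[n --> \oo] --> 0.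
Proof. by move=> /andP[q0 q1]; apply: cvg_expr; rewrite ger0_norm. Qed.

Lemma sqrt_iter_cvg t : 0 <= t <= 1 -> sqrt_iter t n @[n --> \oo] --> Num.sqrt t.
Proof.
move=> t01; set r := Num.sqrt t.
have r0 : 0 <= r by exact: sqrtr_ge0.
have r1 : r <= 1 by rewrite /r -[leRHS]sqrtr1; apply: ler_wsqrtr; case/andP: t01.
have [req0|rn0] := eqVneq r 0.
  rewrite (_ : sqrt_iter t = fun=> r); first exact: cvg_cst.
  apply/funext => n; have [/andP[h1 h2] _] := sqrt_iter_bounds n t01.
  by apply/eqP; rewrite eq_le -/r h2 req0.
have rgt0 : 0 < r by rewrite lt_neqAle eq_sym rn0.
apply/cvgrPdist_le => e e0.
have q01 : 0 <= 1 - r / 2 < 1 by apply/andP; split; lra.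
have /cvgrPdist_le /(_ _ e0) := geometric_cvg0 q01; apply: filterS => n.
have [/andP[h1 h2] h3] := sqrt_iter_bounds n t01.
rewrite sub0r normrN !ger0_norm ?subr_ge0 ?exprn_ge0//; last by case/andP: q01.
apply: le_trans; apply: (le_trans h3); rewrite ler_piMl// exprn_ge0//.
by case/andP: q01.
Qed.

End sqrt_iteration.

Section density.
Import HBSimple.
Context d (X : measurableType d) (R : realType) (mu : probability X R).
Context (P : set (X -> R[i])).
Hypothesis P_bounded : forall p, P p -> cmeasurable p /\ exists M : R, forall x, normc (p x) <= M.
Hypothesis P_cst : forall c : R[i], P (fun=> c).
Hypothesis P_add : forall p q, P p -> P q -> P (fun x => p x + q x).
Hypothesis P_mul : forall p q, P p -> P q -> P (fun x => p x * q x).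

Definition L1_limit (f : X -> R[i]) := forall e : R, 0 < e -> exists p,
  P p /\ L1norm mu (fun x => f x - p x) <= e.

(** Boundedness accompanies approximability because a product of integrable functions may fail to be
    integrable; it makes the class an algebra. *)
Definition bounded_limit f :=
  [/\ cmeasurable f, exists M : R, forall x, normc (f x) <= M & L1_limit f].

Let P_int p : P p -> cintegrable mu p.
Proof. by move=> /P_bounded[mp [M pM]]; exact: bounded_cintegrable pM. Qed.

Let bl_int f : bounded_limit f -> cintegrable mu f.
Proof. by move=> [mf [M fM] _]; exact: bounded_cintegrable fM. Qed.

Let L1norm_sub0 (f : X -> R[i]) : L1norm mu (fun x => f x - f x) = 0.
Proof.
transitivity (\int[mu]_x (0 : R)); last by rewrite Rintegral_cst// mul0r.
by apply: eq_Rintegral => x _; rewrite subrr ComplexField.Normc.normc0.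
Qed.

Lemma bounded_limit_P p : P p -> bounded_limit p.
Proof.
move=> Pp; have [mp bp] := P_bounded Pp; split=> // e e0; exists p; split=> //.
by rewrite L1norm_sub0 ltW.
Qed.

Lemma L1_limit_trans f : cintegrable mu f ->
  (forall e, 0 < e -> exists g, [/\ cintegrable mu g, L1_limit g &
    L1norm mu (fun x => f x - g x) <= e]) -> L1_limit f.
Proof.
move=> fi fg e e0; have e20 : 0 < e / 2 by rewrite divr_gt0.
have [g [gi /(_ _ e20)[p [Pp gp]] fge]] := fg _ e20.
exists p; split=> //; apply: (le_trans (L1normB fi gi (P_int Pp))); lra.
Qed.

Lemma L1_limitD f g : cintegrable mu f -> cintegrable mu g ->
  L1_limit f -> L1_limit g -> L1_limit (fun x => f x + g x).
Proof.
move=> fi gi fl gl e e0; have e20 : 0 < e / 2 by rewrite divr_gt0.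
have [p [Pp fp]] := fl _ e20; have [q [Pq gq]] := gl _ e20.
exists (fun x => p x + q x); split; first exact: P_add.
have -> : (fun x => f x + g x - (p x + q x)) = (fun x => (f x - p x) + (g x - q x)).
  by apply/funext => x; rewrite opprD addrACA.
apply: (le_trans (L1normD (cintegrableB fi (P_int Pp)) (cintegrableB gi (P_int Pq)))); lra.
Qed.

Lemma bounded_limitD f g : bounded_limit f -> bounded_limit g ->
  bounded_limit (fun x => f x + g x).
Proof.
move=> bf bg; have fi := bl_int bf; have gi := bl_int bg.
case: bf bg => mf [M fM] lf [mg [N gN] lg]; split; first exact: cmeasurableD.
  by exists (M + N) => x; rewrite (le_trans (le_normcD _ _))// lerD.
exact: L1_limitD.
Qed.

Let L1norm_mul_le f g (M : R) : cintegrable mu f -> cmeasurable g ->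
  (forall x, normc (g x) <= M) -> L1norm mu (fun x => f x * g x) <= M * L1norm mu f.
Proof.
move=> fi mg gM; rewrite /L1norm -RintegralZl//; last exact: cintegrable_normc.
apply: le_L1norm; first exact: cintegrableM gM.
  exact: (integrable_RZ M (cintegrable_normc fi)).
by move=> x; rewrite ComplexField.Normc.normcM mulrC ler_wpM2r ?normc_ge0.
Qed.

(** [f] is first replaced by some [p], whose bound [K] is not controlled by that of [f]; only then
    is [g] approximated, at a precision depending on [K]. *)
Lemma bounded_limitM f g : bounded_limit f -> bounded_limit g ->
  bounded_limit (fun x => f x * g x).
Proof.
move=> bf bg; have fi := bl_int bf; have gi := bl_int bg.
case: bf bg => mf [M fM] lf [mg [N gN] lg]; split; first exact: cmeasurableM.
  exists (M * N) => x; rewrite ComplexField.Normc.normcM ler_pM ?normc_ge0//.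
have fgi := cintegrableM fi mg gN.
apply: L1_limit_trans => // e e0.
have x0 : X := point.
have N0 : 0 <= N := le_trans (normc_ge0 _) (gN x0).
have e1 : 0 < e / (1 + N) by rewrite divr_gt0// ltr_wpDr.
have [p [Pp fp]] := lf _ e1; have [mp [K pK]] := P_bounded Pp.
have K0 : 0 <= K := le_trans (normc_ge0 _) (pK x0).
have pi := P_int Pp; have pgi := cintegrableM pi mg gN.
exists (fun x => p x * g x); split => //.
  move=> e' e'0; have e2 : 0 < e' / (1 + K) by rewrite divr_gt0// ltr_wpDr.
  have [q [Pq gq]] := lg _ e2; exists (fun x => p x * q x); split; first exact: P_mul.
  have -> : (fun x => p x * g x - p x * q x) = (fun x => (g x - q x) * p x).
    by apply/funext => x; rewrite -mulrBr mulrC.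
  apply: (le_trans (L1norm_mul_le (cintegrableB gi (P_int Pq)) mp pK)).
  apply: (le_trans (ler_wpM2l K0 gq)).
  by rewrite mulrA ler_pdivrMr ?ltr_wpDr// mulrDr mulr1 [K * e']mulrC lerDr ltW.
have -> : (fun x => f x * g x - p x * g x) = (fun x => (f x - p x) * g x).
  by apply/funext => x; rewrite mulrBl.
apply: (le_trans (L1norm_mul_le (cintegrableB fi pi) mg gN)).
apply: (le_trans (ler_wpM2l N0 fp)).
by rewrite mulrA ler_pdivrMr ?ltr_wpDr// mulrDr mulr1 [N * e]mulrC lerDr ltW.
Qed.

Lemma L1_dominated_cvg (f : nat -> X -> R[i]) (g : X -> R[i]) (M e : R) :
  (forall n, cmeasurable (f n)) -> cmeasurable g ->
  (forall n x, normc (f n x) <= M) -> (forall x, normc (g x) <= M) ->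
  (forall x, normc (f n x - g x) @[n --> \oo] --> 0) -> 0 < e ->
  exists n, L1norm mu (fun x => f n x - g x) <= e.
Proof.
move=> mf mg fM gM fg e0.
have mB (h h' : X -> R[i]) : cmeasurable h -> cmeasurable h' -> cmeasurable (fun x => h x - h' x).
  move=> mh mh'; have -> : (fun x => h x - h' x) = (fun x : X => h x + (-1) * h' x).
    by apply/funext => x; rewrite mulN1r.
  by apply: cmeasurableD => //; apply: cmeasurableM => //; exact: cmeasurable_cst.
pose h n x := (normc (f n x - g x))%:E.
have mh n : measurable_fun setT (h n).
  by apply/measurable_EFinP; apply: measurable_normc; exact: mB.
have hcv : {ae mu, forall x, setT x -> h ^~ x @ \oo --> (cst 0 : X -> \bar R) x}.
  by apply: aeW => x _; apply: cvg_EFin; [exact: nearW|exact: fg].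
have hM : {ae mu, forall x n, setT x -> (`|h n x| <= (cst (M + M)%:E : X -> \bar R) x)%E}.
  apply: aeW => x n _; rewrite lee_fin ger0_norm ?normc_ge0//.
  by rewrite (le_trans (le_normcD _ _))// normcN lerD.
have iM : mu.-integrable setT (cst (M + M)%:E : X -> \bar R).
  exact: finite_measure_integrable_cst.
have [_ _] := dominated_convergence measurableT mh (measurable_cst _) hcv iM hM.
rewrite integral0 => /fine_cvgP[_ /cvgrPdist_le /(_ _ e0)[N _ NP]].
exists N; have := NP N (leqnn N); rewrite /= sub0r normrN; apply: le_trans.
by rewrite /L1norm /Rintegral ler_norm.
Qed.

Lemma bounded_limit_cvg (f : nat -> X -> R[i]) (g : X -> R[i]) (M : R) :
  (forall n, bounded_limit (f n)) -> cmeasurable g ->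
  (forall n x, normc (f n x) <= M) -> (forall x, normc (g x) <= M) ->
  (forall x, normc (f n x - g x) @[n --> \oo] --> 0) -> bounded_limit g.
Proof.
move=> bf mg fM gM fg; have gi := bounded_cintegrable mu mg gM.
split=> //; first by exists M.
apply: L1_limit_trans => // e e0.
have mf n : cmeasurable (f n) by case: (bf n).
have [n ne] := L1_dominated_cvg mf mg fM gM fg e0.
exists (f n); split; [exact: bl_int|by case: (bf n)|by rewrite L1normBC].
Qed.

Definition rlimit (h : X -> R) := bounded_limit (fun x => (h x)%:C).

Lemma rlimit_measurable h : rlimit h -> measurable_fun setT h.
Proof. by case=> -[]. Qed.

Lemma rlimit_cst (c : R) : rlimit (fun=> c).
Proof. exact/bounded_limit_P/P_cst. Qed.

Lemma rlimitD h k : rlimit h -> rlimit k -> rlimit (fun x => h x + k x).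
Proof. by move=> bh bk; have := bounded_limitD bh bk; under eq_fun do rewrite -rmorphD. Qed.

Lemma rlimitM h k : rlimit h -> rlimit k -> rlimit (fun x => h x * k x).
Proof. by move=> bh bk; have := bounded_limitM bh bk; under eq_fun do rewrite -rmorphM. Qed.

Lemma rlimitB h k : rlimit h -> rlimit k -> rlimit (fun x => h x - k x).
Proof.
move=> bh bk; have := rlimitD bh (rlimitM (rlimit_cst (-1)) bk).
by under eq_fun do rewrite mulN1r.
Qed.

Lemma rlimit_cvg (h : nat -> X -> R) (g : X -> R) (M : R) :
  (forall n, rlimit (h n)) -> (forall n x, `|h n x| <= M) ->
  (forall x, h n x @[n --> \oo] --> g x) -> rlimit g.
Proof.
move=> bh hM hg.
have mg : measurable_fun setT g.
  by apply: (measurable_fun_cvg (h := h)); [move=> n; exact: rlimit_measurable|move=> x _; exact: hg].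
apply: (@bounded_limit_cvg (fun n x => (h n x)%:C) _ M) => //.
- by move=> n x; rewrite normc_real.
- move=> x; rewrite normc_real.
  have cx : `|h n x| @[n --> \oo] --> `|g x| by apply: cvg_norm; exact: hg.
  rewrite -(cvg_lim _ cx)//.
  by apply: limr_le; [apply/cvg_ex; exists (`|g x|)|apply: nearW => n; exact: hM].
- move=> x; under eq_fun do rewrite -rmorphB normc_real.
  have cx : h n x - g x @[n --> \oo] --> g x - g x by apply: cvgB; [exact: hg|exact: cvg_cst].
  by rewrite subrr in cx; have := cvg_norm cx; rewrite normr0; exact.
Qed.

Lemma rlimit_sqrt h : rlimit h -> (forall x, 0 <= h x <= 1) -> rlimit (fun x => Num.sqrt (h x)).
Proof.
move=> bh h01; apply: (@rlimit_cvg (fun n x => sqrt_iter (h x) n) _ 1).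
- elim=> [|n ih] /=; first exact: rlimit_cst.
  apply: rlimitD => //; apply: rlimitM; first exact: rlimit_cst.
  by apply: rlimitB => //; under eq_fun do rewrite expr2; exact: rlimitM.
- move=> n x; have [/andP[p0 p1] _] := sqrt_iter_bounds n (h01 x).
  rewrite ger0_norm// (le_trans p1)//.
  by case/andP: (h01 x) => _ /ler_wsqrtr; rewrite sqrtr1.
- by move=> x; exact: sqrt_iter_cvg.
Qed.

(** |h| = K sqrt((h / K)^2), where K = M + 1 is positive and brings the square into [0, 1]. *)
Lemma rlimit_norm h : rlimit h -> rlimit (fun x => `|h x|).
Proof.
move=> bh; have [_ [M hM] _] := bh.
pose K := M + 1; have K0 : 0 < K.
  by rewrite /K ltr_wpDl// (le_trans (normc_ge0 _) (hM point)).
have hK x : `|h x| <= K by have := hM x; rewrite normc_real /K; lra.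
have b2 : rlimit (fun x => (K^-1 * h x) ^+ 2).
  under eq_fun do rewrite expr2; apply: rlimitM; apply: rlimitM => //; exact: rlimit_cst.
have b01 x : 0 <= (K^-1 * h x) ^+ 2 <= 1.
  rewrite sqr_ge0/= -[leLHS]ger0_norm ?sqr_ge0// normrX expr_le1// normrM gtr0_norm ?invr_gt0//.
  by rewrite ler_pdivrMl// mulr1.
have := rlimitM (rlimit_cst K) (rlimit_sqrt b2 b01).
congr rlimit; apply/funext => x.
by rewrite sqrtr_sqr normrM gtr0_norm ?invr_gt0// mulrA divff ?mul1r// gt_eqF.
Qed.

(* The indicator is the limit of 1 - (1 - c h^+)^n for a small constant c. *)
Lemma rlimit_pos h : rlimit h -> rlimit \1_[set x | 0 < h x].
Proof.
move=> bh; have [_ [M hM] _] := bh.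
pose K := M + 1; have K0 : 0 < K.
  by rewrite /K ltr_wpDl// (le_trans (normc_ge0 _) (hM point)).
have hK x : `|h x| <= K by have := hM x; rewrite normc_real /K; lra.
(* [h x + |h x|] is twice the positive part and at most 2 K, so [q] lies in [0, 1] and equals 1
   exactly where h <= 0. *)
pose q x := 1 - (2 * K)^-1 * (h x + `|h x|).
have bq : rlimit q.
  apply: rlimitB; first exact: rlimit_cst.
  apply: rlimitM; first exact: rlimit_cst.
  by apply: rlimitD => //; exact: rlimit_norm.
have q01 x : 0 <= q x <= 1.
  have h1 := hK x; have h2 := ler_norm (h x); have /andP[h3 _] : - `|h x| <= h x <= `|h x| by rewrite -ler_norml.
  have K2 : 0 < 2 * K by rewrite mulr_gt0.
  have s0 : 0 <= h x + `|h x| by lra.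
  have i0 : 0 <= (2 * K)^-1 by rewrite invr_ge0 ltW.
  by rewrite /q gerBl mulr_ge0//= andbT subr_ge0 ler_pdivrMl// mulr1; lra.
apply: (@rlimit_cvg (fun n x => 1 - q x ^+ n) _ 1).
- move=> n; apply: rlimitB; first exact: rlimit_cst.
  elim: n => [|n ih]; first by under eq_fun do rewrite expr0; exact: rlimit_cst.
  by under eq_fun do rewrite exprS; exact: rlimitM.
- move=> n x; have /andP[q0 q1] := q01 x.
  have := exprn_ile1 n q0 q1; have := exprn_ge0 n q0.
  by rewrite ler_norml => ? ?; apply/andP; split; lra.
- move=> x; rewrite indicE; have [hx|hx] := ltP 0 (h x).
    rewrite mem_set//= -[X in _ --> X]subr0; apply: cvgB; first exact: cvg_cst.
    apply: geometric_cvg0; case/andP: (q01 x) => -> _ /=.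
    by rewrite /q gtr0_norm// ltrBlDl ltrDr mulr_gt0 ?invr_gt0 ?mulr_gt0// addr_gt0.
  rewrite memNset/=; last by apply/negP; rewrite -leNgt.
  have -> : q x = 1 by rewrite /q ler0_norm// subrr mulr0 subr0.
  under eq_fun do rewrite expr1n subrr.
  exact: cvg_cst.
Qed.

(** Rays will be identified only where the coordinate lies in ]0, 1[, which is almost everywhere. *)
Lemma rlimit_ae (h k : X -> R) : rlimit h -> measurable_fun setT k -> (exists M, forall x, `|k x| <= M) ->
  {ae mu, forall x, h x = k x} -> rlimit k.
Proof.
move=> [mh bh lh] mk [M kM] hk.
have mkC : cmeasurable (fun x => (k x)%:C) by split=> //=; exact: measurable_cst.
split=> //; first by exists M => x; rewrite normc_real.
move=> e e0; have [p [Pp hp]] := lh _ e0; exists p; split=> //.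
have [mp _] := P_bounded Pp; apply: le_trans hp; rewrite le_eqVlt; apply/orP; left.
have mB (f : X -> R[i]) : cmeasurable f -> measurable_fun setT (fun x => (normc (f x - p x))%:E).
  move=> mf; apply/measurable_EFinP/measurable_normc.
  have -> : (fun x => f x - p x) = (fun x : X => f x + (-1) * p x).
    by apply/funext => x; rewrite mulN1r.
  by apply: cmeasurableD => //; apply: cmeasurableM => //; exact: cmeasurable_cst.
apply/eqP; rewrite /L1norm /Rintegral; congr fine; apply: ae_eq_integral => //.
- exact: mB.
- exact: mB.
- by apply: filterS hk => x ->.
Qed.

Definition approx_sets : set (set X) := [set A | rlimit \1_A].

(** Products of indicators give intersections, hence finite unions with the help of complements;
    countable unions are bounded pointwise limits of these. *)
Lemma approx_sets_sigma_algebra : sigma_algebra setT approx_sets.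
Proof.
have Cc A : approx_sets A -> approx_sets (~` A).
  move=> VA; have := rlimitB (rlimit_cst 1) VA; congr rlimit.
  by apply/funext => x; rewrite !indicE in_setC; case: (x \in A); rewrite ?subrr ?subr0.
have Ci A B : approx_sets A -> approx_sets B -> approx_sets (A `&` B).
  move=> VA VB; have := rlimitM VA VB; congr rlimit.
  by apply/funext => x; rewrite !indicE in_setI -natrM mulnb.
have C0 : approx_sets set0.
  by have := rlimit_cst 0; congr rlimit; apply/funext => x; rewrite indicE in_set0.
have Cu A B : approx_sets A -> approx_sets B -> approx_sets (A `|` B).
  by move=> VA VB; rewrite -[A `|` B]setCK setCU; apply/Cc/Ci; exact: Cc.
split=> //; first by move=> A VA; rewrite setTD; exact: Cc.
move=> A VA; pose B n := \big[setU/set0]_(k < n) A k.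
have VB n : approx_sets (B n).
  by elim: n => [|n ih]; rewrite /B ?big_ord0// big_ord_recr/=; exact: Cu.
apply: (@rlimit_cvg (fun n => \1_(B n)) _ 1) => //.
  by move=> n x; rewrite indicE ger0_norm// lern1 leq_b1.
move=> x; have [[k _ Akx]|nA] := pselect ((\bigcup_k A k) x).
  apply: cvg_near_cst; exists k.+1 => // n /= kn.
  have UU : (\bigcup_k A k) x by exists k.
  have BU : B n x by rewrite /B -bigcup_mkord; exists k.
  by rewrite !indicE (mem_set UU) (mem_set BU).
have nB n : ~ B n x by rewrite /B -bigcup_mkord => -[k _ Akx]; apply: nA; exists k.
by apply: cvg_near_cst; apply: nearW => n; rewrite !indicE (memNset nA) (memNset (nB n)).
Qed.

Lemma L1_dense f : (forall A, measurable A -> approx_sets A) -> cintegrable mu f -> L1_limit f.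
Proof.
move=> Vall fi.
(* One argument serves the real part (c = 1) and the imaginary part (c = i). *)
have real (h : X -> R) (c : R[i]) : mu.-integrable setT (EFin \o h) ->
    cintegrable mu (fun x => c * (h x)%:C) /\ L1_limit (fun x => c * (h x)%:C).
  move=> hi.
  have hiC : cintegrable mu (fun x => (h x)%:C).
    by split=> //=; exact: finite_measure_integrable_cst.
  have chi := cintegrableZ c hiC.
  split=> //; apply: L1_limit_trans => // e e0.
  have [g [gi _ /fine_cvgP[_ /cvgrPdist_le gl]]] := approximation_sfun_integrable measurableT hi.
  have e1 : 0 < e / (1 + normc c) by rewrite divr_gt0// ltr_wpDr// normc_ge0.
  have [N _ /(_ N (leqnn N))] := gl _ e1; rewrite /= sub0r normrN => gN.
  have giC : cintegrable mu (fun x => (g N x)%:C).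
    by split=> //=; [exact: gi|exact: finite_measure_integrable_cst].
  have bg : rlimit (g N).
    rewrite (_ : (g N : X -> R) = fun x =>
        \sum_(y <- fset_set (range (g N))) (y * \1_(g N @^-1` [set y]) x)); last first.
      by apply/funext => x; rewrite fimfunE fsbig_finite.
    elim: (fset_set _ : seq R) => [|y s ih].
      by under eq_fun do rewrite big_nil; exact: rlimit_cst.
    under eq_fun do rewrite big_cons; apply: rlimitD => //.
    apply: rlimitM; first exact: rlimit_cst.
    by apply: Vall; exact: measurable_sfunP.
  exists (fun x => c * (g N x)%:C); split.
  - exact: cintegrableZ.
  - by case: (bounded_limitM (bounded_limit_P (P_cst c)) bg).
  have -> : (fun x => c * (h x)%:C - c * (g N x)%:C) = (fun x => c * ((h x)%:C - (g N x)%:C)).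
    by apply/funext => x; rewrite mulrBr.
  rewrite L1normZ; last exact: cintegrableB.
  have le : L1norm mu (fun x => (h x)%:C - (g N x)%:C) <= e / (1 + normc c).
    apply: le_trans gN; rewrite /L1norm /Rintegral.
    under eq_integral do rewrite -rmorphB normc_real.
    exact: ler_norm.
  apply: (le_trans (ler_wpM2l (normc_ge0 _) le)).
  rewrite mulrA ler_pdivrMr ?ltr_wpDr ?normc_ge0// mulrDr mulr1 [normc c * e]mulrC lerDr.
  exact: ltW.
have [i1 l1] := real _ 1 fi.1; have [i2 l2] := real _ 'i%C fi.2.
rewrite (_ : f = fun x => 1 * (Re (f x))%:C + 'i%C * (Im (f x))%:C); first exact: L1_limitD.
by apply/funext => x; rewrite mul1r -complexE.
Qed.

End density.

(** * Density on T^N and approximation within the spectrum *)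

Section density_torus.
Context {R : realType}.
Local Notation TN := (torusN R).
Local Notation chi := (@charTN R : dualTN -> TN -> R[i]).

Definition polynomialTN : set (TN -> R[i]) := [set p | exists s, p = combination chi s].

Let P_bounded p : polynomialTN p -> cmeasurable p /\ exists M : R, forall x, normc (p x) <= M.
Proof.
move=> [s ->]; split.
  apply: cmeasurable_sum => z; apply: cmeasurableM; first exact: cmeasurable_cst.
  exact: measurable_charTN.
exists (\sum_(z <- s) normc z.2) => x; rewrite (le_trans (normc_sum _ _ _))//.
by apply: ler_sum => z _; rewrite ComplexField.Normc.normcM normc_charTN mulr1.
Qed.

Let P_cst (c : R[i]) : polynomialTN (fun=> c).
Proof.
exists [:: (trunc_seq 0 (fun=> 0), c)]; apply/funext => x.
by rewrite /combination big_seq1/= charTN_trunc big_ord0 e2pi0 mulr1.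
Qed.

Let P_add p q : polynomialTN p -> polynomialTN q -> polynomialTN (fun x => p x + q x).
Proof.
by move=> [s ->] [t ->]; exists (s ++ t); apply/funext => x; rewrite combination_cat.
Qed.

Let P_mul p q : polynomialTN p -> polynomialTN q -> polynomialTN (fun x => p x * q x).
Proof.
move=> [s ->] [t ->]; have [M MP] := exists_supported_seq (s ++ t).
exists [seq (trunc_seq M (fun i => z.1 i + y.1 i), z.2 * y.2) | z : dualTN * R[i] <- s, y : dualTN * R[i] <- t].
apply/funext => x; rewrite /combination big_allpairs_dep/= mulr_suml.
rewrite big_seq [RHS]big_seq; apply: eq_bigr => z zs; rewrite mulr_sumr.
rewrite big_seq [RHS]big_seq; apply: eq_bigr => y yt.
have zM : supported M z.1 by apply: MP; rewrite mem_cat zs.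
have yM : supported M y.1 by apply: MP; rewrite mem_cat yt orbT.
rewrite charTN_trunc (charTN_supported _ zM) (charTN_supported _ yM) mulrACA -e2piD.
rewrite -big_split; congr (_ * e2pi _); apply: eq_bigr => i _.
by rewrite /= rmorphD mulrDl.
Qed.

Let rl := rlimit (@haarTN R) polynomialTN.
Let rl_cst := rlimit_cst (@haarTN R) P_bounded P_cst.

Lemma rlimit_cos n (c : R) : rl (fun x => cos (2 * pi * (x n - c))).
Proof.
pose e (u : int) i : int := if i == n then u else 0.
have eE u (x : TN) : chi (trunc_seq n.+1 (e u)) x = e2pi (u%:~R * x n).
  rewrite charTN_trunc big_ord_recr/= big1 ?add0r /e ?eqxx// => i _.
  by rewrite ltn_eqF ?mul0r.
apply: bounded_limit_P => //.
exists [:: (trunc_seq n.+1 (e 1), (2^-1)%:C * e2pi (- c)); (trunc_seq n.+1 (e (-1)), (2^-1)%:C * e2pi c)].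
apply/funext => x; rewrite /combination big_cons big_seq1/= !eE -!mulrA -!e2piD mul1r mulN1r.
rewrite -[c - x n]opprB e2piN addrC -[- c + _]addrC.
apply: complex_eqP; rewrite ?(ReD, ReM, ReJ, ImD, ImM, ImJ) /=; first by rewrite [in LHS]mulrA; field.
by field.
Qed.

Lemma ae_coord n : {ae @haarTN R, forall x : TN, 0 < x n < 1}.
Proof.
pose B : set (measurableTypeR R) := ~` [set x | 0 < x < 1].
have mI : measurable [set x : measurableTypeR R | 0 < x < 1].
  rewrite (_ : [set _ | _] = `]0, 1[%classic); first exact: measurable_itv.
  by apply/seteqP; split => x /=; rewrite in_itv.
have mB : measurable B by exact: measurableC.
exists ((fun x : TN => x n) @^-1` B); split.
- by rewrite -[X in measurable X]setTI; exact: (@measurable_coord _ (measurableTypeR R) n measurableT _ mB).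
- rewrite [LHS](pushforward_coord haarT n mB).
  rewrite [LHS]/(lebesgue_measure (B `&` `[0, 1[%classic)).
  rewrite (_ : B `&` _ = [set 0]); first exact: lebesgue_measure_set1.
  apply/seteqP; split => x /=; rewrite /B /= in_itv/=.
    by move=> [/negP h /andP[x0 x1]]; apply/eqP; rewrite eq_le x0 andbT leNgt; move: h; rewrite x1 andbT.
  by move=> ->; rewrite ltxx lexx ltr01.
- by move=> x /= h; exact: h.
Qed.

(* A ray of ]0, 1[ is an arc of the circle centred at its midpoint, hence is cut
   out by a trigonometric polynomial. *)
Lemma cos_ray (v x : R) : 0 < v < 1 -> 0 < x < 1 ->
  (0 < cos (2 * pi * (x - v / 2)) - cos (pi * v)) = (x < v).
Proof.
move=> /andP[v0 v1] /andP[x0 x1]; rewrite subr_gt0.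
have p0 : 0 < pi :> R := pi_gt0 _.
have pv : pi * v \in `[0, pi] by rewrite in_itv/=; apply/andP; split; nra.
set t := 2 * pi * (x - v / 2).
(* t runs through ]-pi v, 2 pi - pi v[, while cosine is decreasing on [0, pi]: up to pi compare |t|
   with pi v, beyond it reflect t to 2 pi - t. *)
have [tp|tp] := leP t pi.
  have at_ : `|t| \in `[0, pi].
    by rewrite in_itv/= normr_ge0/= ler_norml tp andbT /t; nra.
  rewrite -(cos_norm t) ltr_cos// ltr_norml.
  by apply/idP/idP; rewrite /t; [move=> /andP[h1 h2]; nra|move=> h; apply/andP; split; nra].
have -> : cos t = cos (pi *+ 2 - t) by rewrite -[RHS]cosN opprB -(cosD2pi (t - pi *+ 2)) subrK.
have t2 : pi *+ 2 - t \in `[0, pi] by rewrite in_itv/= mulr2n /t; apply/andP; split; move: tp; rewrite /t; nra.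
rewrite ltr_cos//; apply/idP/idP; rewrite mulr2n /t; last by move: tp; rewrite /t; nra.
move: tp; rewrite /t; nra.
Qed.

Lemma approx_sets_ray n (v : R) :
  approx_sets (@haarTN R) polynomialTN ((fun x : TN => x n) @^-1` `]-oo, v[).
Proof.
set A := _ @^-1` _.
have mA : measurable A.
  by rewrite -[A]setTI; exact: (@measurable_coord _ (measurableTypeR R) n measurableT _ (measurable_itv _)).
have mk : measurable_fun setT (\1_A : TN -> R) by exact: measurable_indic.
have kM : exists M : R, forall x : TN, `|\1_A x| <= M.
  by exists 1 => x; rewrite indicE ger0_norm// lern1 leq_b1.
suff [h bh hA] : exists2 h : TN -> R, rl h &
    forall x : TN, 0 < x n < 1 -> h x = \1_A x.
  apply: (rlimit_ae P_bounded bh mk kM); apply: filterS (ae_coord n) => x; exact: hA.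
have AE (x : TN) : \1_A x = ((x n : R) < v)%R%:R :> R.
  rewrite indicE; congr (nat_of_bool _)%:R; apply/idP/idP.
    by move=> /set_mem; rewrite /A/= in_itv.
  by move=> h; apply/mem_set; rewrite /A/= in_itv.
have [v0|v0] := leP v 0.
  exists (fun=> 0); first exact: rl_cst.
  by move=> x /andP[x0 x1]; rewrite AE ltNge (le_trans v0 (ltW x0)).
have [v1|v1] := leP 1 v.
  exists (fun=> 1); first exact: rl_cst.
  by move=> x /andP[x0 x1]; rewrite AE (lt_le_trans x1 v1).
pose h (x : TN) : R := cos (2 * pi * (x n - v / 2)) - cos (pi * v).
exists (\1_[set x | 0 < h x]).
  apply: rlimit_pos => //; apply: rlimitB => //; exact: rlimit_cos.
move=> x x01; rewrite AE indicE; congr (nat_of_bool _)%:R.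
rewrite -(@cos_ray v (x n)) ?v0//; apply/idP/idP; first by move=> /set_mem.
by move=> ?; apply/mem_set.
Qed.

(** Two generations in turn: the product sigma-algebra by preimages under coordinates, and the Borel
    sets of the line by rays. *)
Lemma approx_sets_measurable (A : set TN) : measurable A ->
  approx_sets (@haarTN R) polynomialTN A.
Proof.
have sV := approx_sets_sigma_algebra (@haarTN R) P_bounded P_cst P_add P_mul.
have [V0 VC VU] := sV.
suff : @measurable _ TN `<=` approx_sets (@haarTN R) polynomialTN by exact.
apply: smallest_sub => // _ [n [B [mB ->]]].
pose G := [set B : set (measurableTypeR R) |
  approx_sets (@haarTN R) polynomialTN ((fun x : TN => x n) @^-1` B)].
suff : @measurable _ (measurableTypeR R) `<=` G by move=> /(_ _ mB).
have sG : sigma_algebra setT G.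
  split.
  - by rewrite /G /= preimage_set0.
  - by move=> C GC; rewrite /G /= setTD -preimage_setC -setTD; exact: VC.
  - by move=> C GC; rewrite /G /= preimage_bigcup; exact: VU.
rewrite (RGenInftyO.measurableE R); apply: smallest_sub => // _ [v ->].
exact: approx_sets_ray.
Qed.

Lemma density_TN (f : TN -> R[i]) (e : R) : cintegrable haarTN f -> 0 < e ->
  exists s, L1norm haarTN (fun x => f x - combination chi s x) <= e.
Proof.
move=> fi e0.
have [_ [[s ->] h]] := L1_dense P_bounded P_cst P_add P_mul approx_sets_measurable fi e0.
by exists s.
Qed.

(** Density gives a polynomial q near f, but with arbitrary spectrum. The Fejer operator Phi is an
    L1 contraction, since w = 1, so f, q, Phi q and Phi f are successively close, and Phi f only
    uses frequencies of f. *)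
Lemma spectral_approx_TN (f : TN -> R[i]) : cintegrable haarTN f ->
  approximable haarTN chi [set l | fourier haarTN chi f l != 0] f.
Proof.
move=> fi e e0; have e3 : 0 < e / 3 by rewrite divr_gt0.
have [s fs] := density_TN fi e3.
have [M MP] := exists_supported_seq s.
have sF z : z \in s -> [set: dualTN] z.1 /\ supported M z.1 by move=> /MP.
pose one : dualTN -> R := fun=> 1.
have dom (J : finType) (u : J -> nat -> int) :
  dominated (fun j k => one (trunc_seq M (fun i => u j i - u k i)))
            (fun j k => one (trunc_seq M (fun i => u j i - u k i))).
  exact/dominated_refl/psd1.
have na l x : normc (chi l x) = 1 by exact: normc_charTN.
have ma l : cmeasurable (chi l) by exact: measurable_charTN.
have subl u u' x : chi (trunc_seq M (fun i => u i - u' i)) x =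
  chi (trunc_seq M u) x * (chi (trunc_seq M u') x)^* by exact: charTN_sub.
have orth_a l : supported M l -> (exists k, l k != 0) -> one l != 0 ->
  cintegral haarTN (chi l) = 0 by move=> _ h _; exact: integral_charTN.
have orth_b l l' : [set: dualTN] l -> supported M l -> supported M l' -> one l' != 0 ->
  cintegral haarTN (fun y => chi l y * (chi l' y)^*) = (l' == l)%:R.
  by move=> _ _ _ _; rewrite orthonormal_charTN eq_sym.
have w1 l : [set: dualTN] l -> supported M l -> one l = 1 by [].
have [L [L0 LP]] := fejer_approx (@haarTN R) ma ma na na orth_b w1 sF e3.
pose q := combination chi s.
have qi : cintegrable haarTN q := combination_cintegrable haarTN ma na s.
pose Phi := fejer_coef (R := R) haarTN chi M one L.
have h1 := fejer_bound (mu := haarTN) ma ma na na subl subl dom orth_a L0 (cintegrableB fi qi).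
(* The discarded entries carry the coefficient 0, so the function is unchanged. *)
exists [seq z <- Phi f | fourier haarTN chi f z.1 != 0]; split.
  by move=> z; rewrite mem_filter => /andP[].
have -> : combination chi [seq z <- Phi f | fourier haarTN chi f z.1 != 0] =
    combination chi (Phi f).
  apply/funext => x; rewrite /combination big_filter [RHS](bigID (fun z => fourier haarTN chi f z.1 != 0))/=.
  rewrite [X in _ + X]big1_seq ?addr0// => z /andP[/negPn/eqP z0 /mapP[jk _ zE]].
  by move: z0; rewrite zE /= => ->; rewrite mulr0 mul0r.
have PhiB x : combination chi (Phi (fun y => f y - q y)) x =
    combination chi (Phi f) x - combination chi (Phi q) x.
  rewrite /combination !big_map -sumrB; apply: eq_bigr => jk _ /=.
  by rewrite (fourierB (mu := haarTN) ma na)// mulrBr mulrBl.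
have ci t : cintegrable haarTN (combination chi t) := combination_cintegrable haarTN ma na t.
have h2 : L1norm haarTN (fun x => combination chi (Phi f) x - combination chi (Phi q) x) <= e / 3.
  apply: le_trans fs; move: h1; rewrite /one mul1r; apply: le_trans.
  by rewrite le_eqVlt; apply/orP; left; apply/eqP; congr (L1norm _ _); apply/funext => x.
apply: (le_trans (L1normB fi qi (ci _))).
have -> : e = e / 3 + (e / 3 + e / 3) by field.
apply: lerD => //; apply: (le_trans (L1normB qi (ci (Phi q)) (ci _))).
by apply: lerD; rewrite L1normBC.
Qed.

Lemma integral_coord0 (g : measurableTypeR R -> \bar R) :
  (forall x, (0 <= g x)%E) -> measurable_fun setT g ->
  (\int[@haarTN R]_x g (x 0%N) = \int[haarT]_x g x)%E.
Proof.
move=> g0 mg; have mc := @measurable_coord _ (measurableTypeR R) 0%N.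
transitivity (\int[pushforward (@haarTN R) (fun x : TN => x 0%N)]_x g x)%E.
  by rewrite ge0_integral_pushforward.
by apply: eq_measure_integral => A mA _; exact: pushforward_coord.
Qed.

Lemma integral_coord0_signed (g : measurableTypeR R -> R) :
  haarT.-integrable setT (EFin \o g) ->
  (@haarTN R).-integrable setT (fun x : TN => (g (x 0%N))%:E) /\
  \int[@haarTN R]_x g (x 0%N) = \int[haarT]_x g x.
Proof.
move=> gi; have mc := @measurable_coord _ (measurableTypeR R) 0%N.
have mg := measurable_int _ gi.
have gi' : (@haarTN R).-integrable setT (fun x : TN => (g (x 0%N))%:E).
  apply/integrableP; split; first exact: (measurableT_comp mg mc).
  rewrite (integral_coord0 (g := fun x => `|(g x)%:E|%E))//; last exact: measurableT_comp.
  by case/integrableP: gi.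
split=> //; rewrite /Rintegral; congr fine.
transitivity (\int[pushforward (@haarTN R) (fun x : TN => x 0%N)]_x (g x)%:E)%E.
  by rewrite integral_pushforward.
by apply: eq_measure_integral => A mA _; exact: pushforward_coord.
Qed.

(** [spectral_approx_TN] is applied to f(x) = g(x_0). The spectrum of f lies on the first axis, so
    the approximants depend on x_0 only and return to the circle with the same norms. *)
Lemma spectral_approx_T (g : measurableTypeR R -> R[i]) : cintegrable haarT g ->
  approximable haarT (@charT R) [set b | fourier haarT (@charT R) g b != 0] g.
Proof.
move=> gi.
pose f (x : TN) := g (x 0%N).
have int0 (h : measurableTypeR R -> R[i]) : cintegrable haarT h ->
    cintegrable haarTN (fun x : TN => h (x 0%N)) /\
    cintegral haarTN (fun x : TN => h (x 0%N)) = cintegral haarT h.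
  move=> [h1 h2]; have [i1 e1] := integral_coord0_signed h1.
  have [i2 e2] := integral_coord0_signed h2.
  by split; [split|apply: complex_eqP].
have norm0 (h : measurableTypeR R -> R[i]) : cintegrable haarT h ->
    L1norm haarTN (fun x : TN => h (x 0%N)) = L1norm haarT h.
  by move=> hi; have [_] := integral_coord0_signed (cintegrable_normc hi).
have [fi _] := int0 _ gi.
have na b x : normc (@charT R b x) = 1 by exact: normc_charT.
have ma b : cmeasurable (@charT R b) by exact: measurable_charT.
have chi0 l (x : TN) : supported 1 l -> chi l x = charT (l 0%N) (x 0%N).
  by move=> l1; rewrite (charTN_supported _ l1) big_ord1.
have four l : supported 1 l -> fourier haarTN chi f l = fourier haarT (@charT R) g (l 0%N).
  move=> l1; have [_ e1] := int0 _ (cintegrable_char_conj (mu := haarT) ma na (l 0%N) gi).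
  transitivity (cintegral haarTN (fun x : TN => g (x 0%N) * (@charT R (l 0%N) (x 0%N))^*)).
    by congr (cintegral _ _); apply/funext => x; rewrite chi0.
  exact: e1.
(* [f] does not depend on a coordinate k >= 1, so if [l k != 0], integrating over that coordinate
   first gives 0. *)
have four0 l : fourier haarTN chi f l != 0 -> supported 1 l.
  move=> fl k k1; apply: contraNeq fl => lk; apply/eqP.
  have k0 : (0 == k)%N = false by rewrite ltn_eqF.
  have splitE (x : TN) (t : measurableTypeR R) :
      f (update_coord k (x, t)) * (chi l (update_coord k (x, t)))^* =
      g (x 0%N) * (chi l (update_coord k (x, 0)))^* * (charT (l k) t)^*.
    by rewrite /f {1}/update_coord k0 charTN_update_coord rmorphM mulrA.
  have ci : cintegrable haarT (fun t : measurableTypeR R => (charT (l k) t)^*).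
    apply: (bounded_cintegrable (M := 1) haarT (cmeasurableJ (ma _))) => t.
    by rewrite normc_conj na.
  apply: (cintegral_update_coord0 (k := k)) => [|x|x].
  - exact: (cintegrable_char_conj (mu := haarTN) (@measurable_charTN R) (@normc_charTN R) l fi).
  - rewrite (_ : (fun t => _) = fun t => g (x 0%N) * (chi l (update_coord k (x, 0)))^* * (charT (l k) t)^*).
      exact: cintegrableZ.
    by apply/funext => t; exact: splitE.
  rewrite (_ : (fun t => _) = fun t => g (x 0%N) * (chi l (update_coord k (x, 0)))^* * (charT (l k) t)^*).
    rewrite (cintegralZ (mu := haarT))// [X in _ * X](_ : _ = 0) ?mulr0//.
    transitivity (cintegral (@haarT R) (fun t => charT 0 t * (charT (l k) t)^*)).
      by congr (cintegral _ _); apply/funext => t; rewrite /charT mul0r e2pi0 mul1r.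
    by rewrite orthonormal_charT eq_sym (negPf lk).
  by apply/funext => t; exact: splitE.
move=> e e0; have [s [sF se]] := spectral_approx_TN fi e0.
exists [seq (z.1 0%N, z.2) | z : dualTN * R[i] <- s]; split.
  by move=> _ /mapP[z /sF /= fz ->] /=; rewrite -four//; exact: four0.
have gci : cintegrable haarT (fun x => g x - combination (@charT R) [seq (z.1 0%N, z.2) | z : dualTN * R[i] <- s] x).
  by apply: cintegrableB => //; exact: combination_cintegrable.
rewrite -(norm0 _ gci); apply: le_trans se; rewrite le_eqVlt; apply/orP; left; apply/eqP.
congr (L1norm _ _); apply/funext => x; congr (_ - _).
rewrite /combination big_map big_seq [RHS]big_seq; apply: eq_bigr => z /sF zF /=.
by rewrite chi0//; exact: four0.
Qed.

End density_torus.

(** * The isomorphism *)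

Section fourier_uniqueness.
Context d (X : measurableType d) (R : realType) (mu : probability X R).
Context (I : choiceType) (chi : I -> X -> R[i]).
Hypothesis mchi : forall i, cmeasurable (chi i).
Hypothesis nchi : forall i x, normc (chi i x) = 1.
Hypothesis spectral_approx : forall f, cintegrable mu f ->
  approximable mu chi [set i | fourier mu chi f i != 0] f.

Lemma L1norm_of_fourier0 f : cintegrable mu f -> (forall i, fourier mu chi f i = 0) ->
  L1norm mu f = 0.
Proof.
move=> fi f0; apply/eqP; rewrite eq_le L1norm_ge0 andbT.
apply/ler_addgt0Pl => e e0; rewrite addr0.
(* The spectrum is empty, so the approximating list can only be empty. *)
have [[|z s] [sf]] := spectral_approx fi e0; last first.
  by have := sf z (mem_head _ _); rewrite /= f0 eqxx.
by under eq_fun do rewrite /combination big_nil subr0.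
Qed.

Lemma fourier_inj f g : cintegrable mu f -> cintegrable mu g ->
  (forall i, fourier mu chi f i = fourier mu chi g i) -> eq_ae mu f g.
Proof.
move=> fi gi fg; have fgi := cintegrableB fi gi.
have := L1norm_eq0 fgi (L1norm_of_fourier0 fgi _).
have z i : fourier mu chi (fun x => f x - g x) i = 0 by rewrite fourierB// fg subrr.
by move=> /(_ z); apply: filterS => x /eqP; rewrite subr_eq0 => /eqP.
Qed.

Lemma eq_ae_L1norm f g : cintegrable mu f -> cintegrable mu g -> eq_ae mu f g ->
  L1norm mu f = L1norm mu g.
Proof.
move=> fi gi fg; rewrite /L1norm /Rintegral; congr fine; apply: ae_eq_integral => //.
- exact: measurable_int (cintegrable_normc fi).
- exact: measurable_int (cintegrable_normc gi).
- by apply: filterS fg => x ->.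
Qed.

Lemma eq_ae_fourier f g i : cintegrable mu f -> cintegrable mu g -> eq_ae mu f g ->
  fourier mu chi f i = fourier mu chi g i.
Proof.
move=> fi gi fg; apply/eqP; rewrite -subr_eq0 -(fourierB (mu := mu))//.
have fgi := cintegrableB fi gi; apply/eqP/ComplexField.Normc.eq0_normc/eqP.
rewrite eq_le normc_ge0 andbT (le_trans (fourier_le mchi nchi i fgi))//.
rewrite (@eq_ae_L1norm _ (fun=> 0))//; last 2 first.
- exact: cintegrable_cst.
- by apply: filterS fg => x ->; rewrite subrr.
apply: L1norm_le_sup; first exact: cintegrable_cst.
by move=> x; rewrite ComplexField.Normc.normc0.
Qed.

(** Coefficients are L1 continuous, so orthogonality to the generators passes to their closure. This
    locates the spectrum of a transferred function; [psi] may label characters differently from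
    [chi]. *)
Lemma approximable_orthogonal (J : choiceType) (psi : J -> X -> R[i]) (F : set J) f i :
  cintegrable mu f -> (forall j, cmeasurable (psi j)) -> (forall j x, normc (psi j x) = 1) ->
  approximable mu psi F f -> (forall j, F j -> fourier mu chi (psi j) i = 0) ->
  fourier mu chi f i = 0.
Proof.
move=> fi mpsi npsi fF o; apply/ComplexField.Normc.eq0_normc/eqP.
rewrite eq_le normc_ge0 andbT; apply/ler_addgt0Pl => e e0; rewrite addr0.
have [s [sF se]] := fF e e0; apply: le_trans se.
have pi : cintegrable mu (combination psi s) := combination_cintegrable mu mpsi npsi s.
have -> : fourier mu chi f i = fourier mu chi (fun x => f x - combination psi s x) i.
  rewrite fourierB// [X in _ - X](_ : _ = 0) ?subr0//.
  rewrite /fourier (_ : (fun x => _) = fun x => \sum_(z <- s) z.2 * (psi z.1 x * (chi i x)^*)); last first.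
    by apply/funext => x; rewrite mulr_suml; apply: eq_bigr => z _; rewrite mulrA.
  have ci z : cintegrable mu (fun x => psi z x * (chi i x)^*).
    by apply: cintegrable_char_conj => //; exact: char_cintegrable.
  rewrite cintegral_sum; last by move=> z; exact: cintegrableZ.
  by rewrite big_seq big1// => z /sF Fz; rewrite cintegralZ// [cintegral _ _]o ?mulr0.
by apply: fourier_le => //; exact: cintegrableB.
Qed.

End fourier_uniqueness.

Section operator_of_coefficients.
Context d (X : measurableType d) d' (Y : measurableType d') (R : realType).
Context (mu : probability X R) (nu : probability Y R) (I J : choiceType).
Context (chi : I -> X -> R[i]) (psi : J -> Y -> R[i]) (A : set I) (B : set J).
Context (theta : I -> J) (K : R) (T : (X -> R[i]) -> (Y -> R[i])).
Hypothesis mchi : forall i, cmeasurable (chi i).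
Hypothesis nchi : forall i x, normc (chi i x) = 1.
Hypothesis mpsi : forall i, cmeasurable (psi i).
Hypothesis npsi : forall i x, normc (psi i x) = 1.
Hypothesis spectral_approx : forall f, cintegrable nu f ->
  approximable nu psi [set i | fourier nu psi f i != 0] f.
Local Notation V := (L1_spectrum mu chi A).
Local Notation W := (L1_spectrum nu psi B).
Hypothesis surj : forall j, B j -> exists2 i, A i & theta i = j.
Hypothesis TW : forall f, V f -> W (T f).
Hypothesis TC : forall f, V f -> forall i, A i -> fourier nu psi (T f) (theta i) = fourier mu chi f i.
Hypothesis TK : forall f, V f -> L1norm nu (T f) <= K * L1norm mu f.

Lemma spectrum_eq_ae g g' : W g -> W g' ->
  (forall i, A i -> fourier nu psi g (theta i) = fourier nu psi g' (theta i)) -> eq_ae nu g g'.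
Proof.
move=> [gi gB] [gi' gB'] e; apply: (fourier_inj mpsi npsi spectral_approx) => // j.
have [Bj|nBj] := pselect (B j); first by have [i Ai <-] := surj Bj; exact: e.
have z h : [set i | fourier nu psi h i != 0] `<=` B -> fourier nu psi h j = 0.
  by move=> hB; apply: contrapT => /eqP /hB.
by rewrite !z.
Qed.

Lemma L1_spectrumZD (c : R[i]) f g : V f -> V g -> V (fun x => c * f x + g x).
Proof.
move=> [fi fA] [gi gA]; split; first by apply: cintegrableD => //; exact: cintegrableZ.
move=> i /=; rewrite (fourierZD mchi nchi)//; apply: contra_neqP => nA.
have z h : [set i | fourier mu chi h i != 0] `<=` A -> fourier mu chi h i = 0.
  by move=> hA; apply: contrapT => /eqP /hA.
by rewrite !z// mulr0 addr0.
Qed.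

(** [T] will be an arbitrary choice of representatives. Linearity and compatibility with a.e.
    equality follow because the coefficients determine [T f] almost everywhere, by
    [spectrum_eq_ae]. *)
Lemma bounded_operator_of_coefficients : L1_bounded_operator mu nu V W T.
Proof.
split=> //; last by exists K.
- move=> f g Vf Vg fg; apply: spectrum_eq_ae; [exact: TW|exact: TW|] => i Ai.
  by rewrite !TC//; case: Vf Vg => [fi _] [gi _]; exact: eq_ae_fourier.
- move=> c f g Vf Vg; have Vfg := L1_spectrumZD c Vf Vg.
  have [[Tfi TfB] [Tgi TgB]] := (TW Vf, TW Vg).
  have WW : W (fun y => c * T f y + T g y).
    split; first by apply: cintegrableD => //; exact: cintegrableZ.
    move=> j /=; rewrite (fourierZD mpsi npsi)//; apply: contra_neqP => nB.
    have z h : [set i | fourier nu psi h i != 0] `<=` B -> fourier nu psi h j = 0.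
      by move=> hB; apply: contrapT => /eqP /hB.
    by rewrite !z// mulr0 addr0.
  apply: spectrum_eq_ae => // [|i Ai]; first exact: TW.
  rewrite TC// (fourierZD mpsi npsi)// !TC//.
  by case: Vf Vg => [fi _] [gi _]; rewrite (fourierZD mchi nchi).
Qed.

End operator_of_coefficients.

(** * Comparison of the two norms for the lacunary system *)

Section lacunary_transfer.
Context {R : realType} (a : nat -> nat) (tau : nat -> int).
Hypothesis a_gt0 : forall n, (0 < a n)%N.
Hypothesis tau0 : tau 0%N != 0.
Hypothesis tauS : forall k, 3 * (a k)%:Z * `|tau k| <= tau k.+1.
Hypothesis ratio_cvg : cvgn (series (@ratio_term R a tau)).
Let sigma := limn (series (@ratio_term R a tau)).
Let K := expR (6 * sigma + 36 * sigma ^+ 2).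
Local Notation F := (specF a).
Local Notation chi := (@charTN R : dualTN -> torusN R -> R[i]).
Let psi (l : dualTN) : measurableTypeR R -> R[i] := charT (pairing l tau).

Lemma pairing_supported M l : supported M l -> pairing l tau = partial_pairing tau l M.
Proof.
by move=> lM; rewrite /pairing (sum_finsupp lM (g := fun k => l k * tau k))// => k ->; rewrite mul0r.
Qed.

Lemma partial_pairing_trunc M (e : nat -> int) n : (n <= M)%N ->
  partial_pairing tau (trunc_seq M e) n = partial_pairing tau e n.
Proof.
move=> nM; apply: eq_bigr => i _; rewrite trunc_seqE ifT//.
exact: leq_trans (ltn_ord i) nM.
Qed.

Lemma pairing_trunc M (e : nat -> int) : pairing (trunc_seq M e) tau = partial_pairing tau e M.
Proof. by rewrite (pairing_supported (@trunc_seq_supported M e)) partial_pairing_trunc. Qed.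

Lemma multiplier_trunc M (e : nat -> int) :
  multiplier a tau M (trunc_seq M e) = multiplier a tau M e :> R.
Proof. by apply: eq_bigr => n _; rewrite partial_pairing_trunc// ltnW. Qed.

Lemma multiplier_maj_trunc M (e : nat -> int) :
  multiplier_maj a tau M (trunc_seq M e) = multiplier_maj a tau M e :> R.
Proof. by apply: eq_bigr => n _; rewrite partial_pairing_trunc// ltnW. Qed.

Lemma pairing_eq M l l' : F l -> supported M l -> supported M l' ->
  (forall n, (n < M)%N -> (`|partial_pairing tau l' n| < `|tau n| - max_pairing a tau n)%N) ->
  pairing l' tau = pairing l tau -> l' = l.
Proof.
move=> Fl lM lM' h; rewrite !(@pairing_supported M)// => e.
have eq := partial_pairing_inj a_gt0 tau0 tauS Fl h e.
by apply: (supported_eqP lM' lM) => i; exact: eq.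
Qed.

Lemma pairing_inj l l' : F l -> F l' -> pairing l' tau = pairing l tau -> l' = l.
Proof.
move=> Fl Fl'; have [m lm] := exists_supported l; have [m' lm'] := exists_supported l'.
apply: (@pairing_eq (maxn m m')) => //.
- exact/(supportedW _ lm)/leq_maxl.
- exact/(supportedW _ lm')/leq_maxr.
- move=> n _; have h1 := partial_pairing_le tau n Fl'.
  by have h2 := max_pairing_lt a_gt0 tau0 tauS n; lia.
Qed.

Let mchi l : cmeasurable (chi l). Proof. exact: measurable_charTN. Qed.
Let nchi l x : normc (chi l x) = 1. Proof. exact: normc_charTN. Qed.
Let mpsi l : cmeasurable (psi l). Proof. exact: measurable_charT. Qed.
Let npsi l x : normc (psi l x) = 1. Proof. exact: normc_charT. Qed.

Lemma orthonormal_psi l l' : F l -> F l' ->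
  cintegral haarT (fun x => psi l x * (psi l' x)^*) = (l == l')%:R.
Proof.
move=> Fl Fl'; rewrite orthonormal_charT; congr (nat_of_bool _)%:R.
by apply/eqP/eqP => [/(pairing_inj Fl' Fl)|->].
Qed.

Let wM M (l : dualTN) : R := multiplier a tau M l.
Let wpM M (l : dualTN) : R := multiplier_maj a tau M l.

Let dom M (J : finType) (e : J -> nat -> int) :
  dominated (fun j k => wM M (trunc_seq M (fun i => e j i - e k i)))
            (fun j k => wpM M (trunc_seq M (fun i => e j i - e k i))).
Proof.
have [d1 d2] := dominated_multiplier (R := R) a_gt0 tau0 tauS e M.
split; [apply: eq_psd d1|apply: eq_psd d2] => j k;
  by rewrite /wM /wpM multiplier_trunc multiplier_maj_trunc.
Qed.

Let subl_chi M (u u' : nat -> int) x : chi (trunc_seq M (fun i => u i - u' i)) x =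
  chi (trunc_seq M u) x * (chi (trunc_seq M u') x)^*.
Proof. exact: charTN_sub. Qed.

Let subl_psi M (u u' : nat -> int) x : psi (trunc_seq M (fun i => u i - u' i)) x =
  psi (trunc_seq M u) x * (psi (trunc_seq M u') x)^*.
Proof. by rewrite /psi !pairing_trunc partial_pairingB charT_sub. Qed.

Let w1 M l : F l -> supported M l -> wM M l = 1.
Proof. by move=> Fl _; exact: multiplier1. Qed.

Let wp0 M : wpM M (trunc_seq M (fun=> 0)) <= K.
Proof. by rewrite /wpM multiplier_maj_trunc; exact: multiplier_maj0_le. Qed.

Let F0 M : F (trunc_seq M (fun=> 0)).
Proof. by move=> n; rewrite trunc_seqE; case: ifP. Qed.

Let supp_bound M l : wpM M l != 0 -> forall n, (n < M)%N ->
  (`|partial_pairing tau l n| < `|tau n| - max_pairing a tau n)%N.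
Proof. by move=> wl n nM; exact: multiplier_maj_supp wl nM. Qed.

(** The kernel is integrated over the circle, where a nonzero l with <l, tau> = 0 would break
    [orth_a]. The support of w+ excludes it: [pairing_eq] compares l with 0, which lies in F. *)
Lemma psi_le_chi s : (forall z, z \in s -> F z.1) ->
  L1norm haarT (combination psi s) <= K * L1norm haarTN (combination chi s).
Proof.
move=> sF; have [M MP] := exists_supported_seq s.
have orth_a l : supported M l -> (exists k, l k != 0) -> wpM M l != 0 ->
    cintegral haarT (psi l) = 0.
  move=> lM [k lk] wl; rewrite integral_charT; case: eqP => // p0.
  suff e : l = trunc_seq M (fun=> 0).
    by move: lk; rewrite e trunc_seqE; case: ifP; rewrite eqxx.
  apply: (pairing_eq (F0 M) (@trunc_seq_supported M _) lM (supp_bound wl)).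
  by rewrite p0 pairing_trunc /partial_pairing big1// => i _; rewrite mul0r.
have orth_b l l' : F l -> supported M l -> supported M l' -> wM M l' != 0 ->
    cintegral haarTN (fun y => chi l y * (chi l' y)^*) = (l' == l)%:R.
  by move=> _ _ _ _; rewrite orthonormal_charTN eq_sym.
have sFM z : z \in s -> F z.1 /\ supported M z.1 by move=> zs; split; [exact: sF|exact: MP].
have := combination_transfer mpsi mchi npsi nchi (@subl_psi M) (@subl_chi M) (@dom M) orth_a orth_b
  (@w1 M) sFM.
by move=> /le_trans; apply; rewrite ler_wpM2r ?L1norm_ge0.
Qed.

(** Coefficients are read off on the circle, so the danger is some l' with the pairing of an l in F
    and l' different from l. Where w(l') is nonzero so is w+(l'), and [pairing_eq] forces l' = l. *)
Lemma chi_le_psi s : (forall z, z \in s -> F z.1) ->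
  L1norm haarTN (combination chi s) <= K * L1norm haarT (combination psi s).
Proof.
move=> sF; have [M MP] := exists_supported_seq s.
have orth_a l : supported M l -> (exists k, l k != 0) -> wpM M l != 0 ->
  cintegral haarTN (chi l) = 0 by move=> _ h _; exact: integral_charTN.
have orth_b l l' : F l -> supported M l -> supported M l' -> wM M l' != 0 ->
    cintegral haarT (fun y => psi l y * (psi l' y)^*) = (l' == l)%:R.
  move=> Fl lM lM' wl'; rewrite orthonormal_charT eq_sym; congr (nat_of_bool _)%:R.
  apply/eqP/eqP => [e|->//]; apply: (pairing_eq Fl lM lM' _ e).
  by apply: supp_bound; exact: (multiplier_supp wl').
have sFM z : z \in s -> F z.1 /\ supported M z.1 by move=> zs; split; [exact: sF|exact: MP].
have := combination_transfer mchi mpsi nchi npsi (@subl_chi M) (@subl_psi M) (@dom M) orth_a orth_b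
  (@w1 M) sFM.
by move=> /le_trans; apply; rewrite ler_wpM2r ?L1norm_ge0.
Qed.

Lemma transfer_to_circle f : L1F a f -> exists g, [/\ L1E a tau g,
  forall l, F l -> fourier haarT (@charT R) g (pairing l tau) = fourier haarTN chi f l &
  L1norm haarT g <= K * L1norm haarTN f].
Proof.
move=> [fi fF].
have fA : approximable haarTN chi F f.
  move=> e e0; have [s [sf se]] := spectral_approx_TN fi e0.
  by exists s; split=> // z /sf /fF.
have ochi l l' : F l -> F l' -> cintegral haarTN (fun x => chi l x * (chi l' x)^*) = (l == l')%:R.
  by move=> _ _; exact: orthonormal_charTN.
have [g [gi gA gc gK]] := transfer mchi mpsi nchi npsi ochi orthonormal_psi (expR_ge0 _) psi_le_chi fi fA.
exists g; split=> //; split=> // b; apply: contra_neqP => nE.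
pose chT : int -> measurableTypeR R -> R[i] := @charT R.
have mT c : cmeasurable (chT c) by exact: measurable_charT.
have nT c x : normc (chT c x) = 1 by exact: normc_charT.
(* [g] is a limit of combinations of the [psi l] with l in F, each of which is orthogonal to a
   character off E. *)
apply: (approximable_orthogonal mT nT gi mpsi npsi gA) => l Fl.
rewrite [LHS]orthonormal_charT; case: eqP => // e; case: nE.
by exists l.
Qed.

Lemma transfer_to_torus g : L1E a tau g -> exists f, [/\ L1F a f,
  forall l, F l -> fourier haarTN chi f l = fourier haarT (@charT R) g (pairing l tau) &
  L1norm haarTN f <= K * L1norm haarT g].
Proof.
move=> [gi gE].
(* The approximants of [g] have frequencies in E; [th] relabels them by F, as [transfer] uses one
   index set for both sides. *)
have /choice[th thP] : forall b, exists l, specE a tau b -> F l /\ pairing l tau = b.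
  move=> b; have [[l Fl <-]|nE] := pselect (specE a tau b); first by exists l.
  by exists (trunc_seq 0 (fun=> 0)).
have gA : approximable haarT psi F g.
  move=> e e0; have [s [sg se]] := spectral_approx_T gi e0.
  exists [seq (th z.1, z.2) | z <- s]; split.
    by move=> _ /mapP[z /sg /gE /thP[Fz _] ->].
  apply: le_trans se; rewrite le_eqVlt; apply/orP; left; apply/eqP.
  congr (L1norm _ _); apply/funext => x; congr (_ - _).
  rewrite /combination big_map big_seq [RHS]big_seq; apply: eq_bigr => z /sg /gE /thP[_ e1] /=.
  by rewrite /psi e1.
have ochi l l' : F l -> F l' -> cintegral haarTN (fun x => chi l x * (chi l' x)^*) = (l == l')%:R.
  by move=> _ _; exact: orthonormal_charTN.
have [f [fi fA fc fK]] := transfer mpsi mchi npsi nchi orthonormal_psi ochi (expR_ge0 _) chi_le_psi gi gA.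
exists f; split=> //; split=> // l; apply: contra_neqP => nF.
apply: (approximable_orthogonal mchi nchi fi mchi nchi fA) => l' Fl'.
by rewrite [LHS]orthonormal_charTN; case: eqP => // e; case: nF; rewrite -e.
Qed.

End lacunary_transfer.

Theorem theorem1 (R : realType) :
  exists K : R -> R, (forall s : R, 0 < K s) /\
  forall (a : nat -> nat) (tau : nat -> int),
    (forall n : nat, (0 < a n)%N) ->
    tau 0%N != 0 ->
    (forall k : nat, 3 * (a k)%:Z * `|tau k| <= tau k.+1) ->
    cvgn (series (@ratio_term R a tau)) ->
    exists T : (torusN R -> R[i]) -> (measurableTypeR R -> R[i]),
      [/\ given_by_formula a tau T,
          L1_isomorphism haarTN haarT (@L1F R a) (@L1E R a tau) T &
          forall f : torusN R -> R[i], L1F a f ->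
            let sigma := limn (series (@ratio_term R a tau)) in
            (K sigma)^-1 * L1norm haarTN f <= L1norm haarT (T f) /\
            L1norm haarT (T f) <= K sigma * L1norm haarTN f].
Proof.
exists (fun s => expR (6 * s + 36 * s ^+ 2)); split; first by move=> s; exact: expR_gt0.
move=> a tau a_gt0 tau0 tauS cv; set sigma := limn (series (@ratio_term R a tau)).
set K := expR (6 * sigma + 36 * sigma ^+ 2).
have K0 : 0 < K by exact: expR_gt0.
pose chi : dualTN -> torusN R -> R[i] := @charTN R.
pose psi : int -> measurableTypeR R -> R[i] := @charT R.
have mchi l : cmeasurable (chi l) by exact: measurable_charTN.
have nchi l x : normc (chi l x) = 1 by exact: normc_charTN.
have mpsi b : cmeasurable (psi b) by exact: measurable_charT.
have npsi b x : normc (psi b x) = 1 by exact: normc_charT.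
have inj l l' : specF a l -> specF a l' -> pairing l' tau = pairing l tau -> l' = l.
  exact: pairing_inj.
(* The implication makes the relation total, so that choice applies; off L^1_F the value of [T] is
   arbitrary. *)
have /choice[T TP] : forall f, exists g, L1F a f -> [/\ L1E a tau g,
    forall l, specF a l -> fourier haarT psi g (pairing l tau) = fourier haarTN chi f l &
    L1norm haarT g <= K * L1norm haarTN f].
  move=> f; have [Vf|] := pselect (L1F a f); last by exists (fun=> 0).
  by have [g gP] := transfer_to_circle a_gt0 tau0 tauS cv Vf; exists g.
have /choice[S SP] : forall g, exists f, L1E a tau g -> [/\ L1F a f,
    forall l, specF a l -> fourier haarTN chi f l = fourier haarT psi g (pairing l tau) &
    L1norm haarTN f <= K * L1norm haarT g].
  move=> g; have [Wg|] := pselect (L1E a tau g); last by exists (fun=> 0).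
  by have [f fP] := transfer_to_torus a_gt0 tau0 tauS cv Wg; exists f.
have TW f : L1F a f -> L1E a tau (T f) by move=> /TP[].
have TC f : L1F a f -> forall l, specF a l ->
  fourier haarT psi (T f) (pairing l tau) = fourier haarTN chi f l by move=> /TP[].
have TK f : L1F a f -> L1norm haarT (T f) <= K * L1norm haarTN f by move=> /TP[].
have SV g : L1E a tau g -> L1F a (S g) by move=> /SP[].
have SC g : L1E a tau g -> forall l, specF a l ->
  fourier haarTN chi (S g) l = fourier haarT psi g (pairing l tau) by move=> /SP[].
have SK g : L1E a tau g -> L1norm haarTN (S g) <= K * L1norm haarT g by move=> /SP[].
have surjE b : specE a tau b -> exists2 l, specF a l & pairing l tau = b by [].
have eqE g g' : L1E a tau g -> L1E a tau g' -> (forall l, specF a l ->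
    fourier haarT psi g (pairing l tau) = fourier haarT psi g' (pairing l tau)) ->
    eq_ae haarT g g'.
  exact: (spectrum_eq_ae mpsi npsi (@spectral_approx_T R) surjE).
have eqF f f' : L1F a f -> L1F a f' -> (forall l, specF a l ->
    fourier haarTN chi f l = fourier haarTN chi f' l) -> eq_ae haarTN f f'.
  apply: (spectrum_eq_ae (theta := id) mchi nchi (@spectral_approx_TN R)) => l Fl.
  by exists l.
have ST f : L1F a f -> eq_ae haarTN (S (T f)) f.
  move=> Vf; apply: eqF => //; first exact/SV/TW.
  by move=> l Fl; rewrite SC// ?TC//; exact: TW.
have TS g : L1E a tau g -> eq_ae haarT (T (S g)) g.
  move=> Wg; apply: eqE => //; first exact/TW/SV.
  by move=> l Fl; rewrite TC// ?SC//; exact: SV.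
have fourier_off g b : L1E a tau g -> ~ specE a tau b -> fourier haarT psi g b = 0.
  by move=> [_ gE] nb; apply: contrapT => /eqP /gE.
exists T; split.
- split.
    move=> f Vf [s [c fE]].
    (* The spectrum of [f] lies in its own frequency list, so the sum over F runs over finitely many
       l in [s]; comparing coefficients identifies it with [T f]. *)
    have fs l : l \notin s -> fourier haarTN chi f l = 0.
      move=> ls; have -> : f = combination chi [seq (i, c i) | i <- s].
        by rewrite fE; apply/funext => x; rewrite /combination big_map.
      rewrite (fourier_combination (F := setT) mchi nchi)//; last first.
        by move=> i j _ _; exact: orthonormal_charTN.
      by rewrite big_map big1_seq// => i /= /andP[/eqP il]; rewrite il (negPf ls).
    pose t := [seq (l, fourier haarTN chi f l) | l <- s & l \in specF a].
    pose psi' l := psi (pairing l tau).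
    have tF z : z \in t -> specF a z.1.
      by move=> /mapP[l]; rewrite mem_filter => /andP[/set_mem Fl _] ->.
    have tE : (fun x => \sum_(l \in specF a) fourier haarTN chi f l *
        e2pi ((pairing l tau)%:~R * x)) = combination psi' t.
      apply/funext => x; rewrite (fsbigE [seq l <- s | l \in specF a]).
      - rewrite /combination big_map big_filter_cond big_filter.
        by apply: eq_bigl => l; rewrite andbb.
      - by rewrite filter_uniq ?fset_uniq.
      - by move=> l /=; rewrite mem_filter => /andP[/set_mem].
      - move=> l Fl; rewrite mem_filter (mem_set Fl) /= => ls.
        by rewrite fs ?mul0r.
    have mpsi' l : cmeasurable (psi' l) by exact: mpsi.
    have npsi' l x : normc (psi' l x) = 1 by exact: npsi.
    have pi := combination_cintegrable haarT mpsi' npsi' t.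
    have tc b : ~ specE a tau b -> fourier haarT psi (combination psi' t) b = 0.
      move=> nb; apply: (approximable_orthogonal mpsi npsi pi mpsi' npsi' (F := specF a)).
        move=> e e0; exists t; split=> //; rewrite (_ : (fun x => _) = fun=> 0).
          apply: (le_trans _ (ltW e0)); apply: L1norm_le_sup; first exact: cintegrable_cst.
          by move=> x; rewrite ComplexField.Normc.normc0.
        by apply/funext => x; rewrite subrr.
      move=> l Fl; rewrite [LHS]orthonormal_charT; case: eqP => // e.
      by case: nb; exists l.
    have tl l : specF a l -> fourier haarT psi (combination psi' t) (pairing l tau) =
        fourier haarTN chi f l.
      move=> Fl; rewrite -[LHS]/(fourier haarT psi' (combination psi' t) l).
      rewrite (fourier_combination mpsi' npsi' (orthonormal_psi a_gt0 tau0 tauS) tF Fl).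
      rewrite big_map big_filter_cond /=; have [ls|ls] := boolP (l \in s); last first.
        rewrite fs// big1_seq// => i /andP[/andP[_ /eqP il] si].
        by move: ls; rewrite -il si.
      rewrite big_mkcond (bigD1_seq l ls (fset_uniq _))/= (mem_set Fl) eqxx.
      by rewrite big1 ?addr0// => i /negPf ->; rewrite andbF.
    rewrite [X in eq_ae _ _ X]tE; apply: eqE; first exact: TW.
      split; first exact: combination_cintegrable.
      by move=> b /=; apply: contra_neqP => nb; exact: (tc b nb).
    by move=> l Fl; rewrite TC// tl.
  (* Over a point of E the fibre in F is a single l by [inj]; off E it is empty and the coefficient
     of [T f] vanishes. *)
  move=> f Vf b; have [[l Fl <-]|nE] := pselect (specE a tau b).
    rewrite [LHS]TC// (_ : _ `&` _ = [set l]) ?fsbig_set1//.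
    apply/seteqP; split => [l' [Fl' /= e]|_ ->]; last by split.
    exact: inj.
  rewrite [LHS]fourier_off//; last exact: TW.
  rewrite (_ : _ `&` _ = set0) ?fsbig_set0//.
  by rewrite -subset0 => l [Fl /= e]; apply: nE; exists l.
- split.
    exact: (bounded_operator_of_coefficients mchi nchi mpsi npsi (@spectral_approx_T R) surjE TW TC TK).
  exists S; split=> //.
  (* [S] relabels from E to F; [th] inverts the pairing on E, and by injectivity it reaches all of
     F. *)
  have /choice[th thP] : forall b, exists l, specE a tau b -> specF a l /\ pairing l tau = b.
    move=> b; have [[l Fl <-]|nE] := pselect (specE a tau b); first by exists l.
    by exists (trunc_seq 0 (fun=> 0)).
  apply: (bounded_operator_of_coefficients (theta := th) mpsi npsi mchi nchi
    (@spectral_approx_TN R) _ SV _ SK).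
    move=> l Fl; have El : specE a tau (pairing l tau) by exists l.
    by exists (pairing l tau) => //; have [h1 h2] := thP _ El; exact: inj.
  by move=> g Wg b Eb; have [h1 h2] := thP _ Eb; rewrite SC// h2.
- move=> f Vf; split; last exact: TK.
  (* As f agrees with S (T f) almost everywhere, the lower bound for [T] is the upper bound for
     [S]. *)
  rewrite ler_pdivrMl// -(eq_ae_L1norm _ _ (ST f Vf)).
  + exact/SK/TW.
  + by have [] := SV _ (TW _ Vf).
  + by case: Vf.
Qed.
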